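(* Let $g(z)$ and $h(z)$ be two even entire functions, each of order lying in $(0,2)$, such that $g(0)=h(0)=1$. Let $\{a_n,\ n\ge 1\}$ and $\{b_n,\ n\ge 1\}$ be two strictly increasing sequences of positive numbers, and suppose that the zeros of $g$ are all simple and are given by $\{\pm a_n,\ n\ge 1\}$, and that the zeros of $h$ are all simple and are given by $\{\pm b_n,\ n\ge 1\}$. Assume that $a_n<b_n$ for all $n$. Then $\varphi(t)=h(it)/g(it)$, $t\in\mathbb{R}$, is the characteristic function of a probability measure on $\mathbb{R}$.
   Context: A ''strictly increasing sequence of positive numbers'' $\{a_n,\ n\ge1\}$ means $0<a_1<a_2<\cdots$ with $\lim_{n\to\infty}a_n=\infty$. The order of an entire function is its usual order of growth. The characteristic function of a probability measure $P$ on $\mathbb{R}$ is $t\mapsto\int e^{itx}\,P(dx)$. *)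

(* Defs.v *)
From HB Require Import structures.
From mathcomp Require Import all_boot all_order all_algebra.
From mathcomp Require Import complex.
From mathcomp Require Import all_classical all_reals all_analysis.

Set Implicit Arguments.
Unset Strict Implicit.
Unset Printing Implicit Defensive.

Import Order.TTheory GRing.Theory Num.Theory.
Import numFieldNormedType.Exports.
Import Normc.

Local Open Scope classical_set_scope.
Local Open Scope ring_scope.
Local Open Scope complex_scope.

(* Complex differentiation: [R[i]^o] is [R[i]] seen as a normed module over
   itself, with the topology of the modulus. *)
Definition entire (R : realType) (f : R[i]^o -> R[i]^o) : Prop :=
  forall z : R[i], derivable f z 1.

Definition even_fun (R : realType) (f : R[i] -> R[i]) : Prop :=
  forall z : R[i], f (- z) = f z.

Definition max_modulus (R : realType) (f : R[i] -> R[i]) (r : R) : R :=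
  sup [set normc (f z) | z in [set z : R[i] | normc z = r]].

(* limsup of log log M(r) / log r as r -> +oo. Since [ln x = 0] for [x <= 0],
   the value is the usual one as soon as M(r) > 1 for r large, hence for every
   non-constant entire function. *)
Definition growth_order (R : realType) (f : R[i] -> R[i]) : \bar R :=
  limf_esup (fun r : R => (ln (ln (max_modulus f r)) / ln r)%:E) +oo.

Definition zero_set (R : realType) (f : R[i] -> R[i]) : set R[i] :=
  [set z | f z = 0].

Definition simple_zero (R : realType) (f : R[i]^o -> R[i]^o) (z : R[i]) : Prop :=
  f z = 0 /\ f^`()%classic z <> 0.

(* The sequence a_1, a_2, ... is indexed from 0: [a n] stands for a_{n+1}. *)
Definition increasing_positive_seq (R : realType) (a : nat -> R) : Prop :=
  [/\ 0 < a 0%N,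
      forall n : nat, a n < a n.+1 &
      a n @[n --> \oo] --> +oo].

Definition expi (R : realType) (x : R) : R[i] := cos x +i* sin x.

Definition Cintegral (d : measure_display) (T : measurableType d)
    (R : realType) (mu : {measure set T -> \bar R}) (f : T -> R[i]) : R[i] :=
  (\int[mu]_x complex.Re (f x)) +i* (\int[mu]_x complex.Im (f x)).

Definition characteristic_function (R : realType)
    (P : probability (measurableTypeR R) R) (t : R) : R[i] :=
  Cintegral P (fun x : R => expi (t * x)).

(* Main.v *)
(**
Let [P_N(t) = prod_(n<N) (1 + t^2/b_n^2) / (1 + t^2/a_n^2)].  Each factor is the
characteristic function of a mixture of a point mass at 0 and a Laplace law, so
[P_N] is the characteristic function of a symmetric variable [X_N], and the
tail [x |-> P(|X_N| > x)] is a finite sum of decaying exponentials.  A maximum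
principle for [y - y''/A^2] shows that these tails are convex and increase with
[N], while they stay below a fixed exponential.  Hence they converge
monotonically to a tail function, whose quantile function, symmetrised, has
characteristic function [lim P_N].

The limit is [h(it)/g(it)] by Hadamard's factorisation.  Dividing the first [N]
pairs of zeros out of [g] leaves an even function [g_N] that is zero-free on
[|z| < a_N], with [log |g_N| = o(a_N^2)] there since the order is less than 2.
The Borel-Caratheodory inequality for even functions gains a factor
[|z|^2/a_N^2], so [g_N] tends to 1.  The complex analysis rests on Goursat's
theorem for [f o exp] on rectangles, that is, on the mean value property.
*)
Require Import Defs.
From HB Require Import structures.
From mathcomp Require Import all_boot all_order all_algebra.
From mathcomp Require Import complex.
From mathcomp Require Import all_classical all_reals all_analysis.
From mathcomp Require Import measurable_realfun.
From mathcomp Require Import ring lra.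
Set Implicit Arguments.
Unset Strict Implicit.
Unset Printing Implicit Defensive.
Import Order.TTheory GRing.Theory Num.Theory.
Import numFieldNormedType.Exports.
Import Normc.
Local Open Scope classical_set_scope.
Local Open Scope ring_scope.
Local Open Scope complex_scope.

(** * Complex differentiability *)

(** The hypothesis [a n < b n] enters through the identity (1 + t^2/b^2) / (1 + t^2/a^2) = p + (1 -
    p) a^2 / (a^2 + t^2) with p = (a/b)^2: both weights are then nonnegative. Laws are handled
    through their tails, by E(1 - cos(tX)) = int_0^oo t sin(tx) P(|X| > x) dx. Monotone tails under
    one integrable bound let the limit pass inside this integral, which replaces tightness and a
    continuity theorem for characteristic functions. The bound is g(i a_1) exp(- a_1 x / 2): at the
    rate l = a_1 / 2 an added Laplace variable of rate a_N costs a factor a_N^2 / (a_N^2 - l^2), at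
    most the factor 1 + a_1^2 / a_N^2 of the product for g(i a_1).

    On the complex side, a quotient by a factor that vanishes at a point is at first only continuous
    there. The mean value property and Cauchy's formula therefore tolerate a finite list [E] of
    radii on which differentiability is unknown: circular means depend continuously on the radius,
    so finitely many circles can be skipped, and Cauchy's formula then shows that there was no
    exception. *)

Section ComplexBasics.
Variable R : realType.
Local Notation C := R[i].
Implicit Types (z w h D : C) (f g : C -> C) (x y e d : R).

Lemma normc_ge0 z : 0 <= normc z.
Proof. by case: z => x y; exact: sqrtr_ge0. Qed.

Lemma normc_gt0 z : (0 < normc z) = (z != 0).
Proof.
rewrite lt_neqAle normc_ge0 andbT eq_sym; congr (~~ _).
by apply/eqP/eqP => [/eq0_normc//|->]; rewrite normc0.
Qed.

Lemma normc_real x : normc x%:C = `|x|.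
Proof. by rewrite /normc /= expr0n addr0 sqrtr_sqr. Qed.

Lemma normci : normc ('i : C) = 1.
Proof. by rewrite /= expr0n add0r expr1n sqrtr1. Qed.

Lemma normcB z w : normc (z - w) = normc (w - z).
Proof. by rewrite -normcN opprB. Qed.

Lemma normcX z n : normc (z ^+ n) = normc z ^+ n.
Proof.
by elim: n => [|n IH]; rewrite ?expr0 ?normc1 // !exprS normcM IH.
Qed.

Lemma le_normc_sub z w : normc z - normc w <= normc (z - w).
Proof. by rewrite lerBlDr (le_trans _ (le_normcD _ _)) ?subrK. Qed.

Lemma le_normc_subr z w : normc w - normc z <= normc (z - w).
Proof. by rewrite normcB le_normc_sub. Qed.

Lemma le_normc_dist u v w : normc (u - w) <= normc (u - v) + normc (v - w).
Proof. by rewrite (le_trans _ (le_normcD _ _)) // addrA subrK. Qed.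

Lemma le_Re_normc z : `|complex.Re z| <= normc z.
Proof.
case: z => x y /=; rewrite -sqrtr_sqr ler_wsqrtr // lerDl; exact: sqr_ge0.
Qed.

Lemma le_Im_normc z : `|complex.Im z| <= normc z.
Proof.
case: z => x y /=; rewrite -sqrtr_sqr ler_wsqrtr // lerDr; exact: sqr_ge0.
Qed.

Lemma le_normc_ReIm z : normc z <= `|complex.Re z| + `|complex.Im z|.
Proof.
rewrite [z in normc z]complexE (le_trans (le_normcD _ _)) // normcM normci.
by rewrite !normc_real mul1r.
Qed.

Lemma normc_conj z : normc (z^*%C) = normc z.
Proof. by case: z => x y /=; rewrite sqrrN. Qed.

Lemma mulc_conj z : z * z^*%C = (normc z ^+ 2)%:C.
Proof.
case: z => x y /=; rewrite sqr_sqrtr ?addr_ge0 ?sqr_ge0 //.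
by apply/eqP; rewrite eq_complex /=; apply/andP; split; apply/eqP; ring.
Qed.

Lemma normc_expi x : normc (expi x) = 1.
Proof. by rewrite /= cos2Dsin2 sqrtr1. Qed.

(** Real radii and the real modulus [normc] keep all estimates in [R]; the topology of [R[i]^o] is
    met only in [derivable_cder]. *)
Definition cnear z (P : C -> Prop) :=
  exists2 d, 0 < d & forall w, normc (w - z) < d -> P w.

Lemma cnear_and z P Q : cnear z P -> cnear z Q -> cnear z (fun w => P w /\ Q w).
Proof.
move=> [d d0 HP] [d' d0' HQ]; exists (Num.min d d'); first by rewrite lt_min d0.
by move=> w; rewrite lt_min => /andP[? ?]; split; [exact: HP|exact: HQ].
Qed.

Lemma cnear_imp z (P Q : C -> Prop) : cnear z P -> (forall w, P w -> Q w) -> cnear z Q.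
Proof. by move=> [d d0 HP] PQ; exists d => // w /HP/PQ. Qed.

Lemma cnear_self z P : cnear z P -> P z.
Proof. by move=> [d d0]; apply; rewrite subrr normc0. Qed.

Definition ccont f z := forall e, 0 < e -> cnear z (fun w => normc (f w - f z) < e).

Lemma ccont_cst c z : ccont (fun=> c) z.
Proof. by move=> e e0; exists 1 => // w _; rewrite subrr normc0. Qed.

Lemma ccont_id z : ccont id z.
Proof. by move=> e e0; exists e. Qed.

Lemma ccontD f g z : ccont f z -> ccont g z -> ccont (fun w => f w + g w) z.
Proof.
move=> cf cg e e0.
apply: cnear_imp (cnear_and (cf (e/2) _) (cg (e/2) _)) _; rewrite ?divr_gt0//.
move=> w [h1 h2]; rewrite opprD addrACA (le_lt_trans (le_normcD _ _))//.
by rewrite [ltRHS](splitr e) ltrD.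
Qed.

Lemma ccontN f z : ccont f z -> ccont (fun w => - f w) z.
Proof.
by move=> cf e /cf/cnear_imp; apply => w; rewrite -opprD normcN.
Qed.

Lemma ccontB f g z : ccont f z -> ccont g z -> ccont (fun w => f w - g w) z.
Proof. by move=> cf cg; apply: ccontD => //; exact: ccontN. Qed.

Lemma ccontM f g z : ccont f z -> ccont g z -> ccont (fun w => f w * g w) z.
Proof.
move=> cf cg e e0.
pose K := 1 + normc (f z) + normc (g z).
have nf := normc_ge0 (f z); have ng := normc_ge0 (g z).
have K0 : 0 < K by rewrite /K; lra.
pose d := Num.min 1 (e / K).
have d0 : 0 < d by rewrite lt_min ltr01 divr_gt0.
have d1 : d <= 1 by rewrite ge_min lexx.
have dK : d * K <= e by rewrite -ler_pdivlMr // ge_min lexx orbT.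
apply: cnear_imp (cnear_and (cf d d0) (cg d d0)) _ => w [h1 h2].
have -> : f w * g w - f z * g z =
  (f w - f z) * (g w - g z) + f z * (g w - g z) + (f w - f z) * g z by ring.
apply: le_lt_trans (le_normcD _ _) _.
apply: le_lt_trans (lerD (le_normcD _ _) (lexx _)) _.
rewrite !normcM.
have A0 := normc_ge0 (f w - f z); have B0 := normc_ge0 (g w - g z).
move: h1 h2 nf ng A0 B0 dK; rewrite /K.
set A := normc (f w - f z); set B := normc (g w - g z).
set F := normc (f z); set G := normc (g z).
move=> Ad Bd F0 G0 A0 B0 dK; apply: lt_le_trans dK.
have : A * B <= A * 1 by rewrite ler_wpM2l //; lra.
have : F * B <= F * d by rewrite ler_wpM2l //; lra.
have : A * G <= d * G by rewrite ler_wpM2r //; lra.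
lra.
Qed.

Lemma cnear_neq0 f z : ccont f z -> f z != 0 ->
  cnear z (fun w => normc (f z) / 2 < normc (f w)).
Proof.
move=> cf fz; have p0 : 0 < normc (f z) / 2 by rewrite divr_gt0 // normc_gt0.
apply: cnear_imp (cf _ p0) _ => w.
by have := le_normc_subr (f w) (f z); lra.
Qed.

Lemma ccontV f z : ccont f z -> f z != 0 -> ccont (fun w => (f w)^-1) z.
Proof.
move=> cf fz e e0; have p0 : 0 < normc (f z) by rewrite normc_gt0.
have q0 : 0 < e * (normc (f z) ^+ 2 / 2) by rewrite mulr_gt0 // divr_gt0 // exprn_gt0.
apply: cnear_imp (cnear_and (cnear_neq0 cf fz) (cf _ q0)) _ => w [h1 h2].
have fw : f w != 0 by rewrite -normc_gt0; lra.
have -> : (f w)^-1 - (f z)^-1 = (f z - f w) / (f w * f z).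
  by field; rewrite fw fz.
rewrite normcM normcV normcM normcB ltr_pdivrMr; last by rewrite mulr_gt0 // normc_gt0.
apply: lt_trans h2 _; rewrite ltr_pM2l // expr2 mulrAC ltr_pM2r //.
Qed.

Lemma ccont_comp f g z : ccont f z -> ccont g (f z) -> ccont (fun w => g (f w)) z.
Proof.
move=> cf cg e /cg[d d0 H]; apply: cnear_imp (cf d d0) _ => w; exact: H.
Qed.

Lemma ccont_near f g z : ccont f z -> cnear z (fun w => f w = g w) -> ccont g z.
Proof.
move=> cf fg e /cf H; apply: cnear_imp (cnear_and H fg) _ => w [+ <-].
by rewrite (cnear_self fg).
Qed.

Lemma ccontX f z n : ccont f z -> ccont (fun w => f w ^+ n) z.
Proof.
move=> cf; elim: n => [|n IH]; first exact: ccont_cst.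
apply: ccont_near (ccontM cf IH) _; exists 1 => // w _; by rewrite exprS.
Qed.

(** Transports an identity to a limit point: from [w] other than [z] to [z] for the uniqueness of
    derivatives, from generic radii to all radii in Cauchy's formula. *)
Lemma ccont_eq f g z : ccont f z -> ccont g z ->
  (forall d, 0 < d -> exists2 w, normc (w - z) < d & f w = g w) -> f z = g z.
Proof.
move=> cf cg H; apply/eqP; rewrite -subr_eq0; apply/negP => /negP n0.
have [d d0 Hd] := cnear_neq0 (ccontB cf cg) n0.
have [w /Hd] := H d d0; rewrite -normc_gt0 in n0.
by move=> + fg; rewrite fg subrr normc0; lra.
Qed.

(* Caratheodory's form of differentiability: the difference quotient extends
   continuously, so that the rules of calculus reduce to those of continuity. *)
Definition cder f z D := exists phi : C -> C,
  [/\ ccont phi z, phi z = D & cnear z (fun w => f w - f z = phi w * (w - z))].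

Lemma cder_cont f z D : cder f z D -> ccont f z.
Proof.
move=> [p [cp _ H]].
have : ccont (fun w => f z + p w * (w - z)) z.
  apply: ccontD; first exact: ccont_cst.
  apply: ccontM => //; apply: ccontB; [exact: ccont_id|exact: ccont_cst].
move/ccont_near; apply; apply: cnear_imp H _ => w <-; ring.
Qed.

Lemma cder_near f g z D : cder f z D -> cnear z (fun w => f w = g w) -> cder g z D.
Proof.
move=> [p [cp pz H]] fg; exists p; split => //.
apply: cnear_imp (cnear_and H fg) _ => w [+ <-].
by rewrite (cnear_self fg).
Qed.

Lemma cder_eq f z D D' : cder f z D -> D = D' -> cder f z D'.
Proof. by move=> ? <-. Qed.

Lemma cder_cst c z : cder (fun=> c) z 0.
Proof.
exists (fun=> 0); split => //; first exact: ccont_cst.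
by exists 1 => // w _; rewrite subrr mul0r.
Qed.

Lemma cder_id z : cder id z 1.
Proof.
exists (fun=> 1); split => //; first exact: ccont_cst.
by exists 1 => // w _; rewrite mul1r.
Qed.

Lemma cderD f g z D E : cder f z D -> cder g z E ->
  cder (fun w => f w + g w) z (D + E).
Proof.
move=> [p [cp pz H]] [q [cq qz K]]; exists (fun w => p w + q w); split.
- exact: ccontD.
- by rewrite pz qz.
- apply: cnear_imp (cnear_and H K) _ => w [h k].
  by rewrite mulrDl -h -k; ring.
Qed.

Lemma cderM f g z D E : cder f z D -> cder g z E ->
  cder (fun w => f w * g w) z (D * g z + f z * E).
Proof.
move=> df dg; have cg := cder_cont dg.
move: df dg => [p [cp pz H]] [q [cq qz K]].
exists (fun w => p w * g w + f z * q w); split.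
- apply: ccontD; apply: ccontM => //; exact: ccont_cst.
- by rewrite pz qz.
- apply: cnear_imp (cnear_and H K) _ => w [h k].
  have -> : f w * g w - f z * g z = (f w - f z) * g w + f z * (g w - g z) by ring.
  by rewrite h k; ring.
Qed.

Lemma cderN f z D : cder f z D -> cder (fun w => - f w) z (- D).
Proof.
move=> df; apply: cder_eq (cder_near (cderM (cder_cst (-1) z) df) _) _.
  by exists 1 => // w _; rewrite mulN1r.
by rewrite mul0r add0r mulN1r.
Qed.

Lemma cderB f g z D E : cder f z D -> cder g z E ->
  cder (fun w => f w - g w) z (D - E).
Proof. by move=> df dg; apply: cderD => //; exact: cderN. Qed.

Lemma cderV f z D : cder f z D -> f z != 0 ->
  cder (fun w => (f w)^-1) z (- D / f z ^+ 2).
Proof.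
move=> df fz; have cf := cder_cont df; have nf := cnear_neq0 cf fz.
case: df => p [cp pz H]; exists (fun w => - p w * (f w * f z)^-1); split.
- apply: ccontM; first exact: ccontN.
  apply: ccontV; last by rewrite mulf_neq0.
  apply: ccontM => //; exact: ccont_cst.
- by rewrite pz expr2.
- apply: cnear_imp (cnear_and H nf) _ => w [h k].
  have fw : f w != 0 by rewrite -normc_gt0 (le_lt_trans _ k)// divr_ge0 ?normc_ge0.
  have -> : (f w)^-1 - (f z)^-1 = - (f w - f z) / (f w * f z).
    by field; rewrite fw fz.
  by rewrite h; field; rewrite fw fz.
Qed.

Lemma cder_comp f g z D E : cder f z D -> cder g (f z) E ->
  cder (fun w => g (f w)) z (E * D).
Proof.
move=> df; have cf := cder_cont df.
move: df => [p [cp pz H]] [q [cq qz [d d0 K]]].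
exists (fun w => q (f w) * p w); split.
- apply: ccontM => //; exact: ccont_comp.
- by rewrite pz qz.
- apply: cnear_imp (cnear_and H (cf _ d0)) _ => w [h k].
  by rewrite -mulrA -h K.
Qed.

Lemma cder_unique f z D E : cder f z D -> cder f z E -> D = E.
Proof.
move=> [p [cp <- H]] [q [cq <- K]].
apply: (@ccont_eq p q z) => // d d0.
have [d' d'0 HK] := cnear_and H K.
pose m := Num.min d d' / 2.
have m0 : 0 < Num.min d d' by rewrite lt_min d0.
have mE : normc (z + m%:C - z) = m.
  by rewrite [z + _]addrC addrK normc_real ger0_norm // divr_ge0 // ltW.
have mlt : m < Num.min d d' by rewrite /m; lra.
have n0 : m%:C != 0 :> C by rewrite -normc_gt0 normc_real normr_gt0 gt_eqF // divr_gt0.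
move: mlt; rewrite lt_min => /andP[md md'].
exists (z + m%:C); first by rewrite mE.
by have [] := HK (z + m%:C); rewrite ?mE // [z + _]addrC addrK => -> /(mulIf n0).
Qed.

Lemma cder_le f z D e : cder f z D -> 0 < e ->
  cnear z (fun w => normc (f w - f z - D * (w - z)) <= e * normc (w - z)).
Proof.
move=> [p [cp pz H]] e0.
apply: cnear_imp (cnear_and H (cp e e0)) _ => w [-> h].
by rewrite -mulrBl normcM -pz ler_wpM2r ?normc_ge0 // ltW.
Qed.

(** The difference quotient, given the value [D] at [z], is continuous there by the estimate, so it
    is Caratheodory's function. *)
Lemma cder_le_intro f z D :
  (forall e, 0 < e ->
    cnear z (fun w => normc (f w - f z - D * (w - z)) <= e * normc (w - z))) ->
  cder f z D.
Proof.
move=> H; exists (fun w => if w == z then D else (f w - f z) / (w - z)); split.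
- move=> e e0; have e20 : 0 < e / 2 by rewrite divr_gt0.
  apply: cnear_imp (H _ e20) _ => w; rewrite eqxx.
  have [->|wz] := eqVneq w z; first by move=> _; rewrite subrr normc0.
  have wz0 : w - z != 0 by rewrite subr_eq0.
  have -> : (f w - f z) / (w - z) - D = (f w - f z - D * (w - z)) / (w - z).
    by field.
  rewrite normcM normcV -ler_pdivrMr ?normc_gt0 // => /le_lt_trans; apply.
  by rewrite ltr_pdivrMr // mulr_natr mulr2n ltrDl.
- by rewrite eqxx.
- exists 1 => // w _; case: eqVneq => [->|wz]; first by rewrite !subrr mulr0.
  by rewrite divfK // subr_eq0.
Qed.

End ComplexBasics.

(** * Integrals and Goursat's theorem *)

Section ComplexIntegral.
Variable R : realType.
Local Notation C := R[i].
Local Notation mu := (@lebesgue_measure R).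
Implicit Types (f g : R -> C) (a b x y e d M : R) (c : C).

(** Relative continuity: both [x] and [y] range over the segment, so nothing is asked of [f] beyond
    its ends. The integrands on a ray or on the side of a rectangle are controlled only there. *)
Definition rcont_on (f : R -> R) a b := forall x, a <= x <= b -> forall e, 0 < e ->
  exists2 d, 0 < d & forall y, a <= y <= b -> `|y - x| < d -> `|f y - f x| < e.

Definition ccont_on f a b := forall x, a <= x <= b -> forall e, 0 < e ->
  exists2 d, 0 < d & forall y, a <= y <= b -> `|y - x| < d -> normc (f y - f x) < e.

Lemma ReB (z w : C) : complex.Re (z - w) = complex.Re z - complex.Re w.
Proof. by case: z w => ? ? []. Qed.

Lemma ImB (z w : C) : complex.Im (z - w) = complex.Im z - complex.Im w.
Proof. by case: z w => ? ? []. Qed.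

Lemma ReD (z w : C) : complex.Re (z + w) = complex.Re z + complex.Re w.
Proof. by case: z w => ? ? []. Qed.

Lemma ImD (z w : C) : complex.Im (z + w) = complex.Im z + complex.Im w.
Proof. by case: z w => ? ? []. Qed.

Lemma ccont_on_Re f a b : ccont_on f a b -> rcont_on (fun x => complex.Re (f x)) a b.
Proof.
move=> cf x xab e e0; have [d d0 H] := cf x xab e e0; exists d => // y yab /H-/(_ yab).
by apply: le_lt_trans; rewrite -ReB le_Re_normc.
Qed.

Lemma ccont_on_Im f a b : ccont_on f a b -> rcont_on (fun x => complex.Im (f x)) a b.
Proof.
move=> cf x xab e e0; have [d d0 H] := cf x xab e e0; exists d => // y yab /H-/(_ yab).
by apply: le_lt_trans; rewrite -ImB le_Im_normc.
Qed.

Lemma rcont_on_within (f : R -> R) a b : rcont_on f a b -> {within `[a, b], continuous f}.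
Proof.
move=> cf; apply/subspace_continuousP => x /= xab; apply/cvgrPdist_lt => e e0.
rewrite in_itv/= in xab; have [d d0 H] := cf x xab e e0.
rewrite near_withinE; apply/nbhs_ballP; exists d => //= y xy; rewrite in_itv/= => yab.
by rewrite distrC; apply: H => //; rewrite distrC.
Qed.

Lemma rcont_on_integrable (f : R -> R) a b : rcont_on f a b -> mu.-integrable `[a, b] (EFin \o f).
Proof.
move=> /rcont_on_within cf; apply: continuous_compact_integrable => //.
exact: segment_compact.
Qed.

Lemma ccont_on_Re_int f a b : ccont_on f a b ->
  mu.-integrable `[a, b] (EFin \o (fun x => complex.Re (f x))).
Proof. by move/ccont_on_Re/rcont_on_integrable. Qed.

Lemma ccont_on_Im_int f a b : ccont_on f a b ->
  mu.-integrable `[a, b] (EFin \o (fun x => complex.Im (f x))).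
Proof. by move/ccont_on_Im/rcont_on_integrable. Qed.

Definition cint a b f : C :=
  (\int[mu]_(x in `[a, b]) complex.Re (f x)) +i*
  (\int[mu]_(x in `[a, b]) complex.Im (f x)).

Lemma eq_cint a b f g : (forall x, a <= x <= b -> f x = g x) -> cint a b f = cint a b g.
Proof.
by move=> H; congr (_ +i* _); apply: eq_Rintegral => x; rewrite inE/= in_itv/= => /H ->.
Qed.

Lemma cintD a b f g : ccont_on f a b -> ccont_on g a b ->
  cint a b (fun x => f x + g x) = cint a b f + cint a b g.
Proof.
move=> cf cg; rewrite /cint.
rewrite [RHS]/(_ + _)/=.
congr (_ +i* _).
- rewrite -RintegralD //; [|exact: ccont_on_Re_int..].
  by apply: eq_Rintegral => x _; rewrite ReD.
- rewrite -RintegralD //; [|exact: ccont_on_Im_int..].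
  by apply: eq_Rintegral => x _; rewrite ImD.
Qed.

Lemma cintZ a b f c : ccont_on f a b -> cint a b (fun x => c * f x) = c * cint a b f.
Proof.
move=> cf; case: c => u v; rewrite /cint.
have iR := ccont_on_Re_int cf; have iI := ccont_on_Im_int cf.
rewrite [RHS]/(_ * _)/=; congr (_ +i* _).
- rewrite -!RintegralZl // -RintegralB //.
  + by apply: eq_Rintegral => x _; case: (f x).
  + exact: (integrableZl _ u iR).
  + exact: (integrableZl _ v iI).
- rewrite -!RintegralZl // -RintegralD //.
  + by apply: eq_Rintegral => x _; case: (f x).
  + exact: (integrableZl _ u iI).
  + exact: (integrableZl _ v iR).
Qed.

Lemma ccont_onD f g a b : ccont_on f a b -> ccont_on g a b ->
  ccont_on (fun x => f x + g x) a b.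
Proof.
move=> cf cg x xab e e0; have e20 : 0 < e / 2 by rewrite divr_gt0.
have [d d0 H] := cf x xab _ e20; have [d' d'0 H'] := cg x xab _ e20.
exists (Num.min d d'); first by rewrite lt_min d0.
move=> y yab; rewrite lt_min => /andP[/H h1 /H' h2].
rewrite opprD addrACA (le_lt_trans (le_normcD _ _))//.
by rewrite [ltRHS](splitr e) ltrD // ?h1 ?h2.
Qed.

Lemma ccont_onZ f c a b : ccont_on f a b -> ccont_on (fun x => c * f x) a b.
Proof.
move=> cf x xab e e0; have n0 := normc_ge0 c.
have p0 : 0 < e / (1 + normc c) by rewrite divr_gt0 // ltr_wpDr.
have [d d0 H] := cf x xab _ p0; exists d => // y yab /(H y yab) h.
rewrite -mulrBr normcM; move: h; rewrite ltr_pdivlMr ?ltr_wpDr // => /le_lt_trans; apply.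
rewrite mulrC ler_wpM2l ?normc_ge0 //; lra.
Qed.

Lemma ccont_onN f a b : ccont_on f a b -> ccont_on (fun x => - f x) a b.
Proof.
move=> /(ccont_onZ (-1)) + x xab e e0 => /(_ x xab e e0)[d d0 H]; exists d => // y yab /(H y yab).
by rewrite !mulN1r.
Qed.

Lemma ccont_on_cst c a b : ccont_on (fun=> c) a b.
Proof. by move=> x xab e e0; exists 1 => // y _ _; rewrite subrr normc0. Qed.

Lemma ccont_onB f g a b : ccont_on f a b -> ccont_on g a b ->
  ccont_on (fun x => f x - g x) a b.
Proof. by move=> cf cg; apply: ccont_onD => //; exact: ccont_onN. Qed.

Lemma cintN a b f : ccont_on f a b -> cint a b (fun x => - f x) = - cint a b f.
Proof.
move=> cf; rewrite -mulN1r -cintZ //; apply: eq_cint => x _; by rewrite mulN1r.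
Qed.

Lemma cintB a b f g : ccont_on f a b -> ccont_on g a b ->
  cint a b (fun x => f x - g x) = cint a b f - cint a b g.
Proof. by move=> cf cg; rewrite cintD ?cintN //; exact: ccont_onN. Qed.

Lemma lebesgue_measure_itvcc a b : a <= b -> fine (mu `[a, b]) = b - a.
Proof.
move=> ab; have -> : mu `[a, b] = (if (a < b)%R then b%:E - a%:E else 0)%E.
  exact: (lebesgue_measure_itv `[a, b]).
have [ab'|ba] := ltP a b; first by [].
by suff -> : a = b; [rewrite subrr|apply: le_anti; rewrite ab].
Qed.

Lemma Rintegral_norm_bound (f : R -> R) a b M : a <= b -> rcont_on f a b ->
  (forall x, a <= x <= b -> `|f x| <= M) ->
  `|\int[mu]_(x in `[a, b]) f x| <= M * (b - a).
Proof.
move=> ab cf fM; have cfi := rcont_on_integrable cf.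
apply: le_trans (le_normr_Rintegral _ cfi) _ => //.
apply: (@le_trans _ _ (\int[mu]_(x in `[a, b]) (cst M x))).
- apply: le_Rintegral => //.
  + exact: integrable_abse cfi.
  + by apply: continuous_compact_integrable; [exact: segment_compact|exact: cst_continuous].
- by rewrite Rintegral_cst // lebesgue_measure_itvcc.
Qed.

(** The factor 2 comes from bounding the real and imaginary parts separately; later estimates have
    room for it. *)
Lemma normc_cint_le a b f M : a <= b -> ccont_on f a b ->
  (forall x, a <= x <= b -> normc (f x) <= M) ->
  normc (cint a b f) <= 2 * M * (b - a).
Proof.
move=> ab cf fM; apply: le_trans (le_normc_ReIm _) _ => /=.
rewrite mulr2n mulrDl mul1r mulrDl lerD //.
- apply: Rintegral_norm_bound => //; first exact: ccont_on_Re.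
  by move=> x /fM; apply: le_trans (le_Re_normc _).
- apply: Rintegral_norm_bound => //; first exact: ccont_on_Im.
  by move=> x /fM; apply: le_trans (le_Im_normc _).
Qed.

Lemma cint_split x a b f : a <= x <= b -> ccont_on f a b ->
  cint a b f = cint a x f + cint x b f.
Proof.
move=> /andP[ax xb] cf; rewrite /cint [RHS]/(_ + _)/=.
have iR := ccont_on_Re_int cf; have iI := ccont_on_Im_int cf.
congr (_ +i* _); apply/eqP; rewrite addrC -subr_eq; apply/eqP.
- rewrite (Rintegral_itvB iR) ?bnd_simp //.
  rewrite Rintegral_itv_obnd_cbnd //.
  by apply: integrableS iR => //; apply: subset_itvr; rewrite bnd_simp.
- rewrite (Rintegral_itvB iI) ?bnd_simp //.
  rewrite Rintegral_itv_obnd_cbnd //.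
  by apply: integrableS iI => //; apply: subset_itvr; rewrite bnd_simp.
Qed.

Lemma ccont_on_sub f a b x y : a <= x -> y <= b -> ccont_on f a b -> ccont_on f x y.
Proof.
move=> ax yb cf z /andP[xz zy] e e0.
have [|d d0 H] := cf z _ e e0; first by rewrite (le_trans ax)//= (le_trans zy).
exists d => // w /andP[xw wy]; apply: H; by rewrite (le_trans ax)//= (le_trans wy).
Qed.

Lemma cint_cst a b c : a <= b -> cint a b (fun=> c) = c * (b - a)%:C.
Proof.
case: c => u v ab; rewrite /cint /= !Rintegral_cst // lebesgue_measure_itvcc //=.
by apply/eqP; rewrite eq_complex /=; apply/andP; split; apply/eqP; ring.
Qed.

End ComplexIntegral.

(** * Bisection principles and continuity along segments *)

Section Goursat.
Variable R : realType.
Local Notation C := R[i].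
Local Notation mu := (@lebesgue_measure R).
Implicit Types (x y l : R).

(** The supremum of the left ends works: since the intervals are nested, every left end is below
    every right end. *)
Lemma nested_point (u w : nat -> R) : (forall n, 0 <= w n) ->
  (forall n, u n <= u n.+1) -> (forall n, u n.+1 + w n.+1 <= u n + w n) ->
  exists p, forall n, u n <= p <= u n + w n.
Proof.
move=> w0 u1 uw.
have umono : {homo u : n m / (n <= m)%N >-> n <= m}.
  by apply: homo_leq => //; exact: le_trans.
have vmono (n m : nat) : (n <= m)%N -> u m + w m <= u n + w n.
  elim: m => [|m IH]; first by rewrite leqn0 => /eqP->.
  by rewrite leq_eqVlt => /orP[/eqP->//|]; rewrite ltnS => /IH; apply: le_trans.
have ub n k : u k <= u n + w n.
  apply: le_trans (umono k (maxn n k) (leq_maxr _ _)) _.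
  apply: le_trans (vmono n (maxn n k) (leq_maxl _ _)); by rewrite lerDl.
exists (sup (range u)) => n; apply/andP; split.
- apply: ub_le_sup; last by exists n.
  by exists (u 0%N + w 0%N) => _ [k _ <-].
- by apply: ge_sup; [exists (u n), n|move=> _ [k _ <-]].
Qed.

Lemma expn2_small (L d : R) : 0 < L -> 0 < d -> exists n, L / 2 ^+ n < d.
Proof.
move=> L0 d0; exists (Num.bound (L / d)).
rewrite ltr_pdivrMr ?exprn_gt0 // mulrC -ltr_pdivrMr //.
have Ld : 0 <= L / d by rewrite divr_ge0 // ltW.
apply: (lt_trans (archi_boundP Ld)).
by rewrite -natrX ltr_nat ltn_expl.
Qed.

(** Compactness as an induction principle: if [P] failed, it would fail on nested quarters shrinking
    to a point, near which [P] holds. It serves Goursat's theorem, boundedness on discs and, in one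
    dimension, uniformity over a segment. *)
Lemma rect_bisect (P : R -> R -> R -> R -> Prop) X Y L M : 0 < L -> 0 < M ->
  (forall x y l m, 0 < l -> 0 < m ->
    P x y (l / 2) (m / 2) -> P (x + l / 2) y (l / 2) (m / 2) ->
    P x (y + m / 2) (l / 2) (m / 2) -> P (x + l / 2) (y + m / 2) (l / 2) (m / 2) ->
    P x y l m) ->
  (forall p q, exists2 d, 0 < d & forall x y l m, x <= p <= x + l ->
    y <= q <= y + m -> 0 < l < d -> 0 < m < d -> P x y l m) ->
  P X Y L M.
Proof.
move=> L0 M0 sub loc; apply: contrapT => nP.
pose l n := L / 2 ^+ n; pose m n := M / 2 ^+ n.
have l0 n : 0 < l n by rewrite divr_gt0 // exprn_gt0.
have m0 n : 0 < m n by rewrite divr_gt0 // exprn_gt0.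
have lS n : l n.+1 = l n / 2 by rewrite /l exprS invfM mulrA mulrAC.
have mS n : m n.+1 = m n / 2 by rewrite /m exprS invfM mulrA mulrAC.
(* [next] sends a level and the corner of a bad rectangle to the corner of a bad quarter. The level
   is an argument because it determines the side lengths. *)
have /choice[next nextP] : forall a : nat * (R * R), exists b : R * R,
    ~ P a.2.1 a.2.2 (l a.1) (m a.1) ->
    [/\ ~ P b.1 b.2 (l a.1.+1) (m a.1.+1),
      a.2.1 <= b.1 /\ b.1 + l a.1.+1 <= a.2.1 + l a.1 &
      a.2.2 <= b.2 /\ b.2 + m a.1.+1 <= a.2.2 + m a.1].
  move=> [n [x y]] /=; rewrite lS mS.
  have ln := l0 n; have mn := m0 n.
  have [P1|] := pselect (P x y (l n / 2) (m n / 2)); last first.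
    by exists (x, y) => _; split => //=; lra.
  have [P2|] := pselect (P (x + l n / 2) y (l n / 2) (m n / 2)); last first.
    by exists (x + l n / 2, y) => _; split => //=; lra.
  have [P3|] := pselect (P x (y + m n / 2) (l n / 2) (m n / 2)); last first.
    by exists (x, y + m n / 2) => _; split => //=; lra.
  have [P4|] := pselect (P (x + l n / 2) (y + m n / 2) (l n / 2) (m n / 2)); last first.
    by exists (x + l n / 2, y + m n / 2) => _; split => //=; lra.
  by exists (x, y) => /(_ (sub _ _ _ _ ln mn P1 P2 P3 P4)).
pose s := fix s n := if n is k.+1 then next (k, s k) else (X, Y).
have sP n : ~ P (s n).1 (s n).2 (l n) (m n).
  elim: n => [|n IH]; first by rewrite /= /l /m !expr0 !divr1.
  by have [] := nextP (n, s n) IH.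
have [p pP] : exists p, forall n, (s n).1 <= p <= (s n).1 + l n.
  apply: nested_point => n; [exact: ltW|..].
  - by have [_ []] := nextP (n, s n) (sP n).
  - by have [_ []] := nextP (n, s n) (sP n).
have [q qP] : exists q, forall n, (s n).2 <= q <= (s n).2 + m n.
  apply: nested_point => n; [exact: ltW|..].
  - by have [_ _ []] := nextP (n, s n) (sP n).
  - by have [_ _ []] := nextP (n, s n) (sP n).
have [d d0 H] := loc p q.
have [n1 Hn1] := expn2_small L0 d0; have [n2 Hn2] := expn2_small M0 d0.
pose n := maxn n1 n2.
apply: (sP n); apply: H => //; rewrite ?l0 ?m0 /=.
- apply: le_lt_trans Hn1; rewrite ler_pM2l // lef_pV2 ?posrE ?exprn_gt0 //.
  by rewrite ler_eXn2l ?leq_maxl // ltr1n.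
- apply: le_lt_trans Hn2; rewrite ler_pM2l // lef_pV2 ?posrE ?exprn_gt0 //.
  by rewrite ler_eXn2l ?leq_maxr // ltr1n.
Qed.

Lemma seg_bisect (P : R -> R -> Prop) X L : 0 < L ->
  (forall x l, 0 < l -> P x (l / 2) -> P (x + l / 2) (l / 2) -> P x l) ->
  (forall p, exists2 d, 0 < d & forall x l, x <= p <= x + l -> 0 < l < d -> P x l) ->
  P X L.
Proof.
move=> L0 sub loc.
apply: (@rect_bisect (fun x _ l _ => P x l) X 0 L 1) => //.
- by move=> x y l m l0 _ P1 P2 _ _; exact: sub.
- by move=> p q; have [d d0 H] := loc p; exists d => // x y l m xl _ ld _; exact: H.
Qed.

Lemma subcE (x y x' y' : R) : (x +i* y) - (x' +i* y') = (x - x') +i* (y - y') :> C.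
Proof. by []. Qed.

Lemma ccont_on_comp (F : C -> C) (c : R -> C) a b K :
  (forall x y, normc (c x - c y) <= K * `|x - y|) ->
  (forall x, a <= x <= b -> ccont F (c x)) ->
  ccont_on (fun x => F (c x)) a b.
Proof.
move=> cK cF x xab e e0; have [d d0 H] := cF x xab e e0.
exists (d / (1 + `|K|)); first by rewrite divr_gt0 // ltr_wpDr.
move=> y yab; rewrite ltr_pdivlMr ?ltr_wpDr // => yx.
apply: H; apply: le_lt_trans (cK y x) _; apply: le_lt_trans yx.
by rewrite mulrC ler_wpM2l // (le_trans (ler_norm _)) // lerDr.
Qed.

Lemma ccont_on_hor (F : C -> C) a b t :
  (forall s, a <= s <= b -> ccont F (s +i* t)) -> ccont_on (fun s => F (s +i* t)) a b.
Proof.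
apply: (@ccont_on_comp F (fun s => s +i* t) a b 1) => x y.
by rewrite mul1r subcE subrr normc_real.
Qed.

Lemma ccont_on_ver (F : C -> C) a b s :
  (forall t, a <= t <= b -> ccont F (s +i* t)) -> ccont_on (fun t => F (s +i* t)) a b.
Proof.
apply: (@ccont_on_comp F (fun t => s +i* t) a b 1) => x y.
by rewrite mul1r subcE subrr /= expr0n add0r sqrtr_sqr.
Qed.

Lemma is_derive_continuous (f : R -> R) x d : is_derive x (1 : R) f d -> {for x, continuous f}.
Proof. by move=> [df _]; apply: differentiable_continuous; exact/derivable1_diffP. Qed.

Lemma derivable_LR (f f' : R -> R) a b : (forall x, is_derive x (1 : R) f (f' x)) ->
  derivable_oo_LRcontinuous f a b.
Proof.
move=> df; split.
- by move=> x _; have [] := df x.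
- exact/cvg_at_right_filter/(is_derive_continuous (df a)).
- exact/cvg_at_left_filter/(is_derive_continuous (df b)).
Qed.

Lemma Rintegral_id a b : a < b -> \int[mu]_(x in `[a, b]) x = (b ^+ 2 - a ^+ 2) / 2.
Proof.
move=> ab; rewrite /Rintegral.
have dF x : is_derive x (1 : R) (fun x : R => x ^+ 2 / 2) x.
  apply: is_derive_eq; rewrite /GRing.scale /= ; by field.
rewrite (@continuous_FTC2 _ _ (fun x => x ^+ 2 / 2)) //=.
- by rewrite mulrBl.
- by apply: continuous_subspaceT => x; exact: cvg_id.
- exact: derivable_LR dF.
- by move=> x _; rewrite derive1E; have [_ ->] := dF x.
Qed.

Lemma cint_id a b : a < b -> cint a b (fun x => x%:C) = ((b ^+ 2 - a ^+ 2) / 2)%:C.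
Proof.
move=> ab; rewrite /cint /= Rintegral_id //; congr (_ +i* _).
by rewrite Rintegral_cst // mul0r.
Qed.

End Goursat.

(** * Contour integrals over rectangles *)

Section RectInt.
Variable R : realType.
Local Notation C := R[i].
Implicit Types (F G : C -> C) (x y l m B : R).

(** The integral of F(z) dz counterclockwise: bottom minus top, then right minus left with dz = i
    dt. *)
Definition rect_int F x y l m : C :=
  cint x (x + l) (fun s => F (s +i* y)) - cint x (x + l) (fun s => F (s +i* (y + m)))
  + 'i%C * (cint y (y + m) (fun t => F ((x + l) +i* t)) - cint y (y + m) (fun t => F (x +i* t))).

Definition on_rect x y l m (P : C -> Prop) :=
  forall s t, x <= s <= x + l -> y <= t <= y + m -> P (s +i* t).

Lemma on_rect_hor F x y l m t : on_rect x y l m (ccont F) -> y <= t <= y + m ->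
  ccont_on (fun s => F (s +i* t)) x (x + l).
Proof. by move=> cF ty; apply: ccont_on_hor => s sx; exact: cF. Qed.

Lemma on_rect_ver F x y l m s : on_rect x y l m (ccont F) -> x <= s <= x + l ->
  ccont_on (fun t => F (s +i* t)) y (y + m).
Proof. by move=> cF sx; apply: ccont_on_ver => t ty; exact: cF. Qed.

Lemma rect_int_split F x y h k : 0 <= h -> 0 <= k ->
  on_rect x y (h + h) (k + k) (ccont F) ->
  rect_int F x y (h + h) (k + k) =
  rect_int F x y h k + rect_int F (x + h) y h k +
  (rect_int F x (y + k) h k + rect_int F (x + h) (y + k) h k).
Proof.
move=> h0 k0 cF; rewrite /rect_int.
have hx : x <= x + h <= x + (h + h) by apply/andP; split; lra.
have ky : y <= y + k <= y + (k + k) by apply/andP; split; lra.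
rewrite (cint_split hx (on_rect_hor (t := y) cF _)); last by apply/andP; split; lra.
rewrite (cint_split hx (on_rect_hor (t := y + (k + k)) cF _)); last by apply/andP; split; lra.
rewrite (cint_split ky (on_rect_ver (s := x) cF _)); last by apply/andP; split; lra.
rewrite (cint_split ky (on_rect_ver (s := x + (h + h)) cF _)); last by apply/andP; split; lra.
rewrite !addrA; ring.
Qed.

Lemma rect_int_bound F x y l m B : 0 <= l -> 0 <= m ->
  on_rect x y l m (ccont F) -> on_rect x y l m (fun w => normc (F w) <= B) ->
  normc (rect_int F x y l m) <= 4 * B * (l + m).
Proof.
move=> l0 m0 cF FB; rewrite /rect_int.
have xx : x <= x + l by lra.
have yy : y <= y + m by lra.
have H t : y <= t <= y + m -> normc (cint x (x + l) (fun s => F (s +i* t))) <= 2 * B * l.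
  move=> ty; have := normc_cint_le xx (on_rect_hor cF ty) (fun s sx => FB s t sx ty).
  by have -> : x + l - x = l by ring.
have V s : x <= s <= x + l -> normc (cint y (y + m) (fun t => F (s +i* t))) <= 2 * B * m.
  move=> sx; have := normc_cint_le yy (on_rect_ver cF sx) (fun t ty => FB s t sx ty).
  by have -> : y + m - y = m by ring.
have H1 := H y; have H2 := H (y + m); have V1 := V x; have V2 := V (x + l).
apply: le_trans (le_normcD _ _) _; rewrite normcM normci mul1r.
apply: le_trans (lerD (le_normcD _ _) (le_normcD _ _)) _; rewrite !normcN.
have {}H1 := H1 ltac:(by rewrite lexx).
have {}H2 := H2 ltac:(by rewrite lexx andbT).
have {}V1 := V1 ltac:(by rewrite lexx).
have {}V2 := V2 ltac:(by rewrite lexx andbT).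
lra.
Qed.

Lemma rect_intB F G x y l m : 0 <= l -> 0 <= m ->
  on_rect x y l m (ccont F) -> on_rect x y l m (ccont G) ->
  rect_int (fun w => F w - G w) x y l m = rect_int F x y l m - rect_int G x y l m.
Proof.
move=> l0 m0 cF cG; rewrite /rect_int.
have xl : x <= x + l <= x + l by apply/andP; split; lra.
have xx : x <= x <= x + l by apply/andP; split; lra.
have ym : y <= y + m <= y + m by apply/andP; split; lra.
have yy : y <= y <= y + m by apply/andP; split; lra.
rewrite (cintB (on_rect_hor cF yy) (on_rect_hor cG yy)).
rewrite (cintB (on_rect_hor cF ym) (on_rect_hor cG ym)).
rewrite (cintB (on_rect_ver cF xl) (on_rect_ver cG xl)).
rewrite (cintB (on_rect_ver cF xx) (on_rect_ver cG xx)).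
ring.
Qed.

Lemma cint_affine (a b : R) (A D : C) : a < b ->
  cint a b (fun s => A + D * s%:C) = A * (b - a)%:C + D * ((b ^+ 2 - a ^+ 2) / 2)%:C.
Proof.
move=> ab; have cid : ccont_on (fun s : R => s%:C : C) a b.
  apply: (@ccont_on_comp R id (fun s => s%:C) a b 1) => [x y|x _]; last exact: ccont_id.
  by rewrite -rmorphB normc_real mul1r.
rewrite cintD; [|exact: ccont_on_cst|exact: ccont_onZ].
by rewrite cint_cst ?ltW // cintZ // cint_id.
Qed.

(** The explicit integrals of 1 and of the variable suffice here: Goursat's argument only needs the
    tangent part of [F] to contribute nothing. *)
Lemma rect_int_affine (A D p : C) x y l m : 0 < l -> 0 < m ->
  rect_int (fun w => A + D * (w - p)) x y l m = 0.
Proof.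
move=> l0 m0; rewrite /rect_int.
have xx : x < x + l by lra.
have yy : y < y + m by lra.
have H t : cint x (x + l) (fun s => A + D * (s +i* t - p)) =
    (A + D * ('i%C * t%:C - p)) * (x + l - x)%:C + D * (((x + l) ^+ 2 - x ^+ 2) / 2)%:C.
  rewrite -cint_affine //; apply: eq_cint => s _; rewrite [s +i* t]complexE /=; ring.
have V s : cint y (y + m) (fun t => A + D * (s +i* t - p)) =
    (A + D * (s%:C - p)) * (y + m - y)%:C + 'i%C * D * (((y + m) ^+ 2 - y ^+ 2) / 2)%:C.
  rewrite -cint_affine //; apply: eq_cint => t _; rewrite [s +i* t]complexE /=; ring.
rewrite !H !V !(rmorphD, rmorphB, rmorphM, rmorphXn, rmorphN) /=.
have := sqr_i R; set I := 'i%C => I2; ring: I2.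
Qed.

(** Subtracting the tangent map at [p] leaves an integrand of size at most [e / 4 * (l + m)]; the 4
    cancels that of [rect_int_bound]. *)
Lemma rect_int_bisect_local F e (p : C) D : cder F p D -> 0 < e ->
  exists2 d, 0 < d & forall x y l m, x <= complex.Re p <= x + l ->
    y <= complex.Im p <= y + m -> 0 < l < d -> 0 < m < d ->
    on_rect x y l m (ccont F) -> normc (rect_int F x y l m) <= e * (l + m) ^+ 2.
Proof.
move=> dF e0; have e40 : 0 < e / 4 by rewrite divr_gt0.
have [d d0 H] := cder_le dF e40.
(* Points of the rectangle lie within [l + m] of [p], hence within [d]. *)
exists (d / 2); first by rewrite divr_gt0.
move=> x y l m xp yp /andP[l0 ld] /andP[m0 md] cF.
pose A w := F p + D * (w - p).
have cA w : ccont A w.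
  apply: ccontD; first exact: ccont_cst.
  apply: ccontM; first exact: ccont_cst.
  by apply: ccontB; [exact: ccont_id|exact: ccont_cst].
have -> : rect_int F x y l m = rect_int (fun w => F w - A w) x y l m.
  by rewrite rect_intB ?ltW // rect_int_affine // subr0.
have -> : e * (l + m) ^+ 2 = 4 * (e / 4 * (l + m)) * (l + m) by field.
apply: rect_int_bound; [exact: ltW..| |].
  by move=> s t sx ty; apply: ccontB => //; exact: cF.
move=> s t sx ty.
have n1 : normc (s +i* t - p) <= l + m.
  apply: le_trans (le_normc_ReIm _) _.
  move: xp yp sx ty; case: p {H A cA dF} => u v /= /andP[? ?] /andP[? ?] /andP[? ?] /andP[? ?].
  by apply: lerD; rewrite ler_norml; apply/andP; split; lra.
have -> : F (s +i* t) - A (s +i* t) = F (s +i* t) - F p - D * (s +i* t - p).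
  by rewrite /A; ring.
apply: le_trans (H _ _) _; first by apply: le_lt_trans n1 _; lra.
by rewrite ler_wpM2l // ltW.
Qed.

(** The bound [e * (l + m) ^+ 2] is additive under quartering, each quarter contributing
    [e * ((l + m) / 2) ^+ 2], so the local estimate becomes a global one for every [e]. *)
Lemma goursat F x y l m : 0 < l -> 0 < m ->
  on_rect x y l m (fun w => exists D, cder F w D) -> rect_int F x y l m = 0.
Proof.
move=> l0 m0 dF.
have cF : on_rect x y l m (ccont F) by move=> s t sx ty; have [D /cder_cont] := dF s t sx ty.
apply: eq0_normc; apply/eqP; rewrite eq_le normc_ge0 andbT.
apply/ler_addgt0Pl => e e0; rewrite addr0.
have lm0 : 0 < (l + m) ^+ 2 by rewrite exprn_gt0 // addr_gt0.
suff : normc (rect_int F x y l m) <= e / (l + m) ^+ 2 * (l + m) ^+ 2.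
  by rewrite divfK // gt_eqF.
have : 0 < e / (l + m) ^+ 2 by rewrite divr_gt0.
move: (e / _) => {e0}e e0.
(* Containment in the given rectangle is part of [P], which makes the local claim vacuous at points
   outside it. *)
pose P x' y' l' m' := x <= x' -> x' + l' <= x + l -> y <= y' -> y' + m' <= y + m ->
  normc (rect_int F x' y' l' m') <= e * (l' + m') ^+ 2.
have : P x y l m; last by apply; rewrite lexx.
apply: rect_bisect => //.
- move=> x' y' l' m' l'0 m'0 P1 P2 P3 P4 h1 h2 h3 h4.
  have [{1}-> {1}->] : l' = l' / 2 + l' / 2 /\ m' = m' / 2 + m' / 2 by split; field.
  rewrite rect_int_split; [|by rewrite divr_ge0 // ltW..|]; last first.
    by move=> s t /andP[? ?] /andP[? ?]; apply: cF; apply/andP; split; lra.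
  have {}P1 := P1 ltac:(lra) ltac:(lra) ltac:(lra) ltac:(lra).
  have {}P2 := P2 ltac:(lra) ltac:(lra) ltac:(lra) ltac:(lra).
  have {}P3 := P3 ltac:(lra) ltac:(lra) ltac:(lra) ltac:(lra).
  have {}P4 := P4 ltac:(lra) ltac:(lra) ltac:(lra) ltac:(lra).
  apply: le_trans (le_normcD _ _) _.
  apply: le_trans (lerD (le_normcD _ _) (le_normcD _ _)) _.
  have -> : e * (l' + m') ^+ 2 = 4 * (e * (l' / 2 + m' / 2) ^+ 2) by field.
  lra.
- move=> p q.
  have [/andP[/andP[px px'] /andP[qy qy']]|npq] := boolP ((x <= p <= x + l) && (y <= q <= y + m)).
    have [|//|D dp] := dF p q; rewrite ?px ?qy //.
    have [d d0 H] := rect_int_bisect_local dp e0.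
    exists d => // x' y' l' m' xp yq l'0 m'0 h1 h2 h3 h4; apply: H => //.
    by move=> s t /andP[? ?] /andP[? ?]; apply: cF; apply/andP; split; lra.
  exists 1 => // x' y' l' m' /andP[? ?] /andP[? ?] _ _ ? ? ? ?; exfalso.
  move/negP: npq; apply; apply/andP; split; apply/andP; split; lra.
Qed.

End RectInt.

(** * The complex exponential and the mean value property *)

Section ComplexExp.
Variable R : realType.
Local Notation C := R[i].
Implicit Types (x y t : R) (z w h : C).

(** Stated without an order between [x] and [y], so that Taylor estimates at 0 cover both signs at
    once. *)
Lemma real_mvt (f f' : R -> R) x y : (forall u, is_derive u (1 : R) f (f' u)) ->
  exists2 c, `|c - x| <= `|y - x| & f y - f x = f' c * (y - x).
Proof.
move=> df.
have cf a b : {within `[a, b], continuous f}.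
  by apply: continuous_subspaceT => u; exact: is_derive_continuous (df u).
have [xy|yx] := leP x y.
  have [c] := MVT_segment xy (fun u _ => df u) (cf x y).
  rewrite in_itv/= => /andP[xc cy] E; exists c => //.
  by rewrite !ger0_norm ?subr_ge0 // lerB.
have [c] := MVT_segment (ltW yx) (fun u _ => df u) (cf y x).
rewrite in_itv/= => /andP[yc cx] E; exists c.
  by rewrite ![`|_ - x|]distrC !ger0_norm ?subr_ge0 // ?lerB // ltW.
by rewrite -opprB E; ring.
Qed.

Lemma sin_norm_le x : `|sin x| <= `|x|.
Proof.
have [c _] := @real_mvt sin cos 0 x (fun u => is_derive_sin u).
rewrite sin0 !subr0 => ->; rewrite normrM ler_piMl //; exact: cos_max.
Qed.

Lemma cos_sub1_le x : `|cos x - 1| <= x ^+ 2.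
Proof.
have [c] := @real_mvt cos (fun u => - sin u) 0 x (fun u => is_derive_cos u).
rewrite cos0 !subr0 => cx ->; rewrite normrM normrN -real_normK ?num_real // expr2.
by rewrite ler_wpM2r // (le_trans (sin_norm_le _)).
Qed.

Lemma sin_sub_le x : `|sin x - x| <= `|x| * x ^+ 2.
Proof.
have [c] := @real_mvt sin cos 0 x (fun u => is_derive_sin u).
rewrite sin0 !subr0 => cx ->; rewrite -[X in _ - X]mul1r -mulrBl normrM mulrC ler_wpM2l //.
apply: le_trans (cos_sub1_le c) _.
by rewrite -(real_normK (num_real c)) -(real_normK (num_real x)) lerXn2r ?nnegrE.
Qed.

Lemma expR_sub1_le x : `|x| <= 1 -> `|expR x - 1| <= expR 1 * `|x|.
Proof.
move=> x1; have [c] := @real_mvt expR expR 0 x (fun u => is_derive_expR u).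
rewrite expR0 !subr0 => cx ->; rewrite normrM ler_wpM2r // ger0_norm ?expR_ge0 //.
by rewrite ler_expR (le_trans (ler_norm _)) // (le_trans cx).
Qed.

Lemma expR_sub1x_le x : `|x| <= 1 -> `|expR x - 1 - x| <= expR 1 * x ^+ 2.
Proof.
move=> x1; have [c] := @real_mvt expR expR 0 x (fun u => is_derive_expR u).
rewrite expR0 !subr0 => cx ->; rewrite -[X in _ - X]mul1r -mulrBl normrM.
rewrite -(real_normK (num_real x)) expr2 mulrA ler_wpM2r //.
apply: le_trans (expR_sub1_le (le_trans cx x1)) _.
by rewrite ler_wpM2l ?expR_ge0.
Qed.

Lemma expiD x y : expi (x + y) = expi x * expi y.
Proof.
apply/eqP; rewrite eq_complex /= cosD sinD; apply/andP; split; apply/eqP => //; ring.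
Qed.

Lemma expi0 : expi 0 = 1 :> C.
Proof. by rewrite /expi cos0 sin0. Qed.

Lemma expi_sub1_le y : normc (expi y - 1) <= 2 * `|y|.
Proof.
have [y1|y1] := leP `|y| 1; last first.
  apply: le_trans (le_normcD _ _) _; rewrite normcN normc1 normc_expi; lra.
apply: le_trans (le_normc_ReIm _) _; rewrite /= subr0.
have := cos_sub1_le y; have := sin_norm_le y.
have : y ^+ 2 <= `|y| by rewrite -(real_normK (num_real y)) expr2 ler_piMl.
lra.
Qed.

Lemma expi_lip x y : normc (expi x - expi y) <= 2 * `|x - y|.
Proof.
have -> : expi x = expi y * expi (x - y) by rewrite -expiD addrC subrK.
rewrite -[X in _ - X]mulr1 -mulrBr normcM normc_expi mul1r; exact: expi_sub1_le.
Qed.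

Lemma expi_sub1i_le y : `|y| <= 1 -> normc (expi y - 1 - 'i%C * y%:C) <= 2 * y ^+ 2.
Proof.
move=> y1; apply: le_trans (le_normc_ReIm _) _.
rewrite !ReB !ImB /= !(mul0r,mulr0,mul1r,oppr0,subr0,add0r,addr0).
have := cos_sub1_le y; have := sin_sub_le y.
have : `|y| * y ^+ 2 <= y ^+ 2 by rewrite ler_piMl // sqr_ge0.
lra.
Qed.

Definition cexp z : C := (expR (complex.Re z))%:C * expi (complex.Im z).

Lemma cexpD z w : cexp (z + w) = cexp z * cexp w.
Proof. by rewrite /cexp ReD ImD expRD expiD rmorphM /=; ring. Qed.

Lemma cexp0 : cexp 0 = 1.
Proof. by rewrite /cexp /= expR0 expi0 mul1r. Qed.

Lemma normc_cexp z : normc (cexp z) = expR (complex.Re z).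
Proof. by rewrite normcM normc_expi mulr1 normc_real ger0_norm ?expR_ge0. Qed.

Lemma cexp_neq0 z : cexp z != 0.
Proof. by rewrite -normc_gt0 normc_cexp expR_gt0. Qed.

Lemma cexpN z : cexp (- z) = (cexp z)^-1.
Proof.
apply: (mulfI (cexp_neq0 z)); rewrite -cexpD subrr cexp0 divff //; exact: cexp_neq0.
Qed.

Lemma cexp_sub1_le h : normc h <= 1 ->
  normc (cexp h - 1 - h) <= (3 * expR 1 + 2) * normc h ^+ 2.
Proof.
move=> h1; set x := complex.Re h; set y := complex.Im h.
have hx : `|x| <= normc h := le_Re_normc h.
have hy : `|y| <= normc h := le_Im_normc h.
(* Two second-order remainders and a product of two first-order terms; their constants are [expR 1],
   2 and [2 * expR 1]. *)
have -> : cexp h - 1 - h = (expR x - 1 - x)%:C + (expi y - 1 - 'i%C * y%:C)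
    + (expR x - 1)%:C * (expi y - 1).
  by rewrite [X in _ - X]complexE /cexp -/x -/y !rmorphB /= rmorph1; ring.
apply: le_trans (le_normcD _ _) _.
apply: le_trans (lerD (le_normcD _ _) (lexx _)) _.
rewrite normcM !normc_real.
have x1 := le_trans hx h1; have y1 := le_trans hy h1.
have A := expR_sub1x_le x1; have B := expi_sub1i_le y1.
have D := ler_pM (normr_ge0 _) (normc_ge0 _) (expR_sub1_le x1) (expi_sub1_le y).
have e0 : 0 < expR 1 :> R := expR_gt0 _.
have hx2 : x ^+ 2 <= normc h ^+ 2.
  by rewrite -(real_normK (num_real x)) lerXn2r ?nnegrE ?normc_ge0.
have hy2 : y ^+ 2 <= normc h ^+ 2.
  by rewrite -(real_normK (num_real y)) lerXn2r ?nnegrE ?normc_ge0.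
have hxy : `|x| * `|y| <= normc h ^+ 2 by rewrite expr2 ler_pM.
have : expR 1 * x ^+ 2 <= expR 1 * normc h ^+ 2 by rewrite ler_pM2l.
have : expR 1 * (`|x| * `|y|) <= expR 1 * normc h ^+ 2 by rewrite ler_pM2l.
rewrite (_ : expR 1 * `|x| * (2 * `|y|) = 2 * (expR 1 * (`|x| * `|y|))) in D; last by ring.
lra.
Qed.

Lemma cder_cexp z : cder cexp z (cexp z).
Proof.
apply: cder_le_intro => e e0.
pose K := 1 + normc (cexp z) * (3 * expR 1 + 2).
have K0 : 0 < K.
  rewrite /K addrC ltr_wpDl // mulr_ge0 ?normc_ge0 // addr_ge0 // mulr_ge0 //; exact: expR_ge0.
exists (Num.min 1 (e / K)); first by rewrite lt_min ltr01 divr_gt0.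
move=> w; rewrite lt_min ltr_pdivlMr // => /andP[/ltW h1 hK].
have -> : cexp w - cexp z - cexp z * (w - z) = cexp z * (cexp (w - z) - 1 - (w - z)).
  have -> : cexp w = cexp z * cexp (w - z) by rewrite -cexpD addrC subrK.
  ring.
rewrite normcM; apply: le_trans (ler_wpM2l (normc_ge0 _) (cexp_sub1_le h1)) _.
rewrite mulrA expr2 mulrA ler_wpM2r ?normc_ge0 //.
apply: le_trans (ltW hK); rewrite mulrC ler_wpM2l ?normc_ge0 // /K; lra.
Qed.

End ComplexExp.

(** * Integrals over circles *)

Section MeanValue.
Variable R : realType.
Local Notation C := R[i].
Implicit Types (x y t r e : R) (z w : C) (G : C -> C).

Lemma pi2_gt0 : 0 < pi *+ 2 :> R.
Proof. by rewrite mulrn_wgt0 // pi_gt0. Qed.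

(** The integral of G(z) dz / (iz) over |z| = r. This normalisation is why the Cauchy kernel appears
    below as z / (z - w). *)
Definition circ r G : C := cint 0 (pi *+ 2) (fun t => G (r%:C * expi t)).

Lemma circ_arc_lip r x y : normc (r%:C * expi x - r%:C * expi y) <= `|r| * 2 * `|x - y|.
Proof.
by rewrite -mulrBr normcM normc_real -mulrA ler_wpM2l // expi_lip.
Qed.

Lemma normc_arc r t : normc (r%:C * expi t) = `|r|.
Proof. by rewrite normcM normc_expi mulr1 normc_real. Qed.

Lemma ccont_on_circ r G : 0 <= r -> (forall z, normc z = r -> ccont G z) ->
  ccont_on (fun t => G (r%:C * expi t)) 0 (pi *+ 2).
Proof.
move=> r0 cG; apply: (ccont_on_comp (circ_arc_lip r)) => t _.
by apply: cG; rewrite normc_arc ger0_norm.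
Qed.

Lemma circ_le r G B : 0 <= r -> (forall z, normc z = r -> ccont G z) ->
  (forall z, normc z = r -> normc (G z) <= B) -> normc (circ r G) <= 2 * B * (pi *+ 2).
Proof.
move=> r0 cG GB; rewrite -[X in _ * X]subr0; apply: normc_cint_le.
- exact/ltW/pi2_gt0.
- exact: ccont_on_circ.
- by move=> t _; apply: GB; rewrite normc_arc ger0_norm.
Qed.

Lemma eq_circ r G H : 0 <= r -> (forall z, normc z = r -> G z = H z) -> circ r G = circ r H.
Proof.
by move=> r0 GH; apply: eq_cint => t _; apply: GH; rewrite normc_arc ger0_norm.
Qed.

Lemma circD r G H : 0 <= r -> (forall z, normc z = r -> ccont G z) ->
  (forall z, normc z = r -> ccont H z) -> circ r (fun z => G z + H z) = circ r G + circ r H.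
Proof. by move=> r0 cG cH; rewrite /circ cintD //; exact: ccont_on_circ. Qed.

Lemma circZ r G c : 0 <= r -> (forall z, normc z = r -> ccont G z) ->
  circ r (fun z => c * G z) = c * circ r G.
Proof. by move=> r0 cG; rewrite /circ cintZ //; exact: ccont_on_circ. Qed.

Lemma circB r G H : 0 <= r -> (forall z, normc z = r -> ccont G z) ->
  (forall z, normc z = r -> ccont H z) -> circ r (fun z => G z - H z) = circ r G - circ r H.
Proof. by move=> r0 cG cH; rewrite /circ cintB //; exact: ccont_on_circ. Qed.

Lemma circ0 G : circ 0 G = G 0 * (pi *+ 2)%:C.
Proof.
have := cint_cst (G 0) (ltW pi2_gt0); rewrite subr0 => <-.
by apply: eq_cint => t _; rewrite mul0r.
Qed.

(** The exponential maps the rectangle with sides [ln r1, ln r2] and [0, 2 pi] onto the annulus. By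
    periodicity the horizontal sides cancel in Goursat's theorem, and the vertical sides are the two
    circles. *)
Lemma circ_const_annulus r1 r2 G : 0 < r1 < r2 ->
  (forall z, r1 <= normc z <= r2 -> exists D, cder G z D) -> circ r1 G = circ r2 G.
Proof.
move=> /andP[r1_0 r12] dG.
have r2_0 : 0 < r2 := lt_trans r1_0 r12.
have l0 : 0 < ln r2 - ln r1 by rewrite subr_gt0 ltr_ln.
have := @goursat R (fun w => G (cexp w)) (ln r1) 0 _ _ l0 pi2_gt0.
rewrite /rect_int add0r.
have -> : ln r1 + (ln r2 - ln r1) = ln r2 by ring.
have -> : cint (ln r1) (ln r2) (fun s => G (cexp (s +i* (pi *+ 2)))) =
          cint (ln r1) (ln r2) (fun s => G (cexp (s +i* 0))).
  by apply: eq_cint => s _; rewrite /cexp /= /expi cos2pi sin2pi cos0 sin0.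
rewrite subrr add0r.
have circE r : 0 < r -> cint 0 (pi *+ 2) (fun t => G (cexp (ln r +i* t))) = circ r G.
  by move=> r0; rewrite /circ; apply: eq_cint => t _; rewrite /cexp /= lnK.
rewrite !circE // => /(_ _)/eqP; rewrite mulf_eq0 => H.
suff : ('i%C == 0 :> C) || (circ r2 G - circ r1 G == 0).
  rewrite subr_eq0 => /orP[|/eqP-> //].
  by rewrite -[_ == _]negbK -normc_gt0 normci ltr01.
apply: H => s t /andP[s1 s2] _.
have [|D dD] := dG (cexp (s +i* t)).
  rewrite normc_cexp /=; apply/andP; split.
    by rewrite -[leLHS]lnK // ler_expR.
  by rewrite -[leRHS]lnK // ler_expR; move: s2; rewrite addrC subrK.
by exists (D * cexp (s +i* t)); apply: cder_comp => //; exact: cder_cexp.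
Qed.

(** Compactness of the parameter segment turns joint continuity at each [(s, z)] into a
    neighbourhood of [z] common to all [s]. This gives continuity of integrals depending on a
    point. *)
Lemma tube (H : R -> C -> C) a b z : a < b ->
  (forall s, a <= s <= b -> forall e, 0 < e -> exists2 d, 0 < d &
     forall s' z', `|s' - s| < d -> normc (z' - z) < d -> normc (H s' z' - H s z) < e) ->
  forall e, 0 < e -> exists2 d, 0 < d &
    forall s z', a <= s <= b -> normc (z' - z) < d -> normc (H s z' - H s z) < e.
Proof.
move=> ab cH e e0.
pose P x l := a <= x -> x + l <= b -> exists2 d, 0 < d &
    forall s z', x <= s <= x + l -> normc (z' - z) < d -> normc (H s z' - H s z) < e.
have : P a (b - a); last by rewrite /P addrC subrK; apply.
apply: seg_bisect; first by rewrite subr_gt0.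
- move=> x l l0 P1 P2 ax xl.
  have [d1 d10 H1] := P1 ltac:(lra) ltac:(lra).
  have [d2 d20 H2] := P2 ltac:(lra) ltac:(lra).
  exists (Num.min d1 d2); first by rewrite lt_min d10.
  move=> s z' /andP[xs sl]; rewrite lt_min => /andP[h1 h2].
  have [sx|xs'] := leP s (x + l / 2).
    by apply: H1 => //; rewrite xs.
  by apply: H2 => //; apply/andP; split; lra.
- move=> p; have [pab|npab] := boolP (a <= p <= b); last first.
    exists 1 => // x l /andP[? ?] _ ? ?; exfalso; move/negP: npab; apply; apply/andP; split; lra.
  have e20 : 0 < e / 2 by rewrite divr_gt0.
  have [d d0 Hd] := cH p pab _ e20.
  exists d => // x l /andP[xp pl] /andP[l0 ld] _ _; exists d => // s z' /andP[xs sl] zd.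
  have sp : `|s - p| < d by rewrite ltr_norml; apply/andP; split; lra.
  rewrite (le_lt_trans (le_normc_dist _ (H p z) _)) // [ltRHS](splitr e) ltrD ?Hd //.
  by rewrite normcB Hd // subrr normc0.
Qed.

Lemma circ_continuous r G : 0 <= r -> (forall z, normc z <= r -> ccont G z) ->
  ccont_on (fun x => circ x G) 0 r.
Proof.
move=> r0 cG x /andP[x0 xr] e e0.
have K0 : 0 < 2 * (pi *+ 2) :> R by rewrite mulr_gt0 // pi2_gt0.
have e'0 : 0 < e / (2 * (pi *+ 2)) / 2 by rewrite !divr_gt0.
(* [tube] varies a complex point, so the radius is viewed as a point of the plane. *)
have [] := @tube (fun t z => G (z * expi t)) 0 (pi *+ 2) x%:C pi2_gt0 _ _ e'0.
  move=> s _ e1 e10.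
  have [|d d0 Hd] := cG (x%:C * expi s) _ _ e10.
    by rewrite normc_arc ger0_norm.
  have q0 : 0 < 1 + 2 * x by lra.
  exists (d / (1 + 2 * x)); first by rewrite divr_gt0.
  move=> s' z' hs hz; apply: Hd.
  have -> : z' * expi s' - x%:C * expi s = (z' - x%:C) * expi s' + (x%:C * expi s' - x%:C * expi s).
    by ring.
  apply: le_lt_trans (le_normcD _ _) _; rewrite normcM normc_expi mulr1.
  have := circ_arc_lip x s' s; rewrite (ger0_norm x0) => H.
  have : d = d / (1 + 2 * x) + x * 2 * (d / (1 + 2 * x)) by field; rewrite gt_eqF.
  have : x * 2 * `|s' - s| <= x * 2 * (d / (1 + 2 * x)).
    by rewrite ler_wpM2l ?mulr_ge0 // ltW.
  lra.
move=> d d0 Hd; exists d => // y /andP[y0 yr] yx.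
rewrite /circ -cintB; last first.
- by apply: ccont_on_circ => // z zE; apply: cG; rewrite zE.
- by apply: ccont_on_circ => // z zE; apply: cG; rewrite zE.
have cc : ccont_on (fun t => G (y%:C * expi t) - G (x%:C * expi t)) 0 (pi *+ 2).
  by apply: ccont_onB; apply: ccont_on_circ => // z zE; apply: cG; rewrite zE.
have := normc_cint_le (ltW pi2_gt0) cc.
move=> /(_ (e / (2 * (pi *+ 2)) / 2)) H.
apply: le_lt_trans (H _) _.
  by move=> t tt; apply/ltW/Hd => //; rewrite -rmorphB normc_real.
have E (P : R) : P != 0 -> 2 * (e / (2 * P) / 2) * P = e / 2 by move=> P0; field.
rewrite subr0 E; last by rewrite gt_eqF // pi2_gt0.
by rewrite ltr_pdivrMr // mulr_natr mulr2n ltrDl.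
Qed.

Lemma const_of_interior (j : R -> C) x y : x <= y -> ccont_on j x y ->
  (forall x' y', x < x' -> x' <= y' -> y' < y -> j x' = j y') -> j x = j y.
Proof.
rewrite le_eqVlt => /orP[/eqP-> //|xy] cj H.
have J u v : x < u -> u < y -> x < v -> v < y -> j u = j v.
  by move=> *; have [uv|/ltW vu] := leP u v; [exact: H|apply/esym/H].
suff E p : x <= p <= y -> j p = j ((x + y) / 2).
  by rewrite (E x) ?lexx ?(ltW xy) // (E y) // lexx ltW.
move=> pxy; apply/eqP; rewrite -subr_eq0; apply/eqP/eq0_normc/eqP.
rewrite eq_le normc_ge0 andbT; apply/ler_addgt0Pl => e e0; rewrite addr0.
have [d d0 Hd] := cj p pxy e e0.
pose k := Num.min (d / 2) ((y - x) / 4).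
have k0 : 0 < k by rewrite lt_min !divr_gt0 ?subr_gt0.
have kd : k <= d / 2 by rewrite ge_min lexx.
have ky : k <= (y - x) / 4 by rewrite ge_min lexx orbT.
move: pxy => /andP[xp py].
have [pm|mp] := leP p ((x + y) / 2).
  rewrite -(J (p + k) ((x + y) / 2)); [|lra..]; rewrite normcB ltW // Hd //.
    by apply/andP; split; lra.
  by rewrite [p + k]addrC addrK gtr0_norm //; lra.
rewrite (J ((x + y) / 2) (p - k)); [|lra..]; rewrite normcB ltW // Hd //.
  by apply/andP; split; lra.
by rewrite [p - k]addrC addrK normrN gtr0_norm //; lra.
Qed.

(** Induction on [E]: the interval is cut at each exceptional point that it contains, and continuity
    carries the constancy up to the cut. *)
Lemma const_off_seq (E : seq R) (j : R -> C) x y : x <= y -> ccont_on j x y ->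
  (forall x' y', x < x' -> x' <= y' -> y' < y ->
     (forall e, e \in E -> ~~ (x' <= e <= y')) -> j x' = j y') -> j x = j y.
Proof.
elim: E x y => [|e E IH] x y xy cj H.
  by apply: const_of_interior => // x' y' h1 h2 h3; apply: H.
have [/andP[xe ey]|ne] := boolP (x <= e <= y).
  apply: (@etrans _ _ (j e)); apply: IH => //.
  - exact: ccont_on_sub cj.
  - move=> x' y' h1 h2 h3 HE; apply: H => //; first lra.
    move=> e'; rewrite inE => /orP[/eqP->|/HE//]; apply/negP => /andP[? ?]; lra.
  - exact: ccont_on_sub cj.
  - move=> x' y' h1 h2 h3 HE; apply: H => //; first lra.
    move=> e'; rewrite inE => /orP[/eqP->|/HE//]; apply/negP => /andP[? ?]; lra.
apply: IH => // x' y' h1 h2 h3 HE; apply: H => //.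
move=> e'; rewrite inE => /orP[/eqP->|/HE//]; apply: contra ne => /andP[? ?].
by apply/andP; split; lra.
Qed.

(** Circular integrals are constant between exceptional radii and continuous in the radius, down to
    radius 0 where the curve degenerates to the point 0. *)
Lemma mean_value (E : seq R) r G : 0 <= r -> (forall z, normc z <= r -> ccont G z) ->
  (forall z, 0 < normc z < r -> normc z \notin E -> exists D, cder G z D) ->
  circ r G = G 0 * (pi *+ 2)%:C.
Proof.
move=> r0 cG dG; rewrite -circ0; apply/esym.
apply: (@const_off_seq E (fun x => circ x G)) => //; first exact: circ_continuous.
move=> x y x0; rewrite le_eqVlt => /orP[/eqP-> //|xy] yr HE.
apply: circ_const_annulus; first by rewrite x0.
move=> z /andP[xz zy]; apply: dG; first by apply/andP; split; lra.
by apply/negP => /HE; rewrite xz zy.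
Qed.

End MeanValue.

(** * Cauchy's formula *)

Section Cauchy.
Variable R : realType.
Local Notation C := R[i].
Implicit Types (x y t r e : R) (z w : C) (f G : C -> C) (E : seq R).

(** The bisected predicate bounds [f] only at points of the disc. Near a point outside it, small
    rectangles miss the disc and any bound serves. *)
Lemma bounded_disc f r : (forall z, normc z <= r -> ccont f z) ->
  exists2 M, 0 <= M & forall z, normc z <= r -> normc (f z) <= M.
Proof.
(* [r] may be zero or negative, while bisection needs a square with positive sides. *)
move=> cf; pose r' := `|r| + 1; have r'0 : 0 < r' by rewrite ltr_wpDl.
have rr' : r <= r' by rewrite (le_trans (ler_norm _)) // lerDl.
pose P x y l m := exists2 M, 0 <= M & forall s t, x <= s <= x + l -> y <= t <= y + m ->
  normc (s +i* t) <= r -> normc (f (s +i* t)) <= M.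
have [] : P (- r') (- r') (2 * r') (2 * r'); last first.
  move=> M M0 H; exists M => // z zr; case: z zr => s t zr.
  have := le_Re_normc (s +i* t); have := le_Im_normc (s +i* t) => /= ht hs.
  have := le_trans ht zr; have := le_trans hs zr; rewrite !ler_norml.
  by move=> /andP[? ?] /andP[? ?]; apply: H => //; apply/andP; split; lra.
apply: rect_bisect; [by rewrite mulr_gt0..| |].
- move=> x y l m l0 m0 [A A0 HA] [B B0 HB] [D D0 HD] [F F0 HF].
  exists (A + B + D + F); first by rewrite !addr_ge0.
  move=> s t /andP[s0 s1] /andP[t0 t1] st.
  have [sl|ls] := leP s (x + l / 2); have [tm|mt] := leP t (y + m / 2).
  + by apply: le_trans (HA _ _ _ _ st) _; [apply/andP; split; lra..|lra].
  + by apply: le_trans (HD _ _ _ _ st) _; [apply/andP; split; lra..|lra].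
  + by apply: le_trans (HB _ _ _ _ st) _; [apply/andP; split; lra..|lra].
  + by apply: le_trans (HF _ _ _ _ st) _; [apply/andP; split; lra..|lra].
- move=> p q; have N x y l m d s t : x <= p <= x + l -> y <= q <= y + m -> 0 < l < d / 2 ->
      0 < m < d / 2 -> x <= s <= x + l -> y <= t <= y + m -> normc (s +i* t - p +i* q) < d.
    move=> /andP[? ?] /andP[? ?] /andP[? ?] /andP[? ?] /andP[? ?] /andP[? ?].
    apply: le_lt_trans (le_normc_ReIm _) _; rewrite /=.
    have : `|s - p| <= l by rewrite ler_norml; apply/andP; split; lra.
    have : `|t - q| <= m by rewrite ler_norml; apply/andP; split; lra.
    lra.
  have [pq|pq] := leP (normc (p +i* q)) r.
    have [d d0 Hd] := cf _ pq 1 ltr01.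
    exists (d / 2); first by rewrite divr_gt0.
    move=> x y l m xp yq lb mb; exists (normc (f (p +i* q)) + 1).
      by rewrite addr_ge0 ?normc_ge0.
    move=> s t xs yt _; have := Hd _ (N _ _ _ _ _ _ _ xp yq lb mb xs yt).
    have := le_normc_sub (f (s +i* t)) (f (p +i* q)); lra.
  exists ((normc (p +i* q) - r) / 2); first by rewrite divr_gt0 // subr_gt0.
  move=> x y l m xp yq lb mb; exists 0 => // s t xs yt st; exfalso.
  have := N _ _ _ _ _ _ _ xp yq lb mb xs yt.
  have := le_normc_subr (s +i* t) (p +i* q); lra.
Qed.

Lemma cint_conj (a b : R) (c : R -> C) : ccont_on c a b ->
  cint a b (fun t => (c t)^*%C) = (cint a b c)^*%C.
Proof.
move=> cc; rewrite /cint /=; congr (_ +i* _).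
  by apply: eq_Rintegral => x _; case: (c x).
rewrite -mulN1r -RintegralZl //; last exact: ccont_on_Im_int.
by apply: eq_Rintegral => x _; case: (c x) => u v /=; rewrite mulN1r.
Qed.

Lemma circ_conj r G : 0 <= r -> (forall z, normc z = r -> ccont G z) ->
  circ r (fun z => (G z)^*%C) = (circ r G)^*%C.
Proof. by move=> r0 cG; rewrite /circ cint_conj //; exact: ccont_on_circ. Qed.

Lemma sub_neq0_normc z w : normc w < normc z -> z - w != 0.
Proof. by move=> h; rewrite subr_eq0; apply: contraTneq h => ->; rewrite ltxx. Qed.

Lemma ccont_kernel w z : z != w -> ccont (fun z => z / (z - w)) z.
Proof.
move=> zw; apply: ccontM; first exact: ccont_id.
apply: ccontV; last by rewrite subr_eq0.
by apply: ccontB; [exact: ccont_id|exact: ccont_cst].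
Qed.

(* On the circle the conjugate of z/(z-w) extends holomorphically inside. *)
Lemma kernel_conj r z w : normc w < r -> normc z = r ->
  (z / (z - w))^*%C = (r ^+ 2)%:C / ((r ^+ 2)%:C - w^*%C * z).
Proof.
move=> wr zr; have z0 : z != 0 by rewrite -normc_gt0 zr (le_lt_trans (normc_ge0 w)).
have zw : z - w != 0 by apply: sub_neq0_normc; rewrite zr.
have zw' : z^*%C - w^*%C != 0 by rewrite -rmorphB /= conjc_eq0.
rewrite -zr -mulc_conj rmorphM fmorphV rmorphB /=.
by field; rewrite zw' /= [z * _]mulrC -mulrBl mulf_neq0.
Qed.

Lemma conj_kernel_neq0 r z w : normc w < r -> normc z <= r ->
  (r ^+ 2)%:C - w^*%C * z != 0.
Proof.
move=> wr zr; have r0 : 0 < r := le_lt_trans (normc_ge0 w) wr.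
apply: sub_neq0_normc; rewrite normc_real normcM normc_conj ger0_norm ?sqr_ge0 // expr2.
by apply: le_lt_trans (ler_wpM2l (normc_ge0 _) zr) _; rewrite ltr_pM2r.
Qed.

Lemma cder_conj_kernel r z w : normc w < r -> normc z <= r ->
  exists D, cder (fun z => (r ^+ 2)%:C / ((r ^+ 2)%:C - w^*%C * z)) z D.
Proof.
move=> wr zr; eexists; apply: cderM; first exact: cder_cst.
apply: cderV; last exact: conj_kernel_neq0.
apply: cderB; first exact: cder_cst.
by apply: cderM; [exact: cder_cst|exact: cder_id].
Qed.

(** By [kernel_conj] the integrand agrees on the circle with a function holomorphic inside, whose
    kernel factor equals 1 at 0. *)
Lemma circ_conj_kernel r G w : normc w < r ->
  (forall z, normc z <= r -> ccont G z) ->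
  (forall z, normc z < r -> exists D, cder G z D) ->
  circ r (fun z => G z * (z / (z - w))^*%C) = G 0 * (pi *+ 2)%:C.
Proof.
move=> wr cG dG; have r0 : 0 < r := le_lt_trans (normc_ge0 w) wr.
rewrite (@eq_circ _ _ _ (fun z => G z * ((r ^+ 2)%:C / ((r ^+ 2)%:C - w^*%C * z)))) ?ltW //.
  rewrite (@mean_value _ [::]) ?ltW //.
  - by rewrite mulr0 subr0 divff ?mulr1 // -normc_gt0 normc_real normr_gt0 expf_neq0 // gt_eqF.
  - move=> z zr; apply: ccontM; first exact: cG.
    by have [D /cder_cont] := cder_conj_kernel wr zr.
  - move=> z /andP[_ zr] _; have [D dD] := dG z zr.
    have [D' dD'] := cder_conj_kernel wr (ltW zr).
    by eexists; exact: cderM dD dD'.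
by move=> z zr; rewrite (kernel_conj wr zr).
Qed.

(** Conjugate the case [G = 1] of [circ_conj_kernel]; its value is real. No expansion of the kernel
    is needed. *)
Lemma circ_kernel r w : normc w < r -> circ r (fun z => z / (z - w)) = (pi *+ 2)%:C.
Proof.
move=> wr; have r0 : 0 < r := le_lt_trans (normc_ge0 w) wr.
have cc z : normc z = r -> ccont (fun z => z / (z - w)) z.
  by move=> zr; apply: ccont_kernel; rewrite -subr_eq0 sub_neq0_normc // zr.
apply: (can_inj (@conjcK R)); rewrite -circ_conj ?ltW //.
have := @circ_conj_kernel r (fun=> 1) w wr (fun z _ => @ccont_cst _ 1 z)
  (fun z _ => ex_intro _ 0 (cder_cst 1 z)).
rewrite mul1r conjc_real => <-; apply: eq_circ; first exact: ltW.
by move=> z _; rewrite mul1r.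
Qed.

Lemma avoid_seq E (a d : R) : 0 < d -> exists2 x, a < x < a + d & x \notin E.
Proof.
elim: E d => [|e E IH] d d0; first by exists (a + d / 2) => //; apply/andP; split; lra.
have [ae|ea] := ltP a e; last first.
  have [x /andP[ax xd] xE] := IH _ d0; exists x; first by rewrite ax.
  by rewrite inE negb_or xE andbT gt_eqF //; lra.
have m0 : 0 < Num.min d (e - a) by rewrite lt_min d0 subr_gt0.
have [x /andP[ax]] := IH _ m0; rewrite addrC -ltrBlDr lt_min => /andP[xd xe] xE.
exists x; first by rewrite ax /=; lra.
by rewrite inE negb_or xE andbT lt_eqF //; lra.
Qed.

Lemma avoid_radius E w (d : R) : 0 < d -> exists w', [/\ normc (w' - w) < d,
  normc w < normc w', normc w' < normc w + d & normc w' \notin E].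
Proof.
move=> d0; have [x /andP[wx xd] xE] := avoid_seq E (normc w) d0.
have [u u1 wu] : exists2 u, normc u = 1 & w = (normc w)%:C * u.
  have [->|w0] := eqVneq w 0; first by exists 1; rewrite ?normc1 // normc0 mul0r.
  have n0 : (normc w)%:C != 0 :> C.
    by rewrite -normc_gt0 normc_real normr_gt0 gt_eqF // normc_gt0.
  exists (w / (normc w)%:C); last by field.
  by rewrite normcM normcV normc_real ger0_norm ?normc_ge0 // divff // gt_eqF // normc_gt0.
have x0 : 0 <= x by rewrite (le_trans (normc_ge0 w)) // ltW.
have xu : normc (x%:C * u) = x by rewrite normcM u1 mulr1 normc_real ger0_norm.
exists (x%:C * u); rewrite xu; split => //.
rewrite {1}wu -mulrBl normcM u1 mulr1 -rmorphB normc_real ger0_norm ?subr_ge0 ?ltW //; lra.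
Qed.

Section CauchyIntegral.
Variables (f : C -> C) (r : R).
Hypothesis cf : forall z, normc z <= r -> ccont f z.

(** Up to the factor 1/i, the integral of f(z) / (z - w)^n dz: the extra [z] cancels the 1/z in
    [circ]. *)
Definition cauchy_int n w := circ r (fun z => f z * (z * (z - w)^-1 ^+ n)).

Lemma ccont_cauchy_int n z w : normc w < r -> normc z = r ->
  ccont (fun z => f z * (z * (z - w)^-1 ^+ n)) z.
Proof.
move=> wr zr; have zw : z - w != 0 by apply: sub_neq0_normc; rewrite zr.
apply: ccontM; first by apply: cf; rewrite zr.
apply: ccontM; first exact: ccont_id.
apply: ccontX; apply: ccontV => //; apply: ccontB; [exact: ccont_id|exact: ccont_cst].
Qed.

Lemma inv_dist_bound z w d : 0 < d -> normc z = r -> normc w <= r - d ->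
  normc (z - w)^-1 <= d^-1.
Proof.
move=> d0 zr wr; rewrite normcV lef_pV2 ?posrE //; last first.
  by rewrite normc_gt0 sub_neq0_normc // zr; lra.
by have := le_normc_sub z w; rewrite zr; lra.
Qed.

(** Differentiation under the integral sign, done by hand: the first-order remainder of 1 / (z - w)
    in w is exactly (w' - w)^2 / ((z - w)^2 (z - w')), and bounds for the kernels on the circle do
    the rest. *)
Lemma cder_cauchy_int w : normc w < r ->
  cder (cauchy_int 1) w (cauchy_int 2 w) /\ ccont (cauchy_int 2) w.
Proof.
move=> wr; have r0 : 0 < r := le_lt_trans (normc_ge0 w) wr.
have [M M0 fM] := bounded_disc cf.
(* With [d] half the distance from [w] to the circle, every [w'] within [d] of [w] stays at distance
   at least [d] from it. *)
have [d d0 dE] : exists2 d, 0 < d & d + d = r - normc w.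
  by exists ((r - normc w) / 2); [rewrite divr_gt0 // subr_gt0|field].
pose K := 1 + 4 * (M * (r * d^-1 ^+ 3)) * (pi *+ 2).
have K0 : 0 < K.
  rewrite /K addrC ltr_wpDl // mulr_ge0 ?(ltW (pi2_gt0 R)) //.
  by rewrite !mulr_ge0 ?exprn_ge0 ?invr_ge0 // ltW.
have near_r w' : normc (w' - w) < d -> normc w' <= r - d /\ normc w' < r.
  by move=> h; have := le_normc_sub w' w; split; lra.
have wd : normc w <= r - d by lra.
have split_inv z w' : normc z = r -> normc w' < r ->
    (z - w')^-1 - (z - w)^-1 = (w' - w) * ((z - w)^-1 * (z - w')^-1).
  move=> zr w'r; have zw : z - w != 0 by apply: sub_neq0_normc; rewrite zr.
  have zw' : z - w' != 0 by apply: sub_neq0_normc; rewrite zr.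
  by field; rewrite zw zw'.
split.
- apply: cder_le_intro => e e0; exists (Num.min d (e / K)).
    by rewrite lt_min d0 divr_gt0.
  move=> w'; rewrite lt_min ltr_pdivlMr // => /andP[w'd w'e].
  have [w'd' w'r] := near_r _ w'd.
  have -> : cauchy_int 1 w' - cauchy_int 1 w - cauchy_int 2 w * (w' - w) =
      (w' - w) ^+ 2 * circ r (fun z => f z * (z * ((z - w)^-1 ^+ 2 * (z - w')^-1))).
    rewrite [cauchy_int 2 w * _]mulrC /cauchy_int -circB;
      [|exact: ltW|by move=> z zr; exact: ccont_cauchy_int..].
    rewrite -(@circZ _ r _ (w' - w)); [|exact: ltW|by move=> z zr; exact: ccont_cauchy_int].
    rewrite -circB; last 3 first.
    - exact: ltW.
    - by move=> z zr; apply: ccontB; exact: ccont_cauchy_int.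
    - by move=> z zr; apply: ccontM; [exact: ccont_cst|exact: ccont_cauchy_int].
    rewrite -(@circZ _ r _ ((w' - w) ^+ 2)); last 2 first.
    - exact: ltW.
    - move=> z zr; have zw' : z - w' != 0 by apply: sub_neq0_normc; rewrite zr.
      have -> : (fun z => f z * (z * ((z - w)^-1 ^+ 2 * (z - w')^-1))) =
                (fun z => (f z * (z * (z - w)^-1 ^+ 2)) * (z - w')^-1).
        by apply/funext => u; rewrite !mulrA.
      apply: ccontM; first exact: ccont_cauchy_int.
      by apply: ccontV => //; apply: ccontB; [exact: ccont_id|exact: ccont_cst].
    apply: eq_circ; first exact: ltW.
    move=> z zr; rewrite !expr1.
    have := split_inv z w' zr w'r.
    set u := (z - w)^-1; set v := (z - w')^-1 => uv.
    have uv2 : v - u - (w' - w) * u ^+ 2 = (w' - w) ^+ 2 * (u ^+ 2 * v).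
      have -> : (w' - w) ^+ 2 * (u ^+ 2 * v) = (w' - w) * u * (v - u) by rewrite uv; ring.
      have -> : v - u - (w' - w) * u ^+ 2 = (w' - w) * (u * v) - (w' - w) * u ^+ 2.
        by rewrite uv.
      ring.
    have -> : (w' - w) ^+ 2 * (f z * (z * (u ^+ 2 * v))) = f z * z * ((w' - w) ^+ 2 * (u ^+ 2 * v)).
      ring.
    rewrite -uv2; ring.
  have cG z : normc z = r -> ccont (fun z => f z * (z * ((z - w)^-1 ^+ 2 * (z - w')^-1))) z.
    move=> zr; have zw' : z - w' != 0 by apply: sub_neq0_normc; rewrite zr.
    have -> : (fun z => f z * (z * ((z - w)^-1 ^+ 2 * (z - w')^-1))) =
              (fun z => (f z * (z * (z - w)^-1 ^+ 2)) * (z - w')^-1).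
      by apply/funext => u; rewrite !mulrA.
    apply: ccontM; first exact: ccont_cauchy_int.
    by apply: ccontV => //; apply: ccontB; [exact: ccont_id|exact: ccont_cst].
  have := circ_le (ltW r0) cG; move=> /(_ (M * (r * d^-1 ^+ 3))) H.
  rewrite normcM normcX expr2 -mulrA mulrC ler_wpM2r ?normc_ge0 // mulrC.
  apply: le_trans (ltW w'e); rewrite mulrC ler_wpM2l ?normc_ge0 //.
  apply: le_trans (H _) _.
    move=> z zr; rewrite 3!normcM normcX zr ler_pM ?mulr_ge0 ?exprn_ge0 ?normc_ge0 //.
    + by rewrite ltW.
    + by rewrite fM // zr.
    + rewrite ler_wpM2l ?(ltW r0) // [leRHS]exprSr ler_pM ?exprn_ge0 ?normc_ge0 //.
        apply: lerXn2r; rewrite ?nnegrE ?normc_ge0 ?invr_ge0 ?(ltW d0) //.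
        exact: inv_dist_bound d0 zr wd.
      exact: inv_dist_bound d0 zr w'd'.
  have : 0 <= M * (r * d^-1 ^+ 3) * (pi *+ 2).
    by rewrite !mulr_ge0 ?exprn_ge0 ?invr_ge0 ?(ltW (pi2_gt0 R)) // ltW.
  rewrite /K; lra.
- move=> e e0; exists (Num.min d (e / K)).
    by rewrite lt_min d0 divr_gt0.
  move=> w'; rewrite lt_min ltr_pdivlMr // => /andP[w'd w'e].
  have [w'd' w'r] := near_r _ w'd.
  have cG z : normc z = r ->
      ccont (fun z => f z * (z * (z - w')^-1 ^+ 2) - f z * (z * (z - w)^-1 ^+ 2)) z.
    by move=> zr; apply: ccontB; exact: ccont_cauchy_int.
  rewrite /cauchy_int -circB; [|exact: ltW|by move=> z zr; exact: ccont_cauchy_int..].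
  have := circ_le (ltW r0) cG.
  move=> /(_ (normc (w' - w) * (2 * (M * (r * d^-1 ^+ 3))))) H.
  apply: le_lt_trans (H _) _; last first.
    have EE (n X P : R) : 2 * (n * (2 * X)) * P = n * (4 * X * P) by ring.
    by apply: le_lt_trans w'e; rewrite EE ler_wpM2l ?normc_ge0 // /K lerDr.
  move=> z zr; have := split_inv z w' zr w'r.
  have := inv_dist_bound d0 zr wd; have := inv_dist_bound d0 zr w'd'.
  set u := (z - w)^-1; set v := (z - w')^-1 => vd ud uv.
  have -> : f z * (z * v ^+ 2) - f z * (z * u ^+ 2) = (v - u) * (f z * (z * (v + u))) by ring.
  rewrite uv !normcM zr -!mulrA ler_wpM2l ?normc_ge0 //.
  have fz : normc (f z) <= M by rewrite fM // zr.
  have di0 : 0 < d^-1 by rewrite invr_gt0.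
  have vu : normc (v + u) <= 2 * d^-1.
    by apply: le_trans (le_normcD _ _) _; lra.
  have uv2 : normc u * normc v <= d^-1 * d^-1 by rewrite ler_pM ?normc_ge0.
  have fv : normc (f z) * (r * normc (v + u)) <= M * (r * (2 * d^-1)).
    by rewrite ler_pM ?normc_ge0 ?mulr_ge0 ?normc_ge0 ?(ltW r0) // ler_wpM2l // ltW.
  rewrite mulrA.
  have -> : 2 * (M * (r * d^-1 ^+ 3)) = d^-1 * d^-1 * (M * (r * (2 * d^-1))) by ring.
  by rewrite ler_pM ?mulr_ge0 ?normc_ge0 ?(ltW r0).
Qed.

End CauchyIntegral.

(** For generic [w'], the mean value property applies to z (f(z) - f(w')) / (z - w'), which vanishes
    at 0; the circle through [w'] is added to the exceptional ones. Both sides being continuous,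
    generic points suffice. *)
Lemma cauchy_formula E f r w : (forall z, normc z <= r -> ccont f z) ->
  (forall z, normc z < r -> normc z \notin E -> exists D, cder f z D) ->
  normc w < r -> f w * (pi *+ 2)%:C = cauchy_int f r 1 w.
Proof.
move=> cf df wr; have r0 : 0 < r := le_lt_trans (normc_ge0 w) wr.
have ck w' z : normc w' < r -> normc z = r -> ccont (fun z => z / (z - w')) z.
  by move=> w'r zr; apply: ccont_kernel; rewrite -subr_eq0 sub_neq0_normc // zr.
have generic w' : 0 < normc w' < r -> normc w' \notin E ->
    f w' * (pi *+ 2)%:C = cauchy_int f r 1 w'.
  move=> /andP[w'0 w'r] w'E; have [D dD] := df w' w'r w'E.
  (* The value [w' * D] makes [G] continuous at [w']; differentiability there is not claimed. *)
  pose G z := if z == w' then w' * D else z * ((f z - f w') / (z - w')).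
  have Gnear z : z != w' -> cnear z (fun u => u * ((f u - f w') / (u - w')) = G u).
    move=> zw; exists (normc (z - w')); first by rewrite normc_gt0 subr_eq0.
    move=> y; rewrite /G; case: eqVneq => // ->; by rewrite normcB ltxx.
  have cG z : normc z <= r -> ccont G z.
    move=> zr; have [->|zw] := eqVneq z w'.
      have [p [cp pD [d d0 Hp]]] := dD.
      apply: (@ccont_near _ (fun u => u * p u)).
        by apply: ccontM => //; exact: ccont_id.
      exists d => // y /Hp; rewrite /G; case: eqVneq => [->|yw]; first by rewrite pD.
      by move=> ->; rewrite mulfK // subr_eq0.
    apply: ccont_near (Gnear z zw); apply: ccontM; first exact: ccont_id.
    apply: ccontM; first by apply: ccontB; [exact: cf|exact: ccont_cst].
    apply: ccontV; last by rewrite subr_eq0.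
    by apply: ccontB; [exact: ccont_id|exact: ccont_cst].
  have := @mean_value R (normc w' :: E) r G (ltW r0) cG.
  have -> : G 0 = 0.
    by rewrite /G mul0r eq_sym -[_ == _]negbK -normc_gt0 w'0.
  rewrite mul0r => G0; apply/eqP; rewrite eq_sym -subr_eq0 -G0; last first.
    move=> z /andP[z0 zr]; rewrite inE negb_or => /andP[zw zE].
    have {}zw : z != w' by apply: contraNneq zw => ->.
    have [D' dD'] := df z zr zE.
    eexists; apply: cder_near (Gnear z zw); apply: cderM; first exact: cder_id.
    apply: cderM; first by apply: cderB; [exact: dD'|exact: cder_cst].
    apply: cderV; last by rewrite subr_eq0.
    by apply: cderB; [exact: cder_id|exact: cder_cst].
  rewrite -(circ_kernel w'r) -circZ ?ltW //; last by move=> z; exact: ck.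
  rewrite /cauchy_int -circB ?ltW //.
  - apply/eqP; apply: eq_circ; first exact: ltW.
    move=> z zr; have zw : z - w' != 0 by apply: sub_neq0_normc; rewrite zr.
    rewrite /G -subr_eq0 (negbTE zw); by field.
  - by move=> z; apply: ccont_cauchy_int.
  - by move=> z zr; apply: ccontM; [exact: ccont_cst|exact: ck].
(* Generic points accumulate at every [w]: by [avoid_radius], a slight outward move reaches a
   nonzero radius outside [E]. *)
apply: (@ccont_eq R (fun w => f w * (pi *+ 2)%:C) (cauchy_int f r 1) w).
- by apply: ccontM; [apply/cf/ltW|exact: ccont_cst].
- by have [/cder_cont] := cder_cauchy_int cf wr.
- move=> d d0; have m0 : 0 < Num.min d (r - normc w) by rewrite lt_min d0 subr_gt0.
  have [w' [h1 h2 h3 h4]] := avoid_radius E w m0.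
  exists w'; first by apply: lt_le_trans h1 _; rewrite ge_min lexx.
  apply: generic => //; rewrite (le_lt_trans (normc_ge0 w) h2) /=.
  apply: lt_le_trans h3 _; rewrite addrC -lerBrDr ge_min lexx orbT //.
Qed.

(* Cauchy's formula removes the exceptional circles. *)
Lemma removable_cder E f r : (forall z, normc z <= r -> ccont f z) ->
  (forall z, normc z < r -> normc z \notin E -> exists D, cder f z D) ->
  exists f' : C -> C, forall w, normc w < r -> cder f w (f' w) /\ ccont f' w.
Proof.
move=> cf df; exists (fun w => cauchy_int f r 2 w / (pi *+ 2)%:C) => w wr.
have p0 : (pi *+ 2)%:C != 0 :> C.
  by rewrite -normc_gt0 normc_real normr_gt0 gt_eqF // pi2_gt0.
have [dc c2] := cder_cauchy_int cf wr.
split; last by apply: ccontM => //; exact: ccont_cst.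
have := cderM dc (cder_cst (pi *+ 2)%:C^-1 w); rewrite mulr0 addr0.
move/cder_near; apply.
exists (r - normc w); first by rewrite subr_gt0.
move=> y yw; have yr : normc y < r by have := le_normc_sub y w; lra.
by rewrite -(cauchy_formula cf df yr) mulfK.
Qed.

(** A substitute for the maximum principle on half the radius. In the constant 4, one factor 2
    bounds the kernel z / (z - w) and the other is that of [circ_le]. *)
Lemma cauchy_bound f r w M : (forall z, normc z <= r -> ccont f z) ->
  (forall z, normc z < r -> exists D, cder f z D) ->
  (forall z, normc z = r -> normc (f z) <= M) -> 0 <= M ->
  normc w <= r / 2 -> 0 < r -> normc (f w) <= 4 * M.
Proof.
move=> cf df fM M0 wr2 r0; have wr : normc w < r by lra.
have := cauchy_formula (E := [::]) cf (fun z zr _ => df z zr) wr.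
move/(congr1 (@normc R)); rewrite normcM normc_real gtr0_norm ?pi2_gt0 // => H.
rewrite -(ler_pM2r (pi2_gt0 R)) H /cauchy_int.
have -> : 4 * M * (pi *+ 2) = 2 * (2 * M) * (pi *+ 2) by ring.
apply: circ_le; first exact: ltW.
  by move=> z; apply: ccont_cauchy_int.
move=> z zr; rewrite !normcM expr1 zr.
have H2 : normc (z - w)^-1 <= (r / 2)^-1.
  by apply: inv_dist_bound zr _; [rewrite divr_gt0|lra].
rewrite mulrC; apply: ler_pM; rewrite ?mulr_ge0 ?normc_ge0 ?fM ?(ltW r0) //.
apply: le_trans (ler_wpM2l (ltW r0) H2) _.
by rewrite (_ : r * (r / 2)^-1 = 2) //; field; rewrite gt_eqF.
Qed.

End Cauchy.

(** * Logarithms and the Borel-Caratheodory inequality *)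

Section Logarithm.
Variable R : realType.
Local Notation C := R[i].
Local Notation mu := (@lebesgue_measure R).
Implicit Types (s t r e d : R) (z w : C) (f G : C -> C).

Lemma cexp_sub1_lip : exists2 K : R, 0 < K &
  forall h : C, normc h <= 1 -> normc (cexp h - 1) <= K * normc h.
Proof.
exists (3 * expR 1 + 3); first by rewrite addr_gt0 // mulr_gt0 // expR_gt0.
move=> h h1; have -> : cexp h - 1 = (cexp h - 1 - h) + h by rewrite subrK.
apply: le_trans (le_normcD _ _) _; have := cexp_sub1_le h1; rewrite expr2.
have : (3 * expR 1 + 2) * (normc h * normc h) <= (3 * expR 1 + 2) * normc h.
  rewrite ler_wpM2l ?ler_piMl ?normc_ge0 // addr_ge0 // mulr_ge0 // expR_ge0 //.
lra.
Qed.

(** Bisection again: the increment bound [k * l] adds up over two halves, and it holds locally for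
    every positive [k]. *)
Lemma const_of_zero_derivative (N : R -> C) (a b : R) : a < b ->
  (forall s, a <= s <= b -> forall e, 0 < e -> exists2 d, 0 < d &
    forall s', a <= s' <= b -> `|s' - s| < d -> normc (N s' - N s) <= e * `|s' - s|) ->
  N a = N b.
Proof.
move=> ab dN; apply/eqP; rewrite eq_sym -subr_eq0; apply/eqP/eq0_normc/eqP.
rewrite eq_le normc_ge0 andbT; apply/ler_addgt0Pl => e e0; rewrite addr0.
have ba0 : 0 < b - a by rewrite subr_gt0.
have [k k0 kE] : exists2 k, 0 < k & e = k * (b - a).
  by exists (e / (b - a)); rewrite ?divr_gt0 // divfK // gt_eqF.
pose P x l := a <= x -> x + l <= b -> normc (N (x + l) - N x) <= k * l.
have : P a (b - a); last by rewrite /P addrC subrK kE; apply.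
apply: seg_bisect => //.
- move=> x l l0 P1 P2 ax xl; have := P1 ltac:(lra) ltac:(lra); have := P2 ltac:(lra) ltac:(lra).
  have -> : x + l / 2 + l / 2 = x + l by field.
  have := le_normc_dist (N (x + l)) (N (x + l / 2)) (N x).
  lra.
- move=> p; have [pab|npab] := boolP (a <= p <= b); last first.
    exists 1 => // x l /andP[? ?] _ ? ?; exfalso; move/negP: npab; apply; apply/andP; split; lra.
  have [d d0 Hd] := dN p pab k k0; exists d => // x l /andP[xp pl] /andP[l0 ld] ax xl.
  have xab : a <= x <= b by apply/andP; split; lra.
  have xlab : a <= x + l <= b by apply/andP; split; lra.
  have xd : `|x - p| < d by rewrite ltr_norml; apply/andP; split; lra.
  have xld : `|x + l - p| < d by rewrite ltr_norml; apply/andP; split; lra.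
  have := Hd _ xlab xld; have := Hd _ xab xd.
  have := le_normc_dist (N (x + l)) (N p) (N x); rewrite (normcB (N p)).
  have -> : `|x + l - p| = x + l - p by rewrite ger0_norm; lra.
  have -> : `|x - p| = p - x by rewrite distrC ger0_norm; lra.
  move=> h1 h2 h3; apply: le_trans h1 _; apply: le_trans (lerD h3 h2) _.
  by rewrite -mulrDr ler_wpM2l ?(ltW k0) //; lra.
Qed.

Section Primitive.
Variables (v : R -> C) (a b : R).
Hypotheses (ab : a < b) (cv : ccont_on v a b).

Lemma cint_primitive s : a <= s <= b -> forall e, 0 < e -> exists2 d, 0 < d &
  forall s', a <= s' <= b -> `|s' - s| < d ->
    normc (cint a s' v - cint a s v - v s * (s' - s)%:C) <= e * `|s' - s|.
Proof.
move=> /andP[as_ sb] e e0; have e20 : 0 < e / 2 by rewrite divr_gt0.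
have [d d0 Hd] := cv (introT andP (conj as_ sb)) e20.
exists d => // s' /andP[as' s'b].
have key x y : a <= x -> x <= y -> y <= b -> x <= s <= y -> y - x < d ->
    normc (cint a y v - cint a x v - v s * (y - x)%:C) <= e * (y - x).
  move=> ax xy yb /andP[xs sy] yx.
  rewrite (@cint_split _ x a y) ?ax //; last exact: ccont_on_sub cv.
  rewrite -cint_cst // [cint a x v + _]addrC addrK -cintB //; last 2 first.
  - exact: ccont_on_sub cv.
  - exact: ccont_on_cst.
  have -> : e * (y - x) = 2 * (e / 2) * (y - x) by field.
  apply: normc_cint_le => //.
    by apply: ccont_onB; [exact: ccont_on_sub cv|exact: ccont_on_cst].
  move=> u /andP[xu uy]; apply/ltW/Hd; first by apply/andP; split; lra.
  by rewrite ltr_norml; apply/andP; split; lra.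
have [ss'|s's] := leP s s'.
  rewrite ger0_norm ?subr_ge0 // => h; apply: key => //; by rewrite lexx.
rewrite distrC gtr0_norm ?subr_gt0 // => h.
have -> : cint a s' v - cint a s v - v s * (s' - s)%:C =
    - (cint a s v - cint a s' v - v s * (s - s')%:C).
  by rewrite -[s' - s]opprB rmorphN /=; ring.
by rewrite normcN; apply: key; rewrite ?(ltW s's) ?lexx.
Qed.

End Primitive.

Section Log.
Variables (f f' : C -> C) (r : R).
Hypotheses (df : forall z, normc z < r -> cder f z (f' z))
  (cf' : forall z, normc z < r -> ccont f' z)
  (f_neq0 : forall z, normc z < r -> f z != 0).

Let u z := f' z / f z.
(** The integral of f'/f along the ray from 0 to z, that is, log(f(z) / f(0)). A fixed path makes it
    well defined without path independence. *)
Definition clog z := cint 0 1 (fun s => z * u (s%:C * z)).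

Lemma ccont_logder z : normc z < r -> ccont u z.
Proof.
move=> zr; apply: ccontM; first exact: cf'.
by apply: ccontV; [exact/cder_cont/df|exact: f_neq0].
Qed.

Lemma normc_ray s z : 0 <= s <= 1 -> normc (s%:C * z) <= normc z.
Proof.
by move=> /andP[s0 s1]; rewrite normcM normc_real ger0_norm // ler_piMl // normc_ge0.
Qed.

Lemma ccont_on_ray z : normc z < r -> ccont_on (fun s => z * u (s%:C * z)) 0 1.
Proof.
move=> zr; apply: ccont_onZ; apply: (@ccont_on_comp R u (fun s => s%:C * z) 0 1 (normc z)).
  by move=> s t; rewrite -mulrBl normcM -rmorphB normc_real mulrC.
by move=> s s01; apply: ccont_logder; apply: le_lt_trans zr; exact: normc_ray.
Qed.

Lemma ccont_clog z : normc z < r -> ccont clog z.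
Proof.
move=> zr e e0; have e40 : 0 < e / 4 by rewrite divr_gt0.
have [] := @tube R (fun s w => w * u (s%:C * w)) 0 1 z ltr01 _ _ e40.
  move=> s s01 e1 e10; have sz : normc (s%:C * z) < r by apply: le_lt_trans zr; exact: normc_ray.
  have z1 : 0 < 2 * (1 + normc z) by rewrite mulr_gt0 // ltr_wpDr // normc_ge0.
  have [d d0 Hd] := ccont_logder sz (divr_gt0 e10 z1).
  have q0 : 0 < 2 * (1 + normc (u (s%:C * z))) by rewrite mulr_gt0 // ltr_wpDr // normc_ge0.
  pose m := Num.min (Num.min 1 (d / (2 * (1 + normc z)))) (e1 / (2 * (1 + normc (u (s%:C * z))))).
  exists m; first by rewrite !lt_min ltr01 !divr_gt0.
  move=> s' w; rewrite !lt_min => /andP[/andP[s'1 s'd] _] /andP[/andP[w1 wd] we].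
  have wz : normc w < 1 + normc z by have := le_normc_sub w z; lra.
  have hu : normc (u (s'%:C * w) - u (s%:C * z)) < e1 / (2 * (1 + normc z)).
    apply: Hd; have -> : s'%:C * w - s%:C * z = (s' - s)%:C * w + s%:C * (w - z).
      by rewrite rmorphB /=; ring.
    apply: le_lt_trans (le_normcD _ _) _.
    have A : normc ((s' - s)%:C * w) <= d / (2 * (1 + normc z)) * (1 + normc z).
      rewrite normcM normc_real ler_pM ?normc_ge0 ?normr_ge0 ?ltW //.
    have B := @normc_ray s (w - z) s01.
    have D : d / (2 * (1 + normc z)) <= d / 2.
      by rewrite ler_pM2l // lef_pV2 ?posrE //; have := normc_ge0 z; lra.
    have F : d / (2 * (1 + normc z)) * (1 + normc z) = d / 2.
      by field; rewrite gt_eqF // ltr_wpDr // normc_ge0.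
    lra.
  have -> : w * u (s'%:C * w) - z * u (s%:C * z) =
      w * (u (s'%:C * w) - u (s%:C * z)) + (w - z) * u (s%:C * z) by ring.
  apply: le_lt_trans (le_normcD _ _) _; rewrite [normc (w * _)]normcM [normc ((w - z) * _)]normcM.
  rewrite ltr_pdivlMr // in hu; rewrite ltr_pdivlMr // in we.
  have nu := normc_ge0 (u (s%:C * z)); have nw := normc_ge0 (w - z).
  have nd := normc_ge0 (u (s'%:C * w) - u (s%:C * z)).
  have A : normc w * normc (u (s'%:C * w) - u (s%:C * z)) <=
      (1 + normc z) * normc (u (s'%:C * w) - u (s%:C * z)) by rewrite ler_wpM2r // ltW.
  have B : normc (w - z) * normc (u (s%:C * z)) <= normc (w - z) * (1 + normc (u (s%:C * z))).
    by rewrite ler_wpM2l //; lra.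
  lra.
move=> d d0 Hd; exists (Num.min d (r - normc z)); first by rewrite lt_min d0 subr_gt0.
move=> w; rewrite lt_min => /andP[wd wr].
have {}wr : normc w < r by have := le_normc_sub w z; lra.
have cB := ccont_onB (ccont_on_ray wr) (ccont_on_ray zr).
rewrite /clog -cintB; [|exact: ccont_on_ray..].
have := normc_cint_le ler01 cB; move=> /(_ (e / 4)) H.
apply: le_lt_trans (H _) _; last lra.
by move=> s s01; apply/ltW/Hd.
Qed.

(** Along the ray, f(sz) exp(- int_0^s V) has zero derivative, since [V] is the logarithmic
    derivative of s -> f(sz). *)
Lemma cexp_clog z : normc z < r -> f z = f 0 * cexp (clog z).
Proof.
move=> zr; pose V s := z * u (s%:C * z).
pose N s := f (s%:C * z) * cexp (- cint 0 s V).
have cV : ccont_on V 0 1 := ccont_on_ray zr.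
suff : N 0 = N 1.
  rewrite /N !mul0r !mul1r.
  have -> : cint 0 0 V = 0.
    apply: eq0_normc; apply/eqP; rewrite eq_le normc_ge0 andbT.
    have [M _ HM] : exists2 M, 0 <= M & forall s, 0 <= s <= 0 -> normc (V s) <= M.
      exists (normc (V 0)); first exact: normc_ge0.
      by move=> s s0; rewrite (@le_anti _ _ s 0) // andbC.
    have := normc_cint_le (lexx 0) (ccont_on_sub (lexx 0) ler01 cV) HM.
    by rewrite subrr mulr0.
  rewrite oppr0 cexp0 mulr1 => ->; rewrite cexpN mulfVK //; exact: cexp_neq0.
apply: const_of_zero_derivative => // s s01 e e0.
have sz : normc (s%:C * z) < r by apply: le_lt_trans zr; exact: normc_ray.
(* [M] is [N] near [s] with the primitive replaced by its tangent, so that the rules for [cder]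
   apply. The linearisation error [eta] returns as a factor [cexp (- eta)]. *)
pose M (y : C) := f (s%:C * z + y * z) * cexp (- (cint 0 s V + V s * y)).
have dM : cder M 0 0.
  have dlin : cder (fun y => s%:C * z + y * z) 0 z.
    apply: cder_eq (cderD (cder_cst _ _) (cderM (cder_id _) (cder_cst z _))) _; ring.
  have dlam : cder (fun y => - (cint 0 s V + V s * y)) 0 (- V s).
    apply: cder_eq (cderN (cderD (cder_cst _ _) (cderM (cder_cst (V s) _) (cder_id _)))) _; ring.
  have d1 : cder (fun y => f (s%:C * z + y * z)) 0 (f' (s%:C * z) * z).
    by apply: (cder_comp (f := fun y => s%:C * z + y * z)) => //; rewrite mul0r addr0; exact: df.
  have /cder_eq := cderM d1 (cder_comp dlam (cder_cexp _)); apply.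
  rewrite mul0r addr0 mulr0 addr0 /V /u.
  have := f_neq0 sz; move: (f _) (f' _) (cexp _) => F F' E F0; by field.
have [K K0 HK] := cexp_sub1_lip.
have M1 : 0 < normc (M 0) + 1 by rewrite ltr_wpDl // normc_ge0.
(* [cexp (- eta) - 1] will be at most [K * e1 * |s' - s|] and [M] at most [normc (M 0) + 1]; [e1]
   makes the product half of the allowance. *)
pose e1 := Num.min 1 (e / 2 / ((normc (M 0) + 1) * K)).
have e10 : 0 < e1 by rewrite lt_min ltr01 !divr_gt0 // mulr_gt0.
have e11 : e1 <= 1 by rewrite ge_min lexx.
have e1e : e1 * ((normc (M 0) + 1) * K) <= e / 2.
  by rewrite -ler_pdivlMr ?mulr_gt0 // ge_min lexx orbT.
have e20 : 0 < e / 2 by rewrite divr_gt0.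
have [d1 d10 H1] := cint_primitive cV s01 e10.
have [d2 d20 H2] := cnear_and (cder_le dM e20) (cder_cont dM ltr01).
exists (Num.min (Num.min d1 d2) 1); first by rewrite !lt_min d10 d20 ltr01.
move=> s' s'01; rewrite !lt_min => /andP[/andP[s'1 s'2] s'3].
have := H1 s' s'01 s'1; set eta := _ - _ - _ => Heta.
have [] := H2 (s' - s)%:C; first by rewrite subr0 normc_real.
rewrite mul0r !subr0 normc_real => Ha Hb.
have eta1 : normc (- eta) <= 1.
  rewrite normcN; apply: le_trans Heta _; rewrite mulr_ile1 // ltW //.
have -> : N s' = M (s' - s)%:C * cexp (- eta).
  rewrite /M /N -mulrA -cexpD; congr (f _ * cexp _); last by rewrite /eta; ring.
  by rewrite rmorphB /=; ring.
have -> : N s = M 0 by rewrite /M /N mul0r mulr0 !addr0.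
have -> : M (s' - s)%:C * cexp (- eta) - M 0 =
   M (s' - s)%:C * (cexp (- eta) - 1) + (M (s' - s)%:C - M 0) by ring.
apply: le_trans (le_normcD _ _) _; rewrite normcM.
have Hc : normc (M (s' - s)%:C) <= normc (M 0) + 1.
  by have := le_normc_sub (M (s' - s)%:C) (M 0); lra.
have Hd : normc (cexp (- eta) - 1) <= K * (e1 * `|s' - s|).
  by apply: le_trans (HK _ eta1) _; rewrite ler_pM2l // normcN.
have He := ler_pM (normc_ge0 _) (normc_ge0 _) Hc Hd.
have Hf : (normc (M 0) + 1) * (K * (e1 * `|s' - s|)) <= e / 2 * `|s' - s|.
  have -> : (normc (M 0) + 1) * (K * (e1 * `|s' - s|)) = e1 * ((normc (M 0) + 1) * K) * `|s' - s|.
    by ring.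
  by rewrite ler_wpM2r.
lra.
Qed.

(** Since exp(clog) = f / f(0) and the exponential has nonzero derivative, dividing Caratheodory's
    factorisation of [f] by that of [cexp] yields one for [clog]. *)
Lemma cder_clog z : normc z < r -> exists D, cder clog z D.
Proof.
move=> zr; have f00 : f 0 != 0 by apply: f_neq0; rewrite normc0 (le_lt_trans (normc_ge0 z)).
have [p [cp pD Hp]] := df zr.
have [q [cq qD [d d0 Hq]]] := cder_cexp (clog z).
have cL := ccont_clog zr.
have q0 : q (clog z) != 0 by rewrite qD; exact: cexp_neq0.
have cqL : ccont (fun w => q (clog w)) z := ccont_comp cL cq.
exists (p z / (f 0 * q (clog z))), (fun w => p w / (f 0 * q (clog w))); split => //.
  apply: ccontM => //; apply: ccontV; last by rewrite mulf_neq0.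
  by apply: ccontM => //; exact: ccont_cst.
have nr : cnear z (fun w => normc w < r).
  exists (r - normc z); first by rewrite subr_gt0.
  by move=> w; have := le_normc_sub w z; lra.
have nq := cnear_neq0 cqL q0.
apply: cnear_imp (cnear_and (cnear_and Hp nr) (cnear_and nq (cL _ d0))) _.
move=> w [[h1 h2] [h3 /Hq h4]].
have qw : q (clog w) != 0 by rewrite -normc_gt0 (le_lt_trans _ h3) // divr_ge0 ?normc_ge0.
apply: (mulfI (mulf_neq0 f00 qw)).
rewrite -mulrA -h4 mulrBr -!cexp_clog // h1.
by field; rewrite ?qw ?q0 ?f00.
Qed.

Lemma clog0 : clog 0 = 0.
Proof.
rewrite /clog (@eq_cint _ _ _ _ (fun=> 0)); last by move=> s _; rewrite mul0r.
by rewrite cint_cst // mul0r.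
Qed.

(** The derivative of an even function is odd, by uniqueness of the derivative, so the integrand on
    the ray is even in [z]. *)
Lemma clog_even z : (forall w, f (- w) = f w) -> normc z < r -> clog (- z) = clog z.
Proof.
move=> fe zr; apply: eq_cint => s s01.
have sz : normc (s%:C * z) < r by apply: le_lt_trans zr; exact: normc_ray.
rewrite mulrN /u fe.
have -> : f' (- (s%:C * z)) = - f' (s%:C * z); last by rewrite !mulNr mulrN opprK.
have szN : normc (- (s%:C * z)) < r by rewrite normcN.
apply: (@cder_unique _ f (- (s%:C * z))); first exact: df.
have dN : cder (fun w : C => - w) (- (s%:C * z)) (-1) by exact/cderN/cder_id.
have := cder_comp dN (g := f) (E := f' (s%:C * z)).
rewrite opprK => /(_ (df sz)); rewrite mulrN1 => /cder_near; apply.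
by exists 1 => // w _; rewrite fe.
Qed.

End Log.

(** A pointwise majorant instead of a constant: in the Borel-Caratheodory inequality only the
    integral of the majorant is controlled. *)
Lemma normc_cint_le_int (a b : R) (c : R -> C) (rho : R -> R) : a <= b ->
  ccont_on c a b -> rcont_on rho a b -> (forall t, a <= t <= b -> normc (c t) <= rho t) ->
  normc (cint a b c) <= 2 * \int[mu]_(t in `[a, b]) rho t.
Proof.
move=> ab cc cr H; apply: le_trans (le_normc_ReIm _) _ => /=.
have ir := rcont_on_integrable cr.
rewrite mulr2n mulrDl mul1r lerD //.
- have iR := ccont_on_Re_int cc.
  apply: le_trans (le_normr_Rintegral _ iR) _ => //; apply: le_Rintegral => //.
    exact: integrable_abse iR.
  by move=> t /=; rewrite in_itv/= => /H; apply: le_trans (le_Re_normc _).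
- have iR := ccont_on_Im_int cc.
  apply: le_trans (le_normr_Rintegral _ iR) _ => //; apply: le_Rintegral => //.
    exact: integrable_abse iR.
  by move=> t /=; rewrite in_itv/= => /H; apply: le_trans (le_Im_normc _).
Qed.

End Logarithm.

(** * The Borel-Caratheodory inequality for even functions *)

Section Hadamard.
Variable R : realType.
Local Notation C := R[i].
Local Notation mu := (@lebesgue_measure R).
Implicit Types (s t r e d : R) (z w : C) (f q : C -> C).

Lemma ccont_conj f z : ccont f z -> ccont (fun w => (f w)^*%C) z.
Proof.
by move=> cf e /cf/cnear_imp; apply => w; rewrite -rmorphB normc_conj.
Qed.

Lemma normc_nat n : normc (n%:R : C) = n%:R.
Proof. by rewrite -(rmorph_nat (real_complex R)) normc_real ger0_norm. Qed.

Lemma borel_caratheodory_even (L : C -> C) r (A : R) w : 0 < r -> 0 <= A ->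
  (forall z, normc z <= r -> ccont L z) ->
  (forall z, normc z < r -> exists D, cder L z D) ->
  L 0 = 0 -> (forall z, normc z = r -> complex.Re (L z) <= A) ->
  normc w <= r / 2 -> L (- w) = L w ->
  normc (L w) <= 16 * A * (normc w ^+ 2 / r ^+ 2).
Proof.
move=> r0 A0 cL dL L0 LA wr2 Le.
have wr : normc w < r by lra.
pose P : C := (pi *+ 2)%:C.
have cLr z : normc z = r -> ccont L z by move=> zr; apply: cL; rewrite zr.
have ck w' z : normc w' < r -> normc z = r -> ccont (fun z => z / (z - w')) z.
  by move=> w'r zr; apply: ccont_kernel; rewrite -subr_eq0 sub_neq0_normc // zr.
have cR z : normc z = r -> ccont (fun z => L z + (L z)^*%C) z.
  by move=> zr; apply: ccontD; [exact: cLr|exact/ccont_conj/cLr].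
(* Schwarz's formula: [L] against the kernel gives [L w'], while its conjugate contributes only the
   conjugate of L(0) = 0, by [circ_conj_kernel]. *)
have poisson w' : normc w' < r ->
    circ r (fun z => (L z + (L z)^*%C) * (z / (z - w'))) = L w' * P.
  move=> w'r.
  have -> : circ r (fun z => (L z + (L z)^*%C) * (z / (z - w'))) =
      circ r (fun z => L z * (z / (z - w')) + (L z * (z / (z - w'))^*%C)^*%C).
    by apply: eq_circ; [exact: ltW|move=> z _; rewrite rmorphM /= conjcK; ring].
  rewrite circD; last 3 first.
  - exact: ltW.
  - by move=> z zr; apply: ccontM; [exact: cLr|exact: ck].
  - by move=> z zr; apply/ccont_conj/ccontM; [exact: cLr|exact/ccont_conj/ck].
  rewrite circ_conj ?(ltW r0) //; last first.
    by move=> z zr; apply/ccontM; [exact: cLr|exact/ccont_conj/ck].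
  rewrite circ_conj_kernel // L0 mul0r conjc0 addr0.
  rewrite (@cauchy_formula R [::] L r w' cL (fun z zr _ => dL z zr) w'r).
  by apply: eq_circ; [exact: ltW|move=> z _; rewrite expr1].
have circL : circ r L = 0.
  by rewrite (@mean_value _ [::]) ?(ltW r0) ?L0 ?mul0r // => z /andP[_ zr] _; exact: dL.
have circR : circ r (fun z => L z + (L z)^*%C) = 0.
  rewrite circD ?(ltW r0) //; last by move=> z zr; exact/ccont_conj/cLr.
  by rewrite circ_conj ?(ltW r0) // circL conjc0 addr0.
have zw2 z : normc z = r -> z ^+ 2 - w ^+ 2 != 0.
  by move=> zr; apply: sub_neq0_normc; rewrite !normcX zr ltrXn2r ?nnegrE ?normc_ge0 ?(ltW r0).
have wNr : normc (- w) < r by rewrite normcN.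
(* Adding the formulas at [w] and [- w] and subtracting twice the mean leaves the kernel z/(z - w) +
   z/(z + w) - 2 = 2 w^2 / (z^2 - w^2), of second order in [w]. *)
have eqL : 2 * L w * P =
    circ r (fun z => (L z + (L z)^*%C) * (2 * (w ^+ 2 / (z ^+ 2 - w ^+ 2)))).
  transitivity (L w * P + L (- w) * P - 2 * 0); first by rewrite Le; ring.
  rewrite -circR -!poisson // -circD ?(ltW r0) //; last 2 first.
  - by move=> z zr; apply: ccontM; [exact: cR|exact: ck].
  - by move=> z zr; apply: ccontM; [exact: cR|exact: ck].
  rewrite -circZ ?(ltW r0) // -circB ?(ltW r0) //; last 2 first.
  - by move=> z zr; apply: ccontD; apply: ccontM; [exact: cR|exact: ck|exact: cR|exact: ck].
  - by move=> z zr; apply: ccontM; [exact: ccont_cst|exact: cR].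
  apply: eq_circ; first exact: ltW.
  move=> z zr; have h1 : z - w != 0 by apply: sub_neq0_normc; rewrite zr.
  have h2 : z - - w != 0 by apply: sub_neq0_normc; rewrite zr.
  by rewrite opprK in h2 *; field; rewrite h1 h2 zw2.
pose c := normc w ^+ 2 / r ^+ 2.
(* Re L <= A gives |Re L| <= 2 A - Re L, whose mean is 2 A because Re L has mean 0; and |w| <= r/2
   bounds the kernel by 4 |w|^2 / r^2. *)
pose rho t := 2 * (2 * A - complex.Re (L (r%:C * expi t))) * (4 * c).
have cLt : ccont_on (fun t => L (r%:C * expi t)) 0 (pi *+ 2) by apply: ccont_on_circ => //; exact: ltW.
have cLR := ccont_on_Re cLt.
have iLR := ccont_on_Re_int cLt.
have c0 : 0 <= c by rewrite divr_ge0 ?sqr_ge0.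
have c80 : 0 <= 8 * c by rewrite mulr_ge0.
have crho : rcont_on rho 0 (pi *+ 2).
  move=> t tt e e0; have K0 : 0 < 8 * c + 1 by lra.
  have [d d0 Hd] := cLR t tt _ (divr_gt0 e0 K0).
  exists d => // t' tt' /(Hd t' tt'); rewrite ltr_pdivlMr // /rho => h.
  set X := complex.Re _ in h *; set Y := complex.Re _ in h *.
  have -> : 2 * (2 * A - X) * (4 * c) - 2 * (2 * A - Y) * (4 * c) = (8 * c) * (Y - X) by ring.
  rewrite normrM (ger0_norm c80) distrC; have := normr_ge0 (X - Y).
  by move: h; rewrite mulrDr mulr1 mulrC; lra.
have bound : forall t, 0 <= t <= pi *+ 2 ->
   normc ((L (r%:C * expi t) + (L (r%:C * expi t))^*%C) *
     (2 * (w ^+ 2 / ((r%:C * expi t) ^+ 2 - w ^+ 2)))) <= rho t.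
  move=> t _; set z := r%:C * expi t.
  have zr : normc z = r by rewrite normc_arc gtr0_norm.
  rewrite addcJ 4!normcM normcV normcX.
  rewrite normc_nat normc_real /rho -/z.
  have rA := LA z zr.
  have hR : `|complex.Re (L z)| <= 2 * A - complex.Re (L z) by rewrite ler_norml; apply/andP; split; lra.
  have hk : 2 * (normc w ^+ 2 / normc (z ^+ 2 - w ^+ 2)) <= 4 * c.
    have w2 : normc w ^+ 2 <= r ^+ 2 / 4.
      have -> : r ^+ 2 / 4 = (r / 2) ^+ 2 by field.
      by rewrite lerXn2r ?nnegrE ?normc_ge0 // divr_ge0 // ltW.
    have r2 : 0 < r ^+ 2 by rewrite exprn_gt0.
    have := le_normc_sub (z ^+ 2) (w ^+ 2); rewrite !normcX zr => hd.
    have -> : 4 * c = 2 * (normc w ^+ 2 / (r ^+ 2 / 2)) by rewrite /c; field; rewrite gt_eqF.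
    rewrite ler_pM2l // ler_wpM2l ?sqr_ge0 // lef_pV2 ?posrE //; last by rewrite divr_gt0.
      lra.
    lra.
  apply: ler_pM => //; rewrite ?mulr_ge0 ?invr_ge0 ?normc_ge0 ?sqr_ge0 //.
  by rewrite ler_pM2l.
have H : normc (2 * L w * P) <= 2 * \int[mu]_(t in `[0, pi *+ 2]) rho t.
  rewrite eqL; apply: normc_cint_le_int => //; first exact/ltW/pi2_gt0.
  apply: (@ccont_on_circ _ r (fun z => (L z + (L z)^*%C) * (2 * (w ^+ 2 / (z ^+ 2 - w ^+ 2))))).
    exact: ltW.
  move=> z zr; apply: ccontM; first exact: cR.
  apply: ccontM; first exact: ccont_cst.
  apply: ccontM; first exact: ccont_cst.
  apply: ccontV; last exact: zw2.
  by apply: ccontB; [apply: ccontX; exact: ccont_id|exact: ccont_cst].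
have irho : \int[mu]_(t in `[0, pi *+ 2]) rho t = 16 * A * c * (pi *+ 2).
  transitivity (\int[mu]_(t in `[0, pi *+ 2]) (16 * A * c - 8 * c * complex.Re (L (r%:C * expi t)))).
    by apply: eq_Rintegral => t _; rewrite /rho; ring.
  rewrite RintegralB //.
  - rewrite Rintegral_cst // lebesgue_measure_itvcc ?(ltW (pi2_gt0 R)) // subr0.
    rewrite RintegralZl //.
    have -> : \int[mu]_(t in `[0, pi *+ 2]) complex.Re (L (r%:C * expi t)) = complex.Re (circ r L) by [].
    by rewrite circL /= mulr0 subr0.
  - by apply: continuous_compact_integrable; [exact: segment_compact|exact: cst_continuous].
  - exact: (integrableZl _ (8 * c) iLR).
rewrite irho 2!normcM in H.
have nP : normc P = pi *+ 2 by rewrite normc_real gtr0_norm // pi2_gt0.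
rewrite nP normc_nat in H.
have p0 := pi2_gt0 R; rewrite -/c -(ler_pM2r p0) -(@ler_pM2l _ 2) //.
by rewrite mulrA.
Qed.

End Hadamard.

(** * Hadamard factorisation *)

Section HadamardProduct.
Variable R : realType.
Local Notation C := R[i].
Implicit Types (s t r e d a : R) (z w D : C) (f q : C -> C).

Definition centire f := forall z, exists D, cder f z D.

Lemma centire_ccont f z : centire f -> ccont f z.
Proof. by move=> /(_ z)[D /cder_cont]. Qed.

Lemma removable_centire f (E : seq R) : (forall z, ccont f z) ->
  (forall z, normc z \notin E -> exists D, cder f z D) -> centire f.
Proof.
move=> cf df z.
have [f' /(_ z)] := @removable_cder R E f (normc z + 1) (fun z _ => cf z) (fun z _ => df z).
by rewrite ltrDl ltr01 => /(_ isT)[H _]; exists (f' z).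
Qed.

(** Cauchy's integral supplies the continuity of the derivative, which the integrand f'/f of the
    logarithm requires. *)
Lemma centire_derivative f : centire f ->
  exists f', forall z, cder f z (f' z) /\ ccont f' z.
Proof.
move=> df; have /choice[f' Hf'] := df; exists f' => z; split => //.
have [g Hg] := @removable_cder R [::] f (normc z + 1) (fun z _ => centire_ccont z df)
  (fun z _ _ => df z).
have zr : normc z < normc z + 1 by rewrite ltrDl.
have [_ cg] := Hg z zr; apply: ccont_near cg _; exists 1 => // w wz.
have wr : normc w < normc z + 1 by have := le_normc_sub w z; lra.
by have [dg _] := Hg w wr; exact: cder_unique dg (Hf' w).
Qed.

Definition zfactor a z : C := 1 - z ^+ 2 / (a ^+ 2)%:C.

Lemma zfactor_even a z : zfactor a (- z) = zfactor a z.
Proof. by rewrite /zfactor sqrrN. Qed.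

Lemma zfactor_eq0 a z : 0 < a -> (zfactor a z == 0) = (z == a%:C) || (z == - a%:C).
Proof.
move=> a0; have a2 : (a ^+ 2)%:C != 0 :> C.
  by rewrite -normc_gt0 normc_real normr_gt0 expf_neq0 // gt_eqF.
rewrite -eqf_sqr -rmorphXn -[RHS]subr_eq0 /=.
have -> : z ^+ 2 - (a ^+ 2)%:C = - (a ^+ 2)%:C * zfactor a z.
  by rewrite /zfactor; move: (a ^+ 2)%:C a2 => b b0; field.
by rewrite mulf_eq0 oppr_eq0 (negbTE a2).
Qed.

Lemma cder_zfactor a z : exists D, cder (zfactor a) z D.
Proof.
eexists; apply: cderB; first exact: cder_cst.
apply: cderM; last exact: cder_cst.
by apply: (cder_near (cderM (cder_id z) (cder_id z))); exists 1 => // w _; rewrite expr2.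
Qed.

Lemma zfactor_normc a z : 0 < a -> zfactor a z = 0 -> normc z = a.
Proof.
move=> a0 /eqP; rewrite zfactor_eq0 // => /orP[] /eqP->; rewrite ?normcN normc_real gtr0_norm //.
Qed.

(** The quotient is differentiable off the circle |z| = a and continuous at the points [a] and
    [- a]; the circle is then removable. *)
Lemma divide_zero f a Da : centire f -> even_fun f -> 0 < a -> f a%:C = 0 ->
  cder f a%:C Da ->
  exists q, [/\ centire q, even_fun q, forall z, f z = zfactor a z * q z &
    Da != 0 -> q a%:C != 0].
Proof.
move=> ef fev a0 fa dfa.
have a0C : a%:C != 0 :> C by rewrite -normc_gt0 normc_real normr_gt0 gt_eqF.
(* The limit at [a], read off from f(z) / (1 - z^2/a^2) = - a^2 / (a + z) * f(z) / (z - a). Evenness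
   gives the same value at [- a]. *)
pose q z := if zfactor a z == 0 then - (a%:C / 2) * Da else f z / zfactor a z.
have qev z : q (- z) = q z by rewrite /q zfactor_even fev.
have fq z : f z = zfactor a z * q z.
  rewrite /q; case: ifPn => [z0|z0]; last by rewrite mulrC divfK.
  rewrite (eqP z0) mul0r; move: z0; rewrite zfactor_eq0 //.
  by move=> /orP[] /eqP->; rewrite ?fev.
have qnear z : zfactor a z != 0 -> cnear z (fun w => f w / zfactor a w = q w).
  move=> z0; have [D /cder_cont cz] := cder_zfactor a z.
  apply: cnear_imp (cnear_neq0 cz z0) _ => w h; rewrite /q ifN //.
  by rewrite -normc_gt0 (le_lt_trans _ h) // divr_ge0 ?normc_ge0.
have dq z : normc z \notin [:: a] -> exists D, cder q z D.
  rewrite inE => za; have z0 : zfactor a z != 0.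
    by apply: contraNneq za => /(zfactor_normc a0)->.
  have [D dz] := cder_zfactor a z; have [D' df] := ef z.
  by eexists; apply: cder_near (qnear z z0); apply: cderM df (cderV dz z0).
have cqa : ccont q a%:C.
  have [p [cp pD Hp]] := dfa.
  have aa : a%:C + a%:C != 0 :> C by rewrite -mulr2n mulrn_eq0.
  have caa : ccont (fun w => a%:C + w) a%:C.
    by apply: ccontD; [exact: ccont_cst|exact: ccont_id].
  apply: (@ccont_near R (fun w => - p w * (a%:C ^+ 2 / (a%:C + w)))).
    apply: ccontM; first exact: ccontN.
    by apply: ccontM; [exact: ccont_cst|exact: ccontV].
  apply: cnear_imp (cnear_and Hp (cnear_neq0 caa aa)) _ => w [h1 h2].
  have wa : a%:C + w != 0 by rewrite -normc_gt0 (le_lt_trans _ h2) // divr_ge0 ?normc_ge0.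
  rewrite /q; have [w0|w0] := eqVneq w a%:C.
    rewrite w0 zfactor_eq0 // eqxx /= pD; field; rewrite -mulr2n mulrn_eq0 //.
  have z0 : zfactor a w != 0.
    rewrite zfactor_eq0 // (negbTE w0) /= -subr_eq0 opprK addrC //.
  have aw : a%:C - w != 0 by rewrite subr_eq0 eq_sym.
  have zE : zfactor a w = (a%:C - w) * (a%:C + w) / a%:C ^+ 2.
    by rewrite /zfactor rmorphXn; field.
  rewrite (negbTE z0) zE; rewrite fa subr0 in h1; rewrite h1.
  by field; rewrite a0C wa aw.
exists q; split => //; last first.
  by rewrite /q zfactor_eq0 // eqxx /= => Da0; rewrite mulf_neq0 // oppr_eq0 mulf_neq0 // invr_eq0 pnatr_eq0.
apply: (@removable_centire _ [:: a]) => // z.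
have [z0|z0] := eqVneq (zfactor a z) 0; last first.
  apply: ccont_near (qnear z z0); apply: ccontM; first exact: centire_ccont.
  by apply: ccontV => //; have [D /cder_cont] := cder_zfactor a z.
move/eqP: z0; rewrite zfactor_eq0 // => /orP[] /eqP-> //.
have cN : ccont (fun w : C => - w) (- a%:C) by exact/ccontN/ccont_id.
have := @ccont_comp _ _ q _ cN; rewrite opprK => /(_ cqa)/ccont_near; apply.
by exists 1 => // w _; rewrite qev.
Qed.

Section Product.
Variables (f : C -> C) (a : nat -> R).
Hypotheses (ef : centire f) (fev : even_fun f) (f0 : f 0 = 1)
  (a_gt0 : forall n, 0 < a n) (a_incr : forall n, a n < a n.+1)
  (fz : forall z, f z = 0 <-> exists n, z = (a n)%:C \/ z = - (a n)%:C)
  (fsimple : forall z D, f z = 0 -> cder f z D -> D != 0).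

Lemma a_mono (m n : nat) : (m < n)%N -> a m < a n.
Proof. exact: (homo_ltn (@lt_trans _ R) a_incr). Qed.

Definition zprod N z : C := \prod_(n < N) zfactor (a n) z.

Lemma zprodS N z : zprod N.+1 z = zprod N z * zfactor (a N) z.
Proof. by rewrite /zprod big_ord_recr. Qed.

Lemma zprod_neq0 N z : a N <= normc z -> zprod N z != 0.
Proof.
move=> h; apply/prodf_neq0 => n _; apply/negP => /eqP/(zfactor_normc (a_gt0 n)) E.
by have := a_mono (ltn_ord n); rewrite -E ltNge h.
Qed.

(** Simplicity is part of the induction: it is what makes [a N] cease to be a zero after one
    division, so that the remaining zeros move outwards. *)
Lemma divide_zeros N : exists q, [/\ centire q, even_fun q,
  forall z, f z = zprod N z * q z,
  forall z, q z = 0 -> exists2 n, (N <= n)%N & normc z = a n &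
  forall z D, q z = 0 -> cder q z D -> D != 0].
Proof.
elim: N => [|N [q [eq qev fq qz qs]]].
  exists f; split => //.
    by move=> z; rewrite /zprod big_ord0 mul1r.
  move=> z /fz[n zn]; exists n => //.
  by case: zn => ->; rewrite ?normcN normc_real gtr0_norm.
have aN : q (a N)%:C = 0.
  have : f (a N)%:C = 0 by apply/fz; exists N; left.
  rewrite fq => /eqP; rewrite mulf_eq0 (negbTE (zprod_neq0 _)) => [/eqP//|].
  by rewrite normc_real gtr0_norm.
have [Da dq] := eq (a N)%:C.
have [q' [eq' q'ev qq' q'a]] := divide_zero eq qev (a_gt0 N) aN dq.
have Da0 := qs _ _ aN dq.
have q'z z : q' z = 0 -> q z = 0 /\ zfactor (a N) z != 0.
  move=> z0; split; first by rewrite qq' z0 mulr0.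
  rewrite zfactor_eq0 //; apply/negP => /orP[] /eqP zE; move: z0; rewrite zE ?q'ev => /eqP;
    by rewrite (negbTE (q'a Da0)).
exists q'; split => //.
- by move=> z; rewrite fq qq' zprodS mulrA.
- move=> z /q'z[z0 zN]; have [n Nn zn] := qz z z0; exists n => //.
  rewrite ltn_neqAle Nn andbT; apply: contraNneq zN => Nn'.
  have [m [zm|zm]] : exists m, z = (a m)%:C \/ z = - (a m)%:C.
    by apply/fz; rewrite fq z0 mulr0.
  + rewrite zfactor_eq0 // Nn' -zn zm normc_real gtr0_norm ?eqxx //.
  + by rewrite zfactor_eq0 // Nn' -zn zm normcN normc_real gtr0_norm ?eqxx ?orbT.
- move=> z D z0 dD; have [qz0 zN] := q'z z z0.
  have [E dE] := cder_zfactor (a N) z.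
  have dqz : cder q z (zfactor (a N) z * D).
    have := cderM dE dD; rewrite z0 mulr0 add0r => /cder_near; apply.
    by exists 1 => // w _; rewrite qq'.
  by have := qs _ _ qz0 dqz; rewrite mulf_eq0 negb_or => /andP[].
Qed.

Hypotheses (a_infty : forall M, exists n, M <= a n)
  (growth : forall e, 0 < e -> exists r0, forall z, r0 <= normc z ->
     normc (f z) <= expR (e * normc z ^+ 2)).

Lemma zfactor_ge1 a' z : 0 < a' -> 2 * a' <= normc z -> 1 <= normc (zfactor a' z).
Proof.
move=> a'0 h; have a2 : 0 < a' ^+ 2 by rewrite exprn_gt0.
have := le_normc_subr 1 (z ^+ 2 / (a' ^+ 2)%:C).
rewrite normc1 normcM normcV normcX normc_real (ger0_norm (ltW a2)) -/(zfactor a' z).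
have : 4 <= normc z ^+ 2 / a' ^+ 2.
  rewrite ler_pdivlMr //; have -> : 4 * a' ^+ 2 = (2 * a') ^+ 2 by ring.
  by rewrite lerXn2r ?nnegrE ?normc_ge0 // mulr_ge0 // ltW.
lra.
Qed.

Lemma zprod_ge1 N z : 2 * a N <= normc z -> 1 <= normc (zprod N z).
Proof.
move=> h; rewrite /zprod.
have : forall n : 'I_N, 1 <= normc (zfactor (a n) z).
  move=> n; apply: zfactor_ge1 => //; have := a_mono (ltn_ord n); lra.
elim: N {h} => [|N IH] H; first by rewrite big_ord0 normc1.
rewrite big_ord_recr normcM /=; apply: mulr_ege1; last exact: (H ord_max).
apply: IH => n; exact: (H (widen_ord (leqnSn N) n)).
Qed.

(** Four radii: the growth of [f] is used on |z| = 4 a_N, [q] is bounded on |z| <= 2 a_N, its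
    logarithm lives on |z| < a_N, and Borel-Caratheodory is applied with radius a_N / 2, so for |w|
    <= a_N / 4. *)
Theorem hadamard_product w e : 0 < e -> exists N0, forall N, (N0 <= N)%N ->
  exists2 k, normc (k - 1) < e & f w = zprod N w * k.
Proof.
move=> e0; have [K K0 HK] := @cexp_sub1_lip R.
pose eta := Num.min 1 (e / (2 * K)).
have eta0 : 0 < eta by rewrite lt_min ltr01 divr_gt0 // mulr_gt0.
pose nw := normc w ^+ 2 + 1.
have nw0 : 0 < nw by rewrite ltr_wpDl ?sqr_ge0.
(* 32 is for the bound [A <= 32 * (eps * a N ^+ 2)], 16 is the constant of Borel-Caratheodory, and 4
   comes from its radius [a N / 2]. *)
pose eps := eta / (32 * (16 * (4 * nw))); have eps0 : 0 < eps by rewrite divr_gt0 // !mulr_gt0.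
have [r0 Hr0] := growth eps0.
have l4 : 0 <= ln 4 :> R by rewrite ln_ge0 // ler1n.
(* [r0] gives access to the growth bound and [4 * normc w] to Borel-Caratheodory at [w]. The last
   term ensures [a N >= 1] and lets [eps * a N ^+ 2] absorb [ln 4]. *)
have [N0 HN0] := a_infty (Num.max (Num.max r0 (4 * normc w)) (1 + ln 4 / eps)).
exists N0 => N N0N.
have {}HN0 : Num.max (Num.max r0 (4 * normc w)) (1 + ln 4 / eps) <= a N.
  by apply: le_trans HN0 _; move: N0N; rewrite leq_eqVlt => /orP[/eqP->//|/a_mono/ltW].
move: HN0; rewrite !ge_max => /andP[/andP[r0a wa] la].
have [q [eq qev fq qz _]] := divide_zeros N.
exists (q w) => //.
have aN := a_gt0 N.
have a1 : 1 <= a N by apply: le_trans la; rewrite lerDl divr_ge0 // ltW.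
(* On |z| = 4 a_N the divided product has modulus at least 1, so [f] bounds [q] there;
   [cauchy_bound] brings the estimate inside. The 16 is 4^2. *)
have qb z : normc z <= 2 * a N -> normc (q z) <= 4 * expR (16 * eps * a N ^+ 2).
  move=> zr; apply: (@cauchy_bound R q (4 * a N)).
  - by move=> y _; exact: centire_ccont.
  - by move=> y _; exact: eq.
  - move=> y yr; apply: (@le_trans _ _ (normc (f y))).
      rewrite fq normcM ler_peMl ?normc_ge0 // zprod_ge1 // yr; lra.
    have -> : 16 * eps * a N ^+ 2 = eps * normc y ^+ 2 by rewrite yr; ring.
    apply: Hr0; rewrite yr; lra.
  - exact: expR_ge0.
  - lra.
  - by rewrite mulr_gt0.
have q0 z : normc z < a N -> q z != 0.
  move=> zN; apply/negP => /eqP/qz[n Nn zn]; move: zN; rewrite zn ltNge.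
  by move: Nn; rewrite leq_eqVlt => /orP[/eqP->|/a_mono/ltW->//]; rewrite lexx.
have [q' Hq'] := centire_derivative eq.
have dq z (_ : normc z < a N) : cder q z (q' z) by have [] := Hq' z.
have cq' z (_ : normc z < a N) : ccont q' z by have [] := Hq' z.
have q00 : q 0 = 1.
  have := fq 0; rewrite f0 /zprod big1 ?mul1r // => n _.
  by rewrite /zfactor expr0n mul0r subr0.
pose L := clog q q'.
have qL z : normc z < a N -> q z = cexp (L z).
  by move=> zN; rewrite (cexp_clog dq cq' q0 zN) q00 mul1r.
pose A := ln 4 + 16 * eps * a N ^+ 2.
have A0 : 0 <= A.
  by apply: addr_ge0 => //; apply: mulr_ge0 (sqr_ge0 _); apply: mulr_ge0 (ltW eps0).
have LA z : normc z < a N -> complex.Re (L z) <= A.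
  move=> zN; rewrite -ler_expR -normc_cexp -qL // /A expRD lnK ?posrE //.
  by apply: qb; lra.
have Lw : normc (L w) <= 16 * A * (normc w ^+ 2 / (a N / 2) ^+ 2).
  apply: borel_caratheodory_even => //.
  - by rewrite divr_gt0.
  - by move=> z zr; apply: (ccont_clog dq cq' q0); lra.
  - by move=> z zr; apply: (cder_clog dq cq' q0); lra.
  - exact: clog0.
  - by move=> z zr; apply: LA; lra.
  - lra.
  - by apply: (clog_even dq qev); lra.
have Lw' : normc (L w) <= eta.
  apply: le_trans Lw _.
  have lA : ln 4 <= eps * a N ^+ 2.
    have : ln 4 <= eps * a N by rewrite -ler_pdivrMl // mulrC; lra.
    have : eps * a N <= eps * a N ^+ 2.
      by rewrite ler_pM2l // expr2 ler_peMr // ltW.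
    lra.
  have A17 : A <= 32 * (eps * a N ^+ 2).
    have : 0 <= eps * a N ^+ 2 by rewrite mulr_ge0 ?sqr_ge0 // ltW.
    rewrite /A; lra.
  have q1 : 0 <= normc w ^+ 2 / (a N / 2) ^+ 2 by rewrite divr_ge0 ?sqr_ge0.
  apply: (@le_trans _ _ (16 * (32 * (eps * a N ^+ 2)) * (normc w ^+ 2 / (a N / 2) ^+ 2))).
    by rewrite ler_wpM2r // ler_pM2l.
  have -> : 16 * (32 * (eps * a N ^+ 2)) * (normc w ^+ 2 / (a N / 2) ^+ 2) = eta * (normc w ^+ 2 / nw).
    by rewrite /eps; field; rewrite !gt_eqF.
  by rewrite ler_piMr ?(ltW eta0) // ler_pdivrMr // mul1r /nw; lra.
have eta1 : eta <= 1 by rewrite ge_min lexx.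
have etae : eta * (2 * K) <= e by rewrite -ler_pdivlMr ?mulr_gt0 // ge_min lexx orbT.
rewrite qL; last lra.
apply: le_lt_trans (HK _ (le_trans Lw' eta1)) _.
have : K * normc (L w) <= K * eta by rewrite ler_pM2l.
lra.
Qed.

End Product.
End HadamardProduct.

(** * From [entire] and [growth_order] to products on the imaginary axis *)

Section FromStatement.
Variable R : realType.
Local Notation C := R[i].
Implicit Types (s t r e d : R) (z w D : C).

Lemma normCE z : `|z| = (normc z)%:C.
Proof. by case: z. Qed.

Lemma derivable_cder (f : C^o -> C^o) z : derivable f z 1 -> cder f z (f^`()%classic z).
Proof.
move=> /cvg_ex[l Hl].
have -> : f^`()%classic z = l.
  by rewrite derive1E; apply: cvg_lim Hl; exact: norm_hausdorff.
apply: cder_le_intro => e e0.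
have e0C : (0 : C) < e%:C by rewrite ltcR.
move/cvgrPdist_lt : Hl => /(_ _ e0C).
rewrite near_withinE => /nbhs_ballP[d /= d0 Hd].
(* Radii of balls in [C^o] are complex numbers; positivity makes this one real. *)
have dE : d = (complex.Re d)%:C by rewrite RRe_real // gtr0_real.
exists (complex.Re d); first by rewrite -ltcR -dE.
move=> w wz; have [->|wz0] := eqVneq w z; first by rewrite !subrr mulr0 subr0 normc0 mulr0.
have h0 : w - z != 0 by rewrite subr_eq0.
have wd : ball (0 : C^o) d (w - z).
  by rewrite /ball /= sub0r normrN normCE dE ltcR.
have := Hd (w - z) wd h0; rewrite normCE ltcR.
have -> : (w - z) *: (1 : C^o) + z = w by rewrite /GRing.scale /= mulr1 subrK.
rewrite /GRing.scale /= => h.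
have -> : f w - f z - l * (w - z) = (w - z) * ((w - z)^-1 * (f w - f z) - l) by field.
by rewrite normcM [leRHS]mulrC ler_wpM2l ?normc_ge0 // normcB ltW.
Qed.

Lemma entire_centire (f : C -> C) : entire f -> centire f.
Proof. by move=> ef z; eexists; apply: derivable_cder; exact: ef. Qed.

(** The supremum bounds its set only if that set is bounded, which is what [bounded_disc]
    provides. *)
Lemma le_max_modulus (f : C -> C) z : centire f -> normc (f z) <= max_modulus f (normc z).
Proof.
move=> ef; apply: ub_le_sup; last by exists z.
have [M _ HM] := @bounded_disc R f (normc z) (fun w _ => centire_ccont w ef).
by exists M => _ [w /= wz <-]; apply: HM; rewrite wz.
Qed.

Lemma growth_of_order (f : C -> C) : centire f -> (growth_order f < 2%:E)%E ->
  forall e, 0 < e -> exists r0, forall z, r0 <= normc z ->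
     normc (f z) <= expR (e * normc z ^+ 2).
Proof.
move=> ef /ereal_inf_lt[y [V [M [_ HM]] <-]] y2 e e0.
pose F r : R := ln (ln (max_modulus f r)) / ln r.
have [rho rho2 Hrho] : exists2 rho : R, rho < 2 & forall r, M < r -> F r <= rho.
  have ub r : M < r -> ((F r)%:E <= ereal_sup [set (F x)%:E | x in V])%E.
    by move=> Mr; apply: ereal_sup_ubound; exists r => //; exact: HM.
  move: y2 ub; rewrite -/F; case: (ereal_sup _) => [x| |] //=.
    by rewrite lte_fin => x2 ub; exists x => // r /ub; rewrite lee_fin.
  by move=> _ ub; exists 1; [rewrite ltr1n|move=> r /ub].
(* [M + 1] gives [F r <= rho], the 1 makes [ln r] positive, and ln r >= - ln e / (2 - rho) says that
   r^rho <= e r^2. *)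
pose r0 := Num.max (M + 1) (expR (Num.max 1 (- ln e / (2 - rho)))).
exists r0 => z; rewrite ge_max => /andP[Mz ez].
set r := normc z in Mz ez *.
have rp : 0 < r by apply: lt_le_trans ez; exact: expR_gt0.
have : Num.max 1 (- ln e / (2 - rho)) <= ln r by rewrite -ler_expR lnK.
rewrite ge_max => /andP[lr1]; rewrite ler_pdivrMr ?subr_gt0 // => lre.
have lr0 : 0 < ln r by lra.
apply: le_trans (le_max_modulus z ef) _; rewrite -/r.
have key : expR (rho * ln r) <= e * r ^+ 2.
  have -> : e * r ^+ 2 = expR (ln e + ln r + ln r).
    by rewrite !expRD !lnK ?posrE // expr2 mulrA.
  by rewrite ler_expR; lra.
(* If the maximum modulus is at most 1, its iterated logarithm carries no information, but the bound
   is immediate. *)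
have [m1|m1] := leP (max_modulus f r) 1.
  apply: le_trans m1 _; rewrite -[leLHS]expR0 ler_expR mulr_ge0 ?sqr_ge0 //; exact: ltW.
have lm0 : 0 < ln (max_modulus f r) by rewrite ln_gt0.
have : F r <= rho by apply: Hrho; lra.
rewrite ler_pdivrMr // => h.
rewrite -[leLHS]lnK ?posrE ?(lt_trans ltr01) // ler_expR; apply: le_trans key.
by rewrite -[leLHS]lnK ?posrE // ler_expR.
Qed.

Definition pprod (a : nat -> R) N t : R := \prod_(n < N) (1 + t ^+ 2 / a n ^+ 2).

Lemma pprod_ge1 a N t : 1 <= pprod a N t.
Proof.
rewrite /pprod; elim/big_ind : _ => // [x y x1 y1|n _]; first exact: mulr_ege1.
by rewrite lerDl divr_ge0 ?sqr_ge0.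
Qed.

Lemma zprod_imaginary a N t : zprod a N ('i%C * t%:C) = (pprod a N t)%:C.
Proof.
rewrite /zprod /pprod rmorph_prod /=; apply: eq_bigr => n _.
rewrite /zfactor exprMn sqr_i mulN1r mulNr opprK rmorphD rmorph1 (rmorphM _ (t ^+ 2)) fmorphV.
by rewrite !rmorphXn.
Qed.

Lemma entire_pprod_cvg (f : C -> C) (a : nat -> R) :
  entire f -> even_fun f -> (growth_order f < 2%:E)%E -> f 0 = 1 ->
  increasing_positive_seq a -> (forall z, f z = 0 -> simple_zero f z) ->
  zero_set f = [set z | exists n : nat, z = (a n)%:C \/ z = - (a n)%:C] ->
  forall t e, 0 < e -> exists N0, forall N, (N0 <= N)%N ->
    normc (f ('i%C * t%:C) - (pprod a N t)%:C) < e.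
Proof.
move=> ef fev fo f0 [a0 aS ainf] fs fz t e e0.
have a_gt0 n : 0 < a n by elim: n => // n; move/lt_trans; apply.
have a_infty M : exists n, M <= a n.
  by move/cvgryPge : ainf => /(_ M)[n _ Hn]; exists n; apply: Hn => /=.
have fzP z : f z = 0 <-> exists n, z = (a n)%:C \/ z = - (a n)%:C.
  by change (zero_set f z <-> exists n, z = (a n)%:C \/ z = - (a n)%:C); rewrite fz.
have cf := entire_centire ef.
have fsi z D : f z = 0 -> cder f z D -> D != 0.
  move=> /fs[_ /eqP + dD]; rewrite (cder_unique dD (derivable_cder (ef z))) //.
have H := hadamard_product cf fev f0 a_gt0 aS fzP fsi a_infty (growth_of_order cf fo)
  ('i%C * t%:C).
set w := 'i%C * t%:C in H *.
pose K := 2 * normc (f w) + 1.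
have K0 : 0 < K by rewrite ltr_wpDl // mulr_ge0 // normc_ge0.
have d0 : 0 < Num.min 2^-1 (e / K) by rewrite lt_min invr_gt0 ltr0n divr_gt0.
have [N0 HN0] := H _ d0; exists N0 => N /HN0[k].
rewrite lt_min ltr_pdivlMr // => /andP[k2 ke] fw.
rewrite {1}fw zprod_imaginary.
have p1 := pprod_ge1 a N t.
have -> : (pprod a N t)%:C * k - (pprod a N t)%:C = (pprod a N t)%:C * (k - 1) by ring.
rewrite normcM normc_real ger0_norm ?(le_trans ler01) //.
(* From |k| >= 1/2. This turns the relative error [k - 1] into an absolute one. *)
have : pprod a N t <= 2 * normc (f w).
  rewrite fw zprod_imaginary normcM normc_real ger0_norm ?(le_trans ler01) //.
  have : 1 / 2 <= normc k by have := le_normc_subr k 1; rewrite normc1; lra.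
  move=> k12; rewrite mulrCA ler_peMr ?(le_trans ler01) //; lra.
move=> pf; apply: le_lt_trans ke; rewrite mulrC ler_wpM2l ?normc_ge0 // /K; lra.
Qed.

End FromStatement.

(** * Exponential sums and their tails *)

Section ExpSums.
Variable R : realType.
Implicit Types (s : seq (R * R)) (x y c l A M t : R).

(** A pair [(c, l)] stands for c exp(- l x). Tails are kept as formal lists, so that
    differentiation, the differential equation and the sine transform act term by term. *)
Definition es s x := \sum_(p <- s) p.1 * expR (- p.2 * x).
Definition des s := [seq (- p.2 * p.1, p.2) | p <- s].
Definition scale_es c s : seq (R * R) := [seq (c * p.1, p.2) | p <- s].
Definition shift_es A s : seq (R * R) := [seq (p.1, p.2 + A) | p <- s].
Definition rates_in (P : R -> Prop) s := forall p, p \in s -> P p.2.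

Lemma es_cat s s' x : es (s ++ s') x = es s x + es s' x.
Proof. by rewrite /es big_cat. Qed.

Lemma es_scale c s x : es (scale_es c s) x = c * es s x.
Proof. by rewrite /es big_map mulr_sumr; apply: eq_bigr => p _; rewrite mulrA. Qed.

Lemma es_shift A s x : es (shift_es A s) x = expR (- A * x) * es s x.
Proof.
rewrite /es big_map mulr_sumr; apply: eq_bigr => p _ /=.
by rewrite opprD mulrDl expRD; ring.
Qed.

Lemma des_cat s s' : des (s ++ s') = des s ++ des s'.
Proof. by rewrite /des map_cat. Qed.

Lemma des_scale c s : des (scale_es c s) = scale_es c (des s).
Proof. by rewrite /des /scale_es -!map_comp; apply: eq_map => p /=; congr (_, _); ring. Qed.

Lemma es_des_shift A s x :
  es (des (shift_es A s)) x = expR (- A * x) * (es (des s) x - A * es s x).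
Proof.
rewrite /es !big_map mulr_sumr -sumrB mulr_sumr; apply: eq_bigr => p _ /=.
by rewrite opprD [(_ + _) * x]mulrDl expRD; ring.
Qed.

Lemma is_derive_es s x : is_derive x (1 : R) (es s) (es (des s) x).
Proof.
elim: s => [|p s IH].
  have -> : es [::] = cst 0 by apply/funext => y; rewrite /es big_nil.
  exact: is_derive_cst.
have -> : es (p :: s) = (fun y => p.1 * expR (- p.2 * y)) \+ es s.
  by apply/funext => y; rewrite /es big_cons.
have -> : es (des (p :: s)) x = p.1 * (expR (- p.2 * x) * - p.2) + es (des s) x.
  by rewrite /es /= big_cons /=; congr (_ + _); ring.
apply: is_deriveD; apply: is_deriveZ.
apply: (is_derive1_comp (f := expR) (g := fun y => - p.2 * y)).
by apply: is_derive_eq; rewrite /GRing.scale /= mulr1.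
Qed.

Lemma mvt_between (f f' : R -> R) x y : x <= y -> (forall u, is_derive u (1 : R) f (f' u)) ->
  exists2 c, x <= c <= y & f y - f x = f' c * (y - x).
Proof.
move=> xy df; have [|c] := MVT_segment xy (fun u _ => df u).
  by apply: continuous_subspaceT => u; exact: is_derive_continuous (df u).
by rewrite in_itv/= => cxy E; exists c.
Qed.

Lemma es_nonincreasing s x y : (forall u, 0 <= u -> es (des s) u <= 0) ->
  0 <= x -> x <= y -> es s y <= es s x.
Proof.
move=> H x0 xy; have [c /andP[xc _] E] := mvt_between xy (is_derive_es s).
by rewrite -subr_le0 E mulr_le0_ge0 ?subr_ge0 // H // (le_trans x0).
Qed.

Lemma es_small s e : rates_in (fun l => 0 < l) s -> 0 < e ->
  exists X, forall x, X <= x -> `|es s x| < e.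
Proof.
elim: s e => [|p s IH] e Hs e0.
  by exists 0 => x _; rewrite /es big_nil normr0.
have e20 : 0 < e / 2 by rewrite divr_gt0.
have [X HX] := IH (e / 2) (fun q qs => Hs q (mem_behead (s := p :: s) qs)) e20.
have l0 : 0 < p.2 by apply: Hs; rewrite mem_head.
(* Beyond this point, 1 + l x <= exp(l x) makes the first term smaller than e/2. *)
exists (Num.max X ((1 + `|p.1|) / (e / 2) / p.2)) => x; rewrite ge_max => /andP[Xx hx].
rewrite /es big_cons (le_lt_trans (ler_normD _ _)) // [ltRHS](splitr e) ltrD ?HX //.
rewrite normrM (ger0_norm (expR_ge0 _)) mulNr expRN ltr_pdivrMr ?expR_gt0 //.
rewrite !ler_pdivrMr // in hx.
have := expR_ge1Dx (p.2 * x); rewrite -(ler_pM2l e20) mulrDr mulr1.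
rewrite [p.2 * x]mulrC; lra.
Qed.

(** A nonincreasing function that vanishes at infinity cannot become negative. *)
Lemma es_nonneg s : rates_in (fun l => 0 < l) s ->
  (forall u, 0 <= u -> es (des s) u <= 0) -> forall x, 0 <= x -> 0 <= es s x.
Proof.
move=> Hs H x x0; rewrite leNgt; apply/negP => h.
have [X HX] := es_small Hs (e := - es s x) ltac:(by rewrite oppr_gt0).
have Xx : X <= Num.max X x by rewrite le_max lexx.
have xX : x <= Num.max X x by rewrite le_max lexx orbT.
have := HX _ Xx; have := es_nonincreasing H x0 xX => h1.
rewrite ler0_norm; lra.
Qed.

(* Maximum principle: factor 1 - D^2/A^2 as (1 - D/A)(1 + D/A) and integrate
   the two first-order inequalities, the outer one backwards from infinity. *)
Lemma es_max_principle A s : 0 < A -> rates_in (fun l => 0 < l) s -> 0 <= es s 0 ->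
  (forall x, 0 <= x -> 0 <= es s x - es (des (des s)) x / A ^+ 2) ->
  forall x, 0 <= x -> 0 <= es s x.
Proof.
move=> A0 Hs s0 H.
pose V := s ++ scale_es A^-1 (des s).
have VE x : es V x = es s x + A^-1 * es (des s) x by rewrite /V es_cat es_scale.
have V0 x : 0 <= x -> 0 <= es V x.
  move=> x0; have : 0 <= es (shift_es A V) x.
    apply: es_nonneg => // [_ /mapP[p pV ->] /=|u u0].
      apply: addr_gt0 => //; move: pV; rewrite mem_cat => /orP[/Hs//|].
      by move=> /mapP[p' /mapP[p'' /Hs p0 ->] ->].
    rewrite es_des_shift VE /V des_cat des_scale es_cat es_scale.
    have -> : es (des s) u + A^-1 * es (des (des s)) u - A * (es s u + A^-1 * es (des s) u) =
      - (A * (es s u - es (des (des s)) u / A ^+ 2)) by field; rewrite gt_eqF.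
    by rewrite mulrN oppr_le0 mulr_ge0 ?expR_ge0 // mulr_ge0 ?(ltW A0) // H.
  by rewrite es_shift pmulr_rge0 // expR_gt0.
move=> x x0.
have [c /andP[c0 _]] := mvt_between x0 (is_derive_es (shift_es (- A) s)).
rewrite es_des_shift !es_shift opprK mulr0 expR0 mul1r subr0 mulNr opprK => E.
rewrite -(pmulr_rge0 _ (expR_gt0 (A * x))) -[leRHS](subrK (es s 0)) E addr_ge0 //.
rewrite mulr_ge0 // mulr_ge0 ?expR_ge0 //.
have -> : es (des s) c + A * es s c = A * es V c by rewrite VE; field; rewrite gt_eqF.
by rewrite mulr_ge0 ?V0 // ltW.
Qed.

(** The characteristic function of a symmetric X with P(|X| > x) = [es s x]: each summand is the
    integral of t sin(tx) c exp(- l x) over x >= 0. *)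
Definition chi s t := 1 - \sum_(p <- s) p.1 * (t ^+ 2 / (p.2 ^+ 2 + t ^+ 2)).

(** The coefficient c / (1 - l^2/A^2) of the particular solution of v - v''/A^2 = c exp(- l x). *)
Definition partial_coef A (p : R * R) := p.1 * (A ^+ 2 / (A ^+ 2 - p.2 ^+ 2)).

(* Tail function of |X + Y| with Y an independent Laplace variable of rate A:
   the solution of V - V''/A^2 = es s with V(0) = 1 vanishing at infinity. *)
Definition laplace_tail A s : seq (R * R) :=
  rcons [seq (partial_coef A p, p.2) | p <- s] (1 - \sum_(p <- s) partial_coef A p, A).

Section LaplaceTail.
Variables (A : R) (s : seq (R * R)).
Hypotheses (A0 : 0 < A) (Hs : rates_in (fun l => 0 < l < A) s).

Lemma rate_sqr_gt0 p : p \in s -> 0 < A ^+ 2 - p.2 ^+ 2.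
Proof. by move=> /Hs/andP[p0 pA]; rewrite subr_gt0 ltrXn2r ?nnegrE ?ltW. Qed.

Lemma laplace_tail0 : es (laplace_tail A s) 0 = 1.
Proof.
rewrite /es /laplace_tail big_rcons /= mulr0 expR0 mulr1 big_map.
rewrite (eq_bigr (fun p => partial_coef A p)) => [|p _]; first by rewrite addrC subrK.
by rewrite mulr0 expR0 mulr1.
Qed.

Lemma laplace_tail_ode x :
  es (laplace_tail A s) x - es (des (des (laplace_tail A s))) x / A ^+ 2 = es s x.
Proof.
rewrite /es /des /laplace_tail !map_rcons !big_rcons /= !big_map /=.
set c := 1 - _; have -> : forall a b : R, a + c * expR (- A * x) -
    (b + - A * (- A * c) * expR (- A * x)) / A ^+ 2 = a - b / A ^+ 2.
  by move=> a b; field; rewrite gt_eqF.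
rewrite mulr_suml -sumrB; apply: eq_big_seq => p ps; rewrite /partial_coef.
by have := rate_sqr_gt0 ps => h; field; rewrite !gt_eqF.
Qed.

(** Partial fractions in t^2. The poles of the old terms differ from that of the new one because the
    rates lie below [A]. *)
Lemma chi_laplace_tail t : chi (laplace_tail A s) t = A ^+ 2 / (A ^+ 2 + t ^+ 2) * chi s t.
Proof.
rewrite /chi /laplace_tail big_rcons /= big_map /=.
have A2 : 0 < A ^+ 2 by rewrite exprn_gt0.
have At : 0 < A ^+ 2 + t ^+ 2 by rewrite ltr_wpDr ?sqr_ge0.
have -> : \sum_(p <- s) partial_coef A p * (t ^+ 2 / (p.2 ^+ 2 + t ^+ 2)) =
   (\sum_(p <- s) partial_coef A p) * (t ^+ 2 / (A ^+ 2 + t ^+ 2)) +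
   A ^+ 2 / (A ^+ 2 + t ^+ 2) * \sum_(p <- s) p.1 * (t ^+ 2 / (p.2 ^+ 2 + t ^+ 2)).
  rewrite mulr_suml mulr_sumr -big_split /=; apply: eq_big_seq => p ps.
  have h := rate_sqr_gt0 ps; have /andP[p0 _] := Hs ps.
  have pt : 0 < p.2 ^+ 2 + t ^+ 2 by rewrite ltr_wpDr ?sqr_ge0 // exprn_gt0.
  by rewrite /partial_coef; field; rewrite !gt_eqF.
by field; rewrite gt_eqF.
Qed.

Lemma laplace_tail_rates : rates_in (fun l => 0 < l) (laplace_tail A s).
Proof.
move=> p; rewrite mem_rcons inE => /orP[/eqP-> //|/mapP[q /Hs/andP[q0 _] ->]//].
Qed.

Hypothesis s0 : es s 0 <= 1.
Hypothesis s2 : forall x, 0 <= x -> 0 <= es (des (des s)) x.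

(** The operator 1 - D^2/A^2 sends the difference of the two sides to s''/A^2, which is nonnegative
    by convexity, and the difference is nonnegative at 0. *)
Lemma le_laplace_tail x : 0 <= x -> es s x <= es (laplace_tail A s) x.
Proof.
have E y : es (laplace_tail A s ++ scale_es (-1) s) y = es (laplace_tail A s) y - es s y.
  by rewrite es_cat es_scale mulN1r.
move=> x0; rewrite -subr_ge0 -E; apply: (es_max_principle A0) => //.
- move=> p; rewrite mem_cat => /orP[/laplace_tail_rates//|/mapP[q /Hs/andP[q0 _] ->]//].
- by rewrite E laplace_tail0 subr_ge0.
- move=> y y0; rewrite E !des_cat !des_scale es_cat es_scale.
  have -> : es (laplace_tail A s) y - es s y - (es (des (des (laplace_tail A s))) y +
     -1 * es (des (des s)) y) / A ^+ 2 = es (laplace_tail A s) y -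
     es (des (des (laplace_tail A s))) y / A ^+ 2 - es s y + es (des (des s)) y / A ^+ 2.
    by field; rewrite gt_eqF.
  by rewrite laplace_tail_ode subrr add0r divr_ge0 ?sqr_ge0 // s2.
Qed.

(** The right-hand side is a barrier: 1 - D^2/A^2 sends it to [M * expR (- l * x)], which dominates
    [es s], and its value at 0 is at least 1. *)
Lemma laplace_tail_le M l : 1 <= M -> 0 < l < A ->
  (forall x, 0 <= x -> es s x <= M * expR (- l * x)) ->
  forall x, 0 <= x -> es (laplace_tail A s) x <= M * (A ^+ 2 / (A ^+ 2 - l ^+ 2)) * expR (- l * x).
Proof.
move=> M1 /andP[l0 lA] sM x x0; pose c := M * (A ^+ 2 / (A ^+ 2 - l ^+ 2)).
have Al : 0 < A ^+ 2 - l ^+ 2 by rewrite subr_gt0 ltrXn2r ?nnegrE ?ltW.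
have E y : es ((c, l) :: scale_es (-1) (laplace_tail A s)) y =
    c * expR (- l * y) - es (laplace_tail A s) y.
  by rewrite {1}/es big_cons -/(es (scale_es _ _) y) es_scale mulN1r.
rewrite -subr_ge0 -E; apply: (es_max_principle A0) => //.
- move=> p; rewrite inE => /orP[/eqP-> //|/mapP[q /laplace_tail_rates q0 ->]//].
- rewrite E laplace_tail0 mulr0 expR0 mulr1 subr_ge0 /c.
  rewrite mulr_ege1 // ler_pdivlMr // mul1r; have := sqr_ge0 l; lra.
- move=> y y0; rewrite E /= !des_scale.
  have -> : es ((- l * (- l * c), l) :: scale_es (-1) (des (des (laplace_tail A s)))) y =
      l ^+ 2 * c * expR (- l * y) - es (des (des (laplace_tail A s))) y.
    by rewrite {1}/es big_cons -/(es (scale_es _ _) y) es_scale mulN1r /=; ring.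
  have -> : c * expR (- l * y) - es (laplace_tail A s) y -
      (l ^+ 2 * c * expR (- l * y) - es (des (des (laplace_tail A s))) y) / A ^+ 2 =
      M * expR (- l * y) - (es (laplace_tail A s) y - es (des (des (laplace_tail A s))) y / A ^+ 2).
    by rewrite /c; field; rewrite !gt_eqF.
  by rewrite laplace_tail_ode subr_ge0 sM.
Qed.

End LaplaceTail.
End ExpSums.

(** * Tails of the finite products *)

Section Tails.
Variable R : realType.
Implicit Types (x y t : R).
Variables (a b : nat -> R).
Hypotheses (a_gt0 : forall n, 0 < a n) (a_incr : forall n, a n < a n.+1)
  (lt_ab : forall n, a n < b n).

Lemma a0_le N : a 0%N <= a N.
Proof. by elim: N => // n /le_trans; apply; exact: ltW. Qed.

(** The list for P(|X_N| > x). To X_n nothing is added with probability (a_n / b_n)^2, and otherwise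
    an independent Laplace variable of rate a_n; the empty list is the tail of X_0 = 0. *)
Fixpoint tails N : seq (R * R) :=
  if N is n.+1 then
    scale_es ((a n / b n) ^+ 2) (tails n) ++
    scale_es (1 - (a n / b n) ^+ 2) (laplace_tail (a n) (tails n))
  else [::].

Definition tail N x := es (tails N) x.

Lemma tailS N x : tail N.+1 x = (a N / b N) ^+ 2 * tail N x +
  (1 - (a N / b N) ^+ 2) * es (laplace_tail (a N) (tails N)) x.
Proof. by rewrite /tail /= es_cat !es_scale. Qed.

Lemma ratio_bounds N : 0 <= (a N / b N) ^+ 2 <= 1.
Proof.
rewrite sqr_ge0 expr_le1 //=; last by rewrite divr_ge0 // ltW // (lt_trans (a_gt0 N)).
by rewrite ler_pdivrMr ?mul1r ?ltW // (lt_trans (a_gt0 N)).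
Qed.

(** Strict increase of [a] keeps the rate of each new Laplace variable above the rates already
    present, so that [partial_coef] has a positive denominator. *)
Lemma tails_rates N : rates_in (fun l => 0 < l < a N) (tails N).
Proof.
elim: N => [//|N IH] p /=; rewrite mem_cat => /orP[] /mapP[p' + ->] /=.
  by move=> /IH/andP[-> /lt_trans]; apply.
rewrite mem_rcons inE => /orP[/eqP-> /=|/mapP[q /IH/andP[q0 qa] ->] /=].
  by rewrite a_gt0 a_incr.
by rewrite q0 (lt_trans qa).
Qed.

Let l := a 0%N / 2.

Lemma decay_rate_lt N : 0 < l < a N.
Proof.
by rewrite /l divr_gt0 //=; have := a0_le N; have := a_gt0 0; lra.
Qed.

(** The claims are proved together: the value at 0 and convexity yield the comparison
    [le_laplace_tail], which in turn yields convexity at the next stage. The constant of the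
    exponential bound grows by one factor of [pprod] per stage. *)
Lemma tail_spec N : [/\ tail N 0 <= 1, forall x, 0 <= x -> 0 <= es (des (des (tails N))) x &
  forall x, 0 <= x -> tail N x <= pprod a N (a 0%N) * expR (- l * x)].
Proof.
elim: N => [|N [I0 I2 IM]].
  split=> [|x _|x _]; rewrite /tail /es ?big_nil //.
  by rewrite mulr_ge0 ?expR_ge0 // (le_trans ler01) // pprod_ge1.
have /andP[p0 p1] := ratio_bounds N.
have aN := a_gt0 N; have rN := @tails_rates N.
split.
- by rewrite tailS laplace_tail0 //; have := ler_wpM2l p0 I0; lra.
- move=> x x0; rewrite /= !des_cat !des_scale es_cat !es_scale.
  rewrite addr_ge0 //; first by rewrite mulr_ge0 // I2.
  rewrite mulr_ge0 ?subr_ge0 //.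
  have := laplace_tail_ode aN rN x; have := le_laplace_tail aN rN I0 I2 x0.
  set v := es (laplace_tail _ _) _; set v2 := es (des _) _ => h e.
  (* Convexity is inherited: by the differential equation, v'' >= 0 is the comparison [h]. *)
  have -> : v2 = a N ^+ 2 * (v - es (tails N) x) by rewrite -e; field; rewrite gt_eqF.
  by rewrite mulr_ge0 ?sqr_ge0 // subr_ge0.
- move=> x x0; have M1 := pprod_ge1 a N (a 0%N).
  have := laplace_tail_le aN rN M1 (decay_rate_lt N) IM x0.
  have := IM x x0; rewrite tailS /pprod big_ord_recr /= -/(pprod a N (a 0%N)).
  set M := pprod a N _ in M1 *; set e := expR _ => h1 h2.
  have e0 : 0 < e := expR_gt0 _.
  have /andP[l0 lN] := decay_rate_lt N.
  have lE : l ^+ 2 = a 0%N ^+ 2 / 4 by rewrite /l; field.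
  have aa : a 0%N ^+ 2 <= a N ^+ 2.
    by rewrite lerXn2r ?a0_le ?nnegrE ?(ltW (a_gt0 _)).
  have a2 : 0 < a N ^+ 2 by rewrite exprn_gt0.
  (* With rho = a_0^2 / a_N^2 <= 1 and l = a_0 / 2 this reads 1 / (1 - rho/4) <= 1 + rho. *)
  have k : a N ^+ 2 / (a N ^+ 2 - l ^+ 2) <= 1 + a 0%N ^+ 2 / a N ^+ 2.
    rewrite ler_pdivrMr; last by rewrite lE; lra.
    rewrite lE; have -> : (1 + a 0%N ^+ 2 / a N ^+ 2) * (a N ^+ 2 - a 0%N ^+ 2 / 4) =
      a N ^+ 2 + a 0%N ^+ 2 * (3 / 4 - a 0%N ^+ 2 / a N ^+ 2 / 4) by field; rewrite gt_eqF.
    rewrite lerDl mulr_ge0 ?sqr_ge0 //.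
    have : a 0%N ^+ 2 / a N ^+ 2 <= 1 by rewrite ler_pdivrMr // mul1r.
    lra.
  have h3 : M * (a N ^+ 2 / (a N ^+ 2 - l ^+ 2)) * e <= M * (1 + a 0%N ^+ 2 / a N ^+ 2) * e.
    by rewrite ler_pM2r // ler_pM2l //; lra.
  have h4 : M * e <= M * (1 + a 0%N ^+ 2 / a N ^+ 2) * e.
    rewrite ler_pM2r // ler_peMr ?lerDl ?divr_ge0 ?sqr_ge0 //; lra.
  have := ler_wpM2l p0 (le_trans h1 h4).
  have q0 : 0 <= 1 - (a N / b N) ^+ 2 by rewrite subr_ge0.
  have := ler_wpM2l q0 (le_trans h2 h3); lra.
Qed.

Lemma tail_nondecreasing N x : 0 <= x -> tail N x <= tail N.+1 x.
Proof.
move=> x0; have [I0 I2 _] := tail_spec N; have /andP[p0 p1] := ratio_bounds N.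
have h := le_laplace_tail (a_gt0 N) (@tails_rates N) I0 I2 x0.
rewrite tailS; have q0 : 0 <= 1 - (a N / b N) ^+ 2 by rewrite subr_ge0.
have := ler_wpM2l q0 h; rewrite -/(tail N x); lra.
Qed.

Lemma tails_pos N : rates_in (fun r => 0 < r) (tails N).
Proof. by move=> p /tails_rates/andP[]. Qed.

(** By convexity the negated derivative is nonincreasing; it vanishes at infinity, hence is
    nonnegative. *)
Lemma des_tail_le0 N x : 0 <= x -> es (des (tails N)) x <= 0.
Proof.
move=> x0; have [_ I2 _] := tail_spec N.
have : 0 <= es (scale_es (-1) (des (tails N))) x.
  apply: es_nonneg => // [p /mapP[p' /mapP[q /tails_pos q0 ->] ->] //|u u0].
  by rewrite des_scale es_scale mulN1r oppr_le0 I2.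
by rewrite es_scale mulN1r oppr_ge0.
Qed.

Lemma tail_nonincreasing N x y : 0 <= x -> x <= y -> tail N y <= tail N x.
Proof. by apply: es_nonincreasing; exact: des_tail_le0. Qed.

Lemma tail_ge0 N x : 0 <= x -> 0 <= tail N x.
Proof. by apply: es_nonneg; [exact: tails_pos|exact: des_tail_le0]. Qed.

Lemma tail_le1 N x : 0 <= x -> tail N x <= 1.
Proof.
by move=> x0; have [I0 _ _] := tail_spec N; apply: le_trans I0; exact: tail_nonincreasing.
Qed.

(** One stage multiplies [chi] by p + (1 - p) a^2 / (a^2 + t^2) with p = (a/b)^2, which is (1 +
    t^2/b^2) / (1 + t^2/a^2). *)
Lemma chi_tails N t : chi (tails N) t = pprod b N t / pprod a N t.
Proof.
elim: N => [|N IH]; first by rewrite /chi /pprod !big_nil !big_ord0 subr0 divr1.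
have aN := a_gt0 N; have bN := lt_trans aN (lt_ab N).
have := chi_laplace_tail aN (@tails_rates N) t.
rewrite IH => E.
have chi_cat c s s' : chi (scale_es c s ++ scale_es (1 - c) s') t = c * chi s t + (1 - c) * chi s' t.
  rewrite /chi big_cat /= !big_map /=.
  have H d r : \sum_(i <- r) d * i.1 * (t ^+ 2 / (i.2 ^+ 2 + t ^+ 2)) =
      d * \sum_(i <- r) i.1 * (t ^+ 2 / (i.2 ^+ 2 + t ^+ 2)) :> R.
    by rewrite mulr_sumr; apply: eq_bigr => i _; rewrite -mulrA.
  by rewrite !H; ring.
rewrite /= chi_cat IH E /pprod !big_ord_recr /= -!/(pprod _ N t).
have pa : 0 < pprod a N t by rewrite (lt_le_trans ltr01) // pprod_ge1.
have At : 0 < a N ^+ 2 + t ^+ 2 by rewrite ltr_wpDr ?sqr_ge0 // exprn_gt0.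
by field; rewrite !gt_eqF.
Qed.

End Tails.

(** * The limit law *)

Section SineTransform.
Variable R : realType.
Local Notation mu := (@lebesgue_measure R).
Implicit Types (x y c l t : R) (s : seq (R * R)).

Lemma ge0_FTC_0y (f F : R -> R) : (forall x, 0 <= x -> 0 <= f x) ->
  (forall x, {for x, continuous f}) -> (forall x, is_derive x (1 : R) F (f x)) ->
  (forall e : R, 0 < e -> exists X, forall x, X <= x -> `|F x| < e) ->
  (\int[mu]_(x in `[0%R, +oo[) (f x)%:E = (- F 0)%:E)%E.
Proof.
move=> f0 cf dF F0; rewrite (@ge0_continuous_FTC2y _ f F 0 0) //.
- by rewrite sub0e.
- by apply: continuous_subspaceT; exact: cf.
- apply/cvgrPdist_lt => e e0; have [X HX] := F0 e e0.
  exists X; split; first exact: num_real.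
  by move=> x /ltW Xx /=; rewrite sub0r normrN; exact: HX.
- exact/cvg_at_right_filter/(is_derive_continuous (dF 0)).
- by move=> x _; rewrite derive1E; have [_ ->] := dF x.
Qed.

Lemma is_derive_expN l x : is_derive x (1 : R) (fun y => expR (- l * y)) (- l * expR (- l * x)).
Proof.
have := is_derive_es [:: (1, l)] x; have -> : es [:: (1, l)] = fun y => expR (- l * y).
  by apply/funext => y; rewrite /es big_seq1 mul1r.
by rewrite /es /= big_seq1 /= mulr1.
Qed.

Lemma continuous_expN l x : {for x, continuous (fun y => expR (- l * y))}.
Proof. exact: is_derive_continuous (is_derive_expN l x). Qed.

Lemma integral_expN l : 0 < l ->
  (\int[mu]_(x in `[0%R, +oo[) (expR (- l * x))%:E = (l^-1)%:E)%E.
Proof.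
move=> l0.
have dF x : is_derive x (1 : R) (fun x => - l^-1 * expR (- l * x)) (expR (- l * x)).
  have := @is_deriveZ _ _ _ (fun y => expR (- l * y)) (- l^-1) x 1 _ (is_derive_expN l x).
  move=> H; apply: is_derive_eq H _; rewrite /GRing.scale /= mulrA mulrNN mulVf ?mul1r // gt_eqF //.
rewrite (ge0_FTC_0y _ (@continuous_expN l) dF).
- by rewrite mulr0 expR0 mulr1 opprK.
- by move=> x _; exact: expR_ge0.
- move=> e e0; have [|X HX] := @es_small _ [:: (- l^-1, l)] e _ e0.
    by move=> p; rewrite inE => /eqP->.
  by exists X => x /HX; rewrite /es big_seq1.
Qed.

Lemma integrable_expN l : 0 < l -> mu.-integrable `[0, +oo[ (EFin \o (fun x => expR (- l * x))).
Proof.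
move=> l0; apply/integrableP; split.
  apply/measurable_EFinP; apply: measurable_funTS; apply: continuous_measurable_fun => x.
  exact: continuous_expN.
under eq_integral => x _ do rewrite /= ger0_norm ?expR_ge0 //.
by rewrite integral_expN // ltry.
Qed.

Lemma is_derive_sinM t x : is_derive x (1 : R) (fun y => sin (t * y)) (t * cos (t * x)).
Proof.
have d : is_derive x (1 : R) (fun y => t * y) t.
  by apply: is_derive_eq; rewrite /GRing.scale /= mulr1.
by have := is_derive1_comp (is_derive_sin (t * x)) d; rewrite mulrC.
Qed.

Lemma is_derive_cosM t x : is_derive x (1 : R) (fun y => cos (t * y)) (- t * sin (t * x)).
Proof.
have d : is_derive x (1 : R) (fun y => t * y) t.
  by apply: is_derive_eq; rewrite /GRing.scale /= mulr1.
by have := is_derive1_comp (is_derive_cos (t * x)) d; rewrite mulNr [sin _ * _]mulrC mulNr.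
Qed.

Lemma continuous_sinM t x : {for x, continuous (fun y => sin (t * y))}.
Proof. exact: is_derive_continuous (is_derive_sinM t x). Qed.

Lemma measurable_sinM t (D : set R) : measurable_fun D (fun y => sin (t * y)).
Proof.
by apply: measurable_funTS; apply: continuous_measurable_fun => x; exact: continuous_sinM.
Qed.

(** The added 1 makes the integrand nonnegative, as [ge0_FTC_0y] requires; [Rintegral_sin_expN]
    subtracts it again. *)
Lemma integral_sin1_expN l t : 0 < l ->
  (\int[mu]_(x in `[0%R, +oo[) ((1 + sin (t * x)) * expR (- l * x))%:E =
    (l^-1 + t / (l ^+ 2 + t ^+ 2))%:E)%E.
Proof.
move=> l0; have lt0 : 0 < l ^+ 2 + t ^+ 2 by rewrite ltr_wpDr ?sqr_ge0 // exprn_gt0.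
pose G x := - l^-1 - (l * sin (t * x) + t * cos (t * x)) / (l ^+ 2 + t ^+ 2).
have cf x : {for x, continuous (fun x => (1 + sin (t * x)) * expR (- l * x))}.
  apply: continuousM; last exact: continuous_expN.
  by apply: continuousD; [exact: cst_continuous|exact: continuous_sinM].
have dF x : is_derive x (1 : R) (fun x => G x * expR (- l * x))
    ((1 + sin (t * x)) * expR (- l * x)).
  have dS := is_derive_sinM t x; have dC := is_derive_cosM t x; have dE := is_derive_expN l x.
  pose k := - l / (l ^+ 2 + t ^+ 2); pose k' := - t / (l ^+ 2 + t ^+ 2).
  have d1 := @is_deriveZ _ _ _ (fun y => sin (t * y)) k x 1 _ dS.
  have d2 := @is_deriveZ _ _ _ (fun y => cos (t * y)) k' x 1 _ dC.
  have d3 := is_deriveD (is_derive_cst (- l^-1) x 1) (is_deriveD d1 d2).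
  have d4 := is_deriveM d3 dE.
  have <- : ((cst (- l^-1) : R -> R) + (k \*: (fun x => sin (t * x)) +
     k' \*: (fun x => cos (t * x)))) * (fun x => expR (- l * x)) = (fun x => G x * expR (- l * x)).
    apply/funext => y.
    have E : (- l^-1 + (k * sin (t * y) + k' * cos (t * y))) * expR (- l * y) = G y * expR (- l * y).
      by rewrite /G /k /k'; congr (_ * _); field; rewrite gt_eqF // gt_eqF.
    exact: E.
  apply: is_derive_eq d4 _.
  have E : (- l^-1 + (k * sin (t * x) + k' * cos (t * x))) * (- l * expR (- l * x)) +
      expR (- l * x) * (0 + (k * (t * cos (t * x)) + k' * (- t * sin (t * x)))) =
      (1 + sin (t * x)) * expR (- l * x).
    by rewrite /k /k'; field; rewrite gt_eqF // gt_eqF.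
  exact: E.
rewrite (ge0_FTC_0y _ cf dF).
- rewrite /G !mulr0 sin0 cos0 !mulr0 expR0 !mulr1; congr EFin; field.
  by rewrite !gt_eqF.
- by move=> x _; rewrite mulr_ge0 ?expR_ge0 //; have := sin_geN1 (t * x); lra.
- move=> e e0; pose c := l^-1 + (l + `|t|) / (l ^+ 2 + t ^+ 2).
  have [|X HX] := @es_small _ [:: (c, l)] e _ e0.
    by move=> p; rewrite inE => /eqP->.
  exists X => x /HX; rewrite /es big_seq1 /= => h; apply: le_lt_trans h.
  rewrite !normrM ler_wpM2r //.
  have c0 : 0 <= c.
    apply: addr_ge0; first by rewrite invr_ge0 ltW.
    by apply: divr_ge0; [rewrite addr_ge0 // ltW|exact: ltW].
  rewrite (ger0_norm c0) /G /c; apply: le_trans (ler_normB _ _) _.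
  rewrite normrN (@ger0_norm _ l^-1) ?invr_ge0 ?(ltW l0) // lerD2l normrM.
  rewrite (@ger0_norm _ (_ ^-1)) ?invr_ge0 ?(ltW lt0) // ler_pM2r ?invr_gt0 //.
  apply: le_trans (ler_normD _ _) _; rewrite !normrM (gtr0_norm l0).
  by rewrite lerD // ler_piMr ?(ltW l0) ?sin_max ?cos_max.
Qed.

Lemma integrable_bounded_expN (g : R -> R) (B l : R) : 0 < l ->
  measurable_fun (`[0%R, +oo[ : set R) g -> (forall x, 0 <= x -> `|g x| <= B) ->
  mu.-integrable `[0, +oo[ (EFin \o (fun x => g x * expR (- l * x))).
Proof.
move=> l0 mg gB.
have iB : mu.-integrable `[0, +oo[ (fun x => B%:E * (expR (- l * x))%:E)%E.
  exact: (integrableZl _ B (integrable_expN l0)).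
apply: le_integrable iB => //.
  apply/measurable_EFinP; apply: measurable_funM => //.
  apply: measurable_funTS; apply: continuous_measurable_fun => x; exact: continuous_expN.
move=> x /=; rewrite in_itv/= andbT => x0; rewrite lee_fin !normrM ler_wpM2r //.
by apply: le_trans (gB x x0) _; exact: ler_norm.
Qed.

Lemma Rintegral_sin_expN l t : 0 < l ->
  \int[mu]_(x in `[0%R, +oo[) (sin (t * x) * expR (- l * x)) = t / (l ^+ 2 + t ^+ 2).
Proof.
move=> l0; have i1 := @integrable_bounded_expN (fun x => 1 + sin (t * x)) 2 l l0.
have -> : \int[mu]_(x in `[0%R, +oo[) (sin (t * x) * expR (- l * x)) =
  \int[mu]_(x in `[0%R, +oo[) ((1 + sin (t * x)) * expR (- l * x)) -
  \int[mu]_(x in `[0%R, +oo[) expR (- l * x).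
  rewrite -RintegralB //.
  - by apply: eq_Rintegral => x _; ring.
  - apply: i1.
      by apply: measurable_funD => //; exact: measurable_sinM.
    by move=> x _; have := sin_geN1 (t * x); have := sin_le1 (t * x); rewrite ler_norml => *; apply/andP; split; lra.
  - exact: integrable_expN.
by rewrite /Rintegral integral_sin1_expN // integral_expN //= addrAC subrr add0r.
Qed.

Lemma integrable_sin_es s t : rates_in (fun l => 0 < l) s ->
  mu.-integrable `[0, +oo[ (EFin \o (fun x => t * sin (t * x) * es s x)).
Proof.
elim: s => [_|p s IH Hs].
  have -> : EFin \o (fun x => t * sin (t * x) * es [::] x) = cst 0%E.
    by apply/funext => x; rewrite /= /es big_nil mulr0.
  exact: integrable0.
have p0 : 0 < p.2 by apply: Hs; rewrite mem_head.
have {}IH := IH (fun q qs => Hs q (mem_behead (s := p :: s) qs)).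
have -> : EFin \o (fun x => t * sin (t * x) * es (p :: s) x) =
    ((EFin \o (fun x => (t * sin (t * x) * p.1) * expR (- p.2 * x))%R) \+
     (EFin \o (fun x => t * sin (t * x) * es s x)%R))%E.
  by apply/funext => x; rewrite /= -EFinD /es big_cons; congr EFin; ring.
apply: integrableD => //; apply: (@integrable_bounded_expN _ (`|t| * `|p.1|)) => //.
  by apply: measurable_funM => //; apply: measurable_funM => //; exact: measurable_sinM.
by move=> x _; rewrite !normrM ler_wpM2r // ler_piMr // sin_max.
Qed.

Lemma Rintegral_sin_es s t : rates_in (fun l => 0 < l) s ->
  \int[mu]_(x in `[0%R, +oo[) (t * sin (t * x) * es s x) = 1 - chi s t.
Proof.
rewrite /chi opprB addrC subrK.
elim: s => [_|p s IH Hs].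
  rewrite big_nil -[RHS](mul0r (fine (mu `[0%R, +oo[))) -Rintegral_cst //.
  by apply: eq_Rintegral => x _; rewrite /es big_nil mulr0.
have p0 : 0 < p.2 by apply: Hs; rewrite mem_head.
have Hs' q (qs : q \in s) : 0 < q.2 := Hs q (mem_behead (s := p :: s) qs).
have i0 : mu.-integrable `[0, +oo[ (EFin \o (fun x => sin (t * x) * expR (- p.2 * x))).
  apply: (@integrable_bounded_expN _ 1) => //; first exact: measurable_sinM.
  by move=> x _; exact: sin_max.
rewrite big_cons -IH //.
have -> : p.1 * (t ^+ 2 / (p.2 ^+ 2 + t ^+ 2)) =
    (t * p.1) * \int[mu]_(x in `[0%R, +oo[) (sin (t * x) * expR (- p.2 * x)).
  by rewrite Rintegral_sin_expN //; ring.
rewrite -RintegralZl // -RintegralD //.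
- by apply: eq_Rintegral => x _; rewrite /es big_cons; ring.
- exact: (integrableZl _ (t * p.1) i0).
- exact: integrable_sin_es.
Qed.

End SineTransform.

(** * Monotone limit of the tails and its quantile function *)

Section LimitTail.
Variable R : realType.
Local Notation mu := (@lebesgue_measure R).
Implicit Types (x y u t : R).
Variables (T : nat -> R -> R) (M l : R).
Hypotheses (l0 : 0 < l)
  (T_cont : forall n x, {for x, continuous (T n)})
  (T_ge0 : forall n x, 0 <= x -> 0 <= T n x)
  (T_le1 : forall n x, 0 <= x -> T n x <= 1)
  (T_le : forall n x, 0 <= x -> T n x <= M * expR (- l * x))
  (T_S : forall n x, 0 <= x -> T n x <= T n.+1 x)
  (T_ni : forall n x y, 0 <= x -> x <= y -> T n y <= T n x).

Definition sup_tail x := sup (range (T ^~ x)).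
(** The value 0 on the negative half-line keeps the hypograph in [LawOfQuantile] within x >= 0. *)
Definition lim_tail x := if 0 <= x then sup_tail x else 0.

Lemma range_has_ubound x : 0 <= x -> has_ubound (range (T ^~ x)).
Proof. by move=> x0; exists 1 => _ [n _ <-]; exact: T_le1. Qed.

Lemma le_lim_tail n x : 0 <= x -> T n x <= lim_tail x.
Proof. by move=> x0; rewrite /lim_tail x0; apply: ub_le_sup; [exact: range_has_ubound|exists n]. Qed.

Lemma lim_tail_le B x : 0 <= x -> (forall n, T n x <= B) -> lim_tail x <= B.
Proof.
by move=> x0 H; rewrite /lim_tail x0; apply: ge_sup; [exists (T 0%N x), 0%N|move=> _ [n _ <-]].
Qed.

Lemma lim_tail_ge0 x : 0 <= lim_tail x.
Proof.
have [x0|x0] := leP 0 x; last by rewrite /lim_tail ifN // -ltNge.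
by apply: le_trans (le_lim_tail 0 x0); exact: T_ge0.
Qed.

Lemma lim_tail_le1 x : 0 <= x -> lim_tail x <= 1.
Proof. by move=> x0; apply: lim_tail_le => // n; exact: T_le1. Qed.

Lemma lim_tail_le_exp x : 0 <= x -> lim_tail x <= M * expR (- l * x).
Proof. by move=> x0; apply: lim_tail_le => // n; exact: T_le. Qed.

Lemma lim_tail_ni x y : 0 <= x -> x <= y -> lim_tail y <= lim_tail x.
Proof.
move=> x0 xy; apply: lim_tail_le => [|n]; first exact: le_trans xy.
by apply: le_trans (le_lim_tail n x0); exact: T_ni.
Qed.

Lemma cvg_lim_tail x : 0 <= x -> T ^~ x @ \oo --> lim_tail x.
Proof.
move=> x0; rewrite /lim_tail x0; apply: nondecreasing_cvgn; last exact: range_has_ubound.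
by apply: homo_leq => [|y z w|n]; [exact: lexx|exact: le_trans|exact: T_S].
Qed.

Lemma lim_tail_gt u x : 0 <= x -> u < lim_tail x -> exists n, u < T n x.
Proof.
move=> x0; rewrite /lim_tail x0 => /sup_gt[|_ [n _ <-] h]; last by exists n.
by exists (T 0%N x), 0%N.
Qed.

Lemma measurable_lim_tail (D : set R) : measurable_fun D lim_tail.
Proof.
apply: measurable_funTS.
(* [lim_tail] is monotone only on x >= 0; precomposed with the maximum with 0 it is monotone on the
   whole line. *)
have -> : lim_tail = fun x => if 0 <= x then lim_tail (Num.max 0 x) else 0.
  by apply/funext => x; case: ifPn => [x0|x0]; [rewrite max_r|rewrite /lim_tail ifN].
apply: measurable_fun_ifT => //; first exact: measurable_fun_ler.
apply: nonincreasing_measurable => // x y xy; apply: lim_tail_ni.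
  by rewrite le_max lexx.
by rewrite ge_max !le_max lexx xy orbT.
Qed.

(** The generalised inverse of the tail: for U uniform on the unit interval, [quantile U] has tail
    [lim_tail]. For large [u] the set is empty and [sup] takes its default value 0, which is the
    right one. *)
Definition quantile u := if 0 < u then sup [set x | 0 <= x /\ u < lim_tail x] else 0.

Lemma quantile_has_ubound u : 0 < u -> has_ubound [set x | 0 <= x /\ u < lim_tail x].
Proof.
move=> u0; exists (`|M| / u / l) => x [x0 ux]; rewrite !ler_pdivlMr //.
have := expR_ge1Dx (l * x) => h1.
have := lt_le_trans ux (lim_tail_le_exp x0).
rewrite mulNr expRN ltr_pdivlMr ?expR_gt0 // => h2.
have : u * (1 + l * x) <= u * expR (l * x) by rewrite ler_pM2l.
have := ler_norm M; have -> : x * l * u = u * (l * x) by ring.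
lra.
Qed.

Lemma quantile_ge0 u : 0 <= quantile u.
Proof.
rewrite /quantile; case: ifPn => // u0.
have [[x [x0 ux]]|H] := pselect ([set x | 0 <= x /\ u < lim_tail x] !=set0).
  exact: (le_trans x0 (ub_le_sup (quantile_has_ubound u0) (conj x0 ux))).
by rewrite sup_out // => -[].
Qed.

(* [lim_tail] is right-continuous, being a supremum of continuous nonincreasing
   functions; hence the equivalence holds at every [x]. *)
Lemma lt_quantile u x : 0 < u -> 0 <= x -> (x < quantile u) = (u < lim_tail x).
Proof.
move=> u0 x0; rewrite /quantile u0; apply/idP/idP.
  have [ne|H] := pselect ([set x | 0 <= x /\ u < lim_tail x] !=set0).
    move=> /(sup_gt ne)[y [y0 uy]] xy; apply: lt_le_trans uy _; apply: lim_tail_ni => //.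
    exact: ltW.
  by rewrite sup_out => [|[]//]; rewrite ltNge x0.
move=> ux; have [n un] := lim_tail_gt x0 ux.
have : \forall y \near x, u < T n y by exact: (cvgr_gt _ (T_cont (n := n) (x := x))).
move=> /nbhs_ballP[d /= d0 Hd].
have yd : u < T n (x + d / 2).
  apply: Hd; rewrite /ball /= opprD addrA subrr add0r normrN gtr0_norm ?divr_gt0 //.
  by rewrite ltr_pdivrMr // mulr_natr mulr2n ltrDl.
have y0 : 0 <= x + d / 2 by rewrite addr_ge0 // divr_ge0 // ltW.
apply: (@lt_le_trans _ _ (x + d / 2)); first by rewrite ltrDl divr_gt0.
apply: ub_le_sup; first exact: quantile_has_ubound.
by split => //; apply: lt_le_trans yd _; exact: le_lim_tail.
Qed.

Lemma quantile_eq0 u : u <= 0 \/ 1 <= u -> quantile u = 0.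
Proof.
move=> [u0|u1]; first by rewrite /quantile ltNge u0.
apply/eqP; rewrite eq_le quantile_ge0 andbT leNgt lt_quantile //; last by rewrite (lt_le_trans ltr01).
by rewrite -leNgt (le_trans _ u1) // lim_tail_le1.
Qed.

Lemma measurable_quantile : measurable_fun setT quantile.
Proof.
apply: (measurability (@RGenOInfty.G R)) => [|/= _ [_] [x] -> <-].
  exact: RGenOInfty.measurableE.
rewrite setTI; have [x0|x0] := leP 0 x; last first.
  rewrite (_ : _ @^-1` _ = setT) //; apply/seteqP; split => // u _ /=.
  by rewrite in_itv/= andbT (lt_le_trans x0) // quantile_ge0.
rewrite (_ : _ @^-1` _ = `]0, lim_tail x[%classic) //.
apply/seteqP; split => u /=; rewrite !in_itv/= andbT.
  move=> xu; have u0 : 0 < u.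
    by rewrite ltNge; apply/negP => u0; move: xu; rewrite quantile_eq0 ?ltNge ?x0 //; left.
  by rewrite u0 -lt_quantile.
by move=> /andP[u0]; rewrite lt_quantile.
Qed.

Lemma integrable_sin_lim_tail t :
  mu.-integrable `[0, +oo[ (EFin \o (fun x => t * sin (t * x) * lim_tail x)).
Proof.
have iB : mu.-integrable `[0, +oo[ (EFin \o (fun x => (`|t| * M) * expR (- l * x))).
  exact: (integrableZl _ (`|t| * M) (integrable_expN l0)).
apply: le_integrable iB => //.
  apply/measurable_EFinP; apply: measurable_funM; last exact: measurable_lim_tail.
  by apply: measurable_funM => //; exact: measurable_sinM.
move=> x /=; rewrite in_itv/= andbT => x0; rewrite lee_fin 2!normrM.
have h := lim_tail_le_exp x0; have h0 := lim_tail_ge0 x.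
rewrite (ger0_norm h0); apply: le_trans (ler_norm _).
rewrite -[leRHS]mulrA ler_pM ?mulr_ge0 //.
by rewrite ler_piMr // sin_max.
Qed.

(** Dominated convergence with majorant |t| M exp(- l x), which is where a bound uniform in [n] is
    needed. *)
Lemma Rintegral_sin_lim_tail t (v : nat -> R) (w : R) :
  (forall n, \int[mu]_(x in `[0%R, +oo[) (t * sin (t * x) * T n x) = v n) ->
  v @ \oo --> w -> \int[mu]_(x in `[0%R, +oo[) (t * sin (t * x) * lim_tail x) = w.
Proof.
move=> vE vw.
have iB : mu.-integrable `[0, +oo[ (EFin \o (fun x => (`|t| * M) * expR (- l * x))).
  exact: (integrableZl _ (`|t| * M) (integrable_expN l0)).
pose F n x := (t * sin (t * x) * T n x)%:E.
pose G x := (t * sin (t * x) * lim_tail x)%:E.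
have mT n : measurable_fun (`[0%R, +oo[ : set R) (T n).
  by apply: measurable_funTS; apply: continuous_measurable_fun => x; exact: T_cont.
have mF n : measurable_fun (`[0%R, +oo[ : set R) (F n).
  apply/measurable_EFinP; apply: measurable_funM => //.
  by apply: measurable_funM => //; exact: measurable_sinM.
have mG : measurable_fun (`[0%R, +oo[ : set R) G.
  apply/measurable_EFinP; apply: measurable_funM; last exact: measurable_lim_tail.
  by apply: measurable_funM => //; exact: measurable_sinM.
have FB n x : 0 <= x -> (`|F n x| <= ((`|t| * M) * expR (- l * x))%:E)%E.
  move=> x0; rewrite lee_fin 2!normrM (ger0_norm (T_ge0 n x0)) -[leRHS]mulrA ler_pM ?mulr_ge0 ?T_ge0 ?T_le //.
  by rewrite ler_piMr // sin_max.
have [|||_ _ H] := @dominated_convergence _ _ _ mu _ (measurable_itv `[0, +oo[) F G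
    (fun x => ((`|t| * M) * expR (- l * x))%:E) mF mG.
- apply: aeW => x; rewrite /= in_itv/= andbT => x0.
  apply: cvg_EFin; first exact: nearW.
  by apply: cvgM; [exact: cvg_cst|exact: cvg_lim_tail].
- exact: iB.
- by apply: aeW => x n xD; apply: FB; move: xD; rewrite /= in_itv/= andbT.
have iF n : mu.-integrable `[0, +oo[ (F n).
  apply: (@le_integrable _ _ _ mu _ (measurable_itv `[0, +oo[) _
    (fun x => ((`|t| * M) * expR (- l * x))%:E) (mF n)) => // x.
  rewrite /= in_itv/= andbT => x0.
  by apply: le_trans (FB n x x0) _; rewrite lee_fin ler_norm.
have E : (fun n => \int[mu]_(x in `[0%R, +oo[) F n x)%E = (fun n => (v n)%:E).
  apply/funext => n; rewrite -vE /Rintegral fineK //.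
  by apply: integrable_fin_num => //; exact: iF.
rewrite E in H.
have vw' : (fun n => (v n)%:E) @ \oo --> w%:E by apply: cvg_EFin => //; exact: nearW.
by have := cvg_unique (@ereal_hausdorff R) H vw'; rewrite /Rintegral => ->.
Qed.

End LimitTail.

(** * Equal mixture of two laws *)

Section Mixture.
Context d (T : measurableType d) (R : realType).
Variables P1 P2 : probability T R.

Let half : {nonneg R} := (2^-1)%:nng.

Definition mixture : set T -> \bar R := measure_add (mscale half P1) (mscale half P2).

HB.instance Definition _ := Measure.on mixture.

Lemma mixture_setT : mixture setT = 1%E.
Proof.
have -> : mixture setT = ((2^-1)%:E * P1 setT + (2^-1)%:E * P2 setT)%E.
  by rewrite /mixture measure_addE.
by rewrite !probability_setT !mule1 -EFinD; congr EFin; field.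
Qed.

HB.instance Definition _ := Measure_isProbability.Build _ _ _ mixture mixture_setT.

Lemma ge0_integral_mixture (g : T -> \bar R) : measurable_fun setT g ->
  (forall x, 0 <= g x)%E ->
  (\int[mixture]_x g x = (2^-1)%:E * (\int[P1]_x g x + \int[P2]_x g x))%E.
Proof.
move=> mg g0; rewrite ge0_integral_measure_add // !ge0_integral_mscale //.
have i1 : (0 <= \int[P1]_x g x)%E by apply: integral_ge0.
have i2 : (0 <= \int[P2]_x g x)%E by apply: integral_ge0.
by rewrite -(ge0_muleDr _ i1 i2).
Qed.

End Mixture.

(** * The symmetrised law with a given tail *)

Section LawOfQuantile.
Variable R : realType.
Local Notation mu := (@lebesgue_measure R).
Implicit Types (x y u t : R).
Variables (S q : R -> R).
Hypotheses (S_ge0 : forall x, 0 <= S x) (S_neg : forall x, x < 0 -> S x = 0)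
  (mS : measurable_fun setT S)
  (iS : forall t, mu.-integrable `[0, +oo[ (EFin \o (fun x => t * sin (t * x) * S x)))
  (q_ge0 : forall u, 0 <= q u) (q_eq0 : forall u, u <= 0 \/ 1 <= u -> q u = 0)
  (mq : measurable_fun setT q)
  (lt_q : forall u x, 0 < u -> 0 <= x -> (x < q u) = (u < S x)).

(** The hypograph of the tail, with level u = [z.1] and abscissa x = [z.2]. For u > 0 the slice at
    level u is [0, q u[ by [lt_q]; the slice at abscissa x is ]0, S x[. *)
Let E : set (R * R) := [set z | 0 < z.1 /\ z.1 < S z.2].

Lemma measurable_hypograph : measurable E.
Proof.
have -> : E = (fst @^-1` `]0, +oo[) `&` ((fun z : R * R => S z.2 - z.1) @^-1` `]0, +oo[).
  by apply/seteqP; split => z /=; rewrite /E /= !in_itv/= !andbT subr_gt0.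
apply: measurableI.
  by rewrite -[X in measurable X]setTI; apply: measurable_fst.
rewrite -[X in measurable X]setTI.
have : measurable_fun setT (fun z : R * R => S z.2 - z.1).
  apply: measurable_funB; last exact: measurable_fst.
  by apply: measurableT_comp; [exact: mS|exact: measurable_snd].
by apply.
Qed.

Let f t (z : R * R) : \bar R := (t * sin (t * z.2) * \1_E z)%:E.

Lemma measurable_slice t : measurable_fun setT (f t).
Proof.
apply/measurable_EFinP; apply: measurable_funM; last exact: measurable_indic measurable_hypograph.
apply: measurable_funM => //.
apply: (@measurableT_comp _ _ _ _ _ _ (fun y : R => sin (t * y)) _ snd).
  exact: measurable_sinM.
exact: measurable_snd.
Qed.

Lemma integral_slice_u t x (c : R) :
  (\int[mu]_u (c * \1_E (u, x))%:E = (c * S x)%:E)%E.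
Proof.
transitivity (\int[mu]_(u in `]0%R, S x[) cst c%:E u)%E.
  rewrite [RHS]integral_mkcond; apply: eq_integral => u _.
  rewrite /patch indicE; case: ifPn.
    by rewrite inE /= in_itv/= => /andP[u0 uS]; rewrite mem_set ?mulr1.
  rewrite notin_setE /= in_itv/= => H; rewrite memNset ?mulr0 // => -[u0 uS].
  by apply: H; rewrite u0.
rewrite integral_cst //= EFinM; congr (_ * _)%E.
have -> : mu `]0, S x[ = (if (0 < S x)%R then (S x)%:E - 0%:E else 0)%E.
  exact: (lebesgue_measure_itv `]0, S x[).
have := S_ge0 x; rewrite le_eqVlt => /orP[/eqP<-|->]; first by rewrite ltxx.
by rewrite sube0.
Qed.

Lemma integral_slice_x t u : (\int[mu]_x f t (u, x) = (1 - cos (t * q u))%:E)%E.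
Proof.
have [u0|u0] := leP u 0.
  rewrite q_eq0; last by left.
  rewrite mulr0 cos0 subrr; apply: integral0_eq => x _.
  by rewrite /f indicE memNset ?mulr0 // => -[/=]; rewrite ltNge u0.
transitivity (\int[mu]_(x in `[0%R, q u[) (t * sin (t * x))%:E)%E.
  rewrite [RHS]integral_mkcond; apply: eq_integral => x _.
  rewrite /patch /f indicE; case: ifPn.
    rewrite inE /= in_itv/= => /andP[x0 xq]; rewrite mem_set ?mulr1 //.
    by split => //=; rewrite -lt_q.
  rewrite notin_setE /= in_itv/= => H; rewrite memNset ?mulr0 // => -[/= _ uS].
  have [x0|x0] := leP 0 x; first by apply: H; rewrite x0 lt_q.
  by move: uS; rewrite S_neg // ltNge ltW.
have cs x : {for x, continuous (fun x => t * sin (t * x))}.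
  by apply: continuousM; [exact: cst_continuous|exact: continuous_sinM].
rewrite integral_itv_bndo_bndc; last first.
  apply/measurable_EFinP; apply: measurable_funTS; exact: continuous_measurable_fun.
have := q_ge0 u; rewrite le_eqVlt => /orP[/eqP<-|q0].
  by rewrite set_itv1 integral_set1 mulr0 cos0 subrr.
have dF x : is_derive x (1 : R) (fun x => - cos (t * x)) (t * sin (t * x)).
  by have := is_deriveN (is_derive_cosM t x); rewrite mulNr opprK.
rewrite (@continuous_FTC2 _ _ (fun x => - cos (t * x))) //.
- by rewrite mulr0 cos0 -EFinB opprK addrC.
- by apply: continuous_subspaceT; exact: cs.
- exact: derivable_LR dF.
- by move=> x _; rewrite derive1E; have [_ ->] := dF x.
Qed.

Lemma integral_extend t : (\int[mu]_x (t * sin (t * x) * S x)%:E =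
  \int[mu]_(x in `[0%R, +oo[) (t * sin (t * x) * S x)%:E)%E.
Proof.
rewrite [RHS]integral_mkcond; apply: eq_integral => x _.
rewrite /patch; case: ifPn => //; rewrite notin_setE /= in_itv/= andbT => /negP.
by rewrite -ltNge => x0; rewrite S_neg // mulr0.
Qed.

Lemma integrable_slice t : (mu \x mu)%E.-integrable setT (f t).
Proof.
apply/(@integrable21ltyP _ _ _ _ R mu mu (f t) (measurable_slice t)).
have -> : (fun x => \int[mu]_u `|f t (u, x)|)%E = (fun x => (`|t * sin (t * x)| * S x)%:E).
  apply/funext => x; rewrite -(integral_slice_u t); apply: eq_integral => u _.
  rewrite /f abse_EFin normrM; congr (_ * _)%:E; by rewrite ger0_norm // indicE.
have -> : (\int[mu]_x (`|t * sin (t * x)| * S x)%:E =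
    \int[mu]_(x in `[0%R, +oo[) `|(t * sin (t * x) * S x)%:E|)%E.
  rewrite [RHS]integral_mkcond; apply: eq_integral => x _.
  rewrite /patch; case: ifPn => [_|]; first by rewrite abse_EFin [in RHS]normrM (ger0_norm (S_ge0 x)).
  rewrite notin_setE /= in_itv/= andbT => /negP.
  by rewrite -ltNge => x0; rewrite S_neg // mulr0.
by have /integrableP[] := iS t.
Qed.

(** Fubini on the hypograph: integrating t sin(tx) first over x gives 1 - cos(t q(u)), first over u
    gives t sin(tx) S(x). *)
Lemma integral_one_sub_cos t :
  (\int[mu]_u (1 - cos (t * q u))%:E = \int[mu]_(x in `[0%R, +oo[) (t * sin (t * x) * S x)%:E)%E.
Proof.
rewrite -integral_extend.
have := Fubini (integrable_slice t); under eq_integral do rewrite integral_slice_x.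
move=> ->; apply: eq_integral => x _; rewrite -(integral_slice_u t).
by apply: eq_integral => u _.
Qed.

Let U : probability (measurableTypeR R) R := uniform_prob (@ltr01 R).

Let mfun_of (h : R -> R) (mh : measurable_fun setT h) : {RV U >-> measurableTypeR R} :=
  @MeasurableFun.Pack _ _ (measurableTypeR R) (measurableTypeR R) h
    (MeasurableFun.Class (isMeasurableFun.Build _ _ (measurableTypeR R) (measurableTypeR R) h mh)).

Let X : {RV U >-> measurableTypeR R} := mfun_of mq.

Let mqN : measurable_fun setT (fun u => - q u).
Proof. exact: measurable_funN. Qed.

Let X' : {RV U >-> measurableTypeR R} := mfun_of mqN.

(** Attaching a fair sign to q(U) makes the imaginary part of the characteristic function vanish. *)
Let P : probability (measurableTypeR R) R := mixture (distribution U X) (distribution U X').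

Lemma ge0_integral_symmetrised (g : R -> R) : measurable_fun setT g -> (forall x, 0 <= g x) ->
  (\int[P]_x (g x)%:E = (2^-1)%:E * \int[U]_u (g (q u) + g (- q u))%:E)%E.
Proof.
move=> mg g0; rewrite ge0_integral_mixture; last 2 first.
- exact/measurable_EFinP.
- by move=> x; rewrite lee_fin.
congr (_ * _)%E.
have mG : measurable_fun setT (EFin \o g) by exact/measurable_EFinP.
have G0 x : (0 <= (EFin \o g) x)%E by rewrite lee_fin.
rewrite (ge0_integral_distribution X mG G0) (ge0_integral_distribution X' mG G0).
rewrite -ge0_integralD //.
- by move=> u _ /=; rewrite lee_fin.
- exact: (measurableT_comp mG mq).
- by move=> u _ /=; rewrite lee_fin.
- exact: (measurableT_comp mG mqN).
Qed.

Lemma integral_P_one_sub_cos t :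
  (\int[P]_x (1 - cos (t * x))%:E =
   \int[mu]_(x in `[0%R, +oo[) (t * sin (t * x) * S x)%:E)%E.
Proof.
have mc : measurable_fun setT (fun x => 1 - cos (t * x) : R).
  apply: measurable_funB => //; apply: continuous_measurable_fun => x.
  exact: is_derive_continuous (is_derive_cosM t x).
have c0 x : 0 <= 1 - cos (t * x) by rewrite subr_ge0 cos_le1.
rewrite ge0_integral_symmetrised // -integral_one_sub_cos.
have mcq : measurable_fun setT (fun u => (1 - cos (t * q u))%:E).
  by apply/measurable_EFinP; exact: (measurableT_comp mc mq).
transitivity (\int[U]_u (1 - cos (t * q u))%:E)%E.
  transitivity ((2^-1)%:E * (2%:E * \int[U]_u (1 - cos (t * q u))%:E))%E.
    congr (_ * _)%E; transitivity (\int[U]_u (2%:E * (1 - cos (t * q u))%:E))%E.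
      by apply: eq_integral => u _; rewrite mulrN cosN -EFinM; congr EFin; ring.
    by rewrite ge0_integralZl // => u _; rewrite lee_fin.
  by rewrite muleA -EFinM mulVf ?mul1e // pnatr_eq0.
(* [q] vanishes for u <= 0 and u >= 1, and so does 1 - cos(t q(u)); the integral over the unit
   interval is therefore that over the line. *)
rewrite integral_uniform // subr0 invr1 mul1e [LHS]integral_mkcond.
apply: eq_integral => u _; rewrite /patch; case: ifPn => //.
rewrite notin_setE /= in_itv/= => /negP; rewrite negb_and -!ltNge => /orP h.
by rewrite q_eq0 ?mulr0 ?cos0 ?subrr //; case: h => /ltW; [left|right].
Qed.

Lemma integral_P_one_sub_sin t : (\int[P]_x (1 - sin (t * x))%:E = 1)%E.
Proof.
have ms : measurable_fun setT (fun x => 1 - sin (t * x) : R).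
  by apply: measurable_funB => //; exact: measurable_sinM.
rewrite ge0_integral_symmetrised => [|//|x]; last by rewrite subr_ge0 sin_le1.
have -> : (\int[U]_u (1 - sin (t * q u) + (1 - sin (t * - q u)))%:E = \int[U]_u (cst 2%:E u))%E.
  by apply: eq_integral => u _; rewrite mulrN sinN /=; congr EFin; ring.
have U1 := probability_setT U.
by rewrite integral_cst // [X in (_ * (_ * X))%E]U1 mule1 -EFinM mulVf // pnatr_eq0.
Qed.

(** Cosine and sine enter the integrals above as the nonnegative functions 1 - cos and 1 - sin; this
    returns to cosine and sine themselves. *)
Lemma Rintegral_one_sub (g : R -> R) (c : R) : measurable_fun setT g -> (forall x, `|g x| <= 1) ->
  (\int[P]_x (1 - g x)%:E = c%:E)%E -> \int[P]_x g x = 1 - c.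
Proof.
move=> mg g1 H.
have i1 : P.-integrable setT (EFin \o cst 1).
  by apply: finite_measure_integrable_cst.
have ig : P.-integrable setT (EFin \o g).
  apply: le_integrable i1 => //; first exact/measurable_EFinP.
  by move=> x _; rewrite /= lee_fin normr1.
have -> : \int[P]_x g x = \int[P]_x (cst 1 x) - \int[P]_x (1 - g x).
  rewrite -RintegralB //.
  - by apply: eq_Rintegral => x _; rewrite /= opprB addrC subrK.
  - exact: (integrableB measurableT i1 ig).
rewrite Rintegral_cst // mul1r /Rintegral H /=.
have P1 := probability_setT P.
by rewrite [X in fine X]P1.
Qed.

Lemma characteristic_function_quantile : exists Q : probability (measurableTypeR R) R,
  forall t, characteristic_function Q t =
    (1 - \int[mu]_(x in `[0%R, +oo[) (t * sin (t * x) * S x))%:C.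
Proof.
exists P => t; rewrite /characteristic_function /Cintegral.
congr (_ +i* _).
- apply: Rintegral_one_sub => [|x|].
  + apply: continuous_measurable_fun => x.
    exact: is_derive_continuous (is_derive_cosM t x).
  + exact: cos_max.
  + rewrite integral_P_one_sub_cos fineK //.
    by apply: integrable_fin_num => //; exact: iS.
- rewrite (@Rintegral_one_sub _ 1) ?subrr //.
  + exact: measurable_sinM.
  + by move=> x; exact: sin_max.
  + exact: integral_P_one_sub_sin.
Qed.

End LawOfQuantile.

(** * Limits of the products on the imaginary axis *)

Section RealLimits.
Variable R : realType.

Lemma cvg_normc_real (f : R[i]) (u : nat -> R) :
  (forall e : R, 0 < e -> exists N0, forall N, (N0 <= N)%N -> normc (f - (u N)%:C) < e) ->
  f = (complex.Re f)%:C /\ u @ \oo --> complex.Re f.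
Proof.
move=> H; split.
  have If : complex.Im f = 0.
    apply/eqP; rewrite -normr_eq0 eq_le normr_ge0 andbT; apply/ler_addgt0Pl => e e0.
    have [N0 /(_ N0 (leqnn _)) h] := H e e0; rewrite addr0 ltW //.
    by apply: le_lt_trans h; rewrite (le_trans _ (le_Im_normc _)) // ImB /= subr0.
  by case: f If {H} => x y /= ->.
apply/cvgrPdist_lt => e e0; have [N0 HN] := H e e0.
exists N0 => // N /= /HN; apply: le_lt_trans.
by rewrite (le_trans _ (le_Re_normc _)) // ReB.
Qed.

Lemma pprod_nondecreasing (a : nat -> R) t :
  {homo (pprod a ^~ t) : n m / (n <= m)%N >-> n <= m}.
Proof.
apply: homo_leq => [x|y x z|n]; [exact: lexx|exact: le_trans|].
have p1 := pprod_ge1 a n t.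
by rewrite /pprod big_ord_recr /= -/(pprod a n t) ler_peMr ?lerDl ?divr_ge0 ?sqr_ge0 // (le_trans ler01).
Qed.

End RealLimits.

Theorem proposition2p3 (R : realType) (g h : R[i] -> R[i]) (a b : nat -> R)
  (g_entire : entire g) (h_entire : entire h)
  (g_even : even_fun g) (h_even : even_fun h)
  (g_order : (0 < growth_order g < 2%:E)%E)
  (h_order : (0 < growth_order h < 2%:E)%E)
  (g0 : g 0 = 1) (h0 : h 0 = 1)
  (a_seq : increasing_positive_seq a) (b_seq : increasing_positive_seq b)
  (g_simple : forall z : R[i], g z = 0 -> simple_zero g z)
  (h_simple : forall z : R[i], h z = 0 -> simple_zero h z)
  (g_zeros : zero_set g =
    [set z | exists n : nat, z = (a n)%:C \/ z = - (a n)%:C])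
  (h_zeros : zero_set h =
    [set z | exists n : nat, z = (b n)%:C \/ z = - (b n)%:C])
  (lt_ab : forall n : nat, a n < b n) :
  exists P : probability (measurableTypeR R) R,
    forall t : R,
      h ('i * t%:C) / g ('i * t%:C) = characteristic_function P t.
Proof.
have /andP[_ go] := g_order; have /andP[_ ho] := h_order.
have gl t := cvg_normc_real (entire_pprod_cvg g_entire g_even go g0 a_seq g_simple g_zeros t).
have hl t := cvg_normc_real (entire_pprod_cvg h_entire h_even ho h0 b_seq h_simple h_zeros t).
have [a0 a_incr _] := a_seq.
have a_gt0 n : 0 < a n by elim: n => // n; move/lt_trans; apply.
(* The constants [pprod a N (a 0)] of [tail_spec] increase to this value of [g], which bounds them
   all. *)
pose T := tail a b; pose M := complex.Re (g ('i%C * (a 0%N)%:C)).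
have l0 : 0 < a 0%N / 2 by rewrite divr_gt0.
have pM N : pprod a N (a 0%N) <= M.
  have [_ c] := gl (a 0%N); rewrite /M -(cvg_lim _ c) //.
  apply: nondecreasing_cvgn_le; first exact: pprod_nondecreasing.
  by apply/cvg_ex; eexists; exact: c.
have Tc n x : {for x, continuous (T n)} := is_derive_continuous (is_derive_es (tails a b n) x).
have T0 n x : 0 <= x -> 0 <= T n x by exact: tail_ge0.
have T1 n x : 0 <= x -> T n x <= 1 by exact: tail_le1.
have TM n x : 0 <= x -> T n x <= M * expR (- (a 0%N / 2) * x).
  move=> x0; have [_ _ H] := tail_spec a_gt0 a_incr lt_ab n.
  by apply: le_trans (H x x0) _; rewrite ler_wpM2r ?expR_ge0.
have TS n x : 0 <= x -> T n x <= T n.+1 x by exact: tail_nondecreasing.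
have Tni n x y : 0 <= x -> x <= y -> T n y <= T n x by exact: tail_nonincreasing.
have S_neg x : x < 0 -> lim_tail T x = 0 by move=> x0; rewrite /lim_tail ifN // -ltNge.
have [P HP] : exists P : probability (measurableTypeR R) R, forall t, characteristic_function P t =
    (1 - \int[lebesgue_measure]_(x in `[0%R, +oo[) (t * sin (t * x) * lim_tail T x))%:C.
  apply: (@characteristic_function_quantile R (lim_tail T) (quantile T)).
  - exact: lim_tail_ge0.
  - exact: S_neg.
  - exact: measurable_lim_tail.
  - exact: integrable_sin_lim_tail l0 T0 T1 TM Tni.
  - exact: quantile_ge0 l0 TM.
  - by move=> u; exact: quantile_eq0 l0 Tc T1 TM Tni u.
  - exact: measurable_quantile l0 Tc T1 TM Tni.
  - by move=> u x; exact: lt_quantile l0 Tc T1 TM Tni u x.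
exists P => t; rewrite HP -complexiE.
have [gE gc] := gl t; have [hE hc] := hl t.
set G := complex.Re _ in gE gc; set H := complex.Re _ in hE hc.
have G0 : G != 0.
  have p1 N := pprod_ge1 a N t.
  rewrite gt_eqF // (lt_le_trans ltr01) // -(cvg_lim _ gc) //.
  by apply: limr_ge; [apply/cvg_ex; eexists; exact: gc|apply: nearW; exact: p1].
rewrite gE hE -fmorph_div; congr (_ %:C).
have -> : \int[lebesgue_measure]_(x in `[0%R, +oo[) (t * sin (t * x) * lim_tail T x) = 1 - H / G.
  apply: (Rintegral_sin_lim_tail l0 Tc T0 T1 TM TS Tni (v := fun n => 1 - pprod b n t / pprod a n t)).
  - move=> n; rewrite -(chi_tails a_gt0 a_incr lt_ab) -Rintegral_sin_es //.
    exact: tails_pos.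
  - by apply: cvgB; [exact: cvg_cst|apply: cvgM => //; exact: cvgV].
by rewrite opprB addrC subrK.
Qed.
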